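(* Let $\Omega=\mathbb{R}^3\setminus\bar B(0,1)$. There is a constant $C$ such that for all $t\neq0$ and all radial $f\in L^2(\Omega)+\dot H_0^1(\Omega)$, $$\|e^{it\Delta_D}f\|_{L^\infty(\Omega)}\le \frac{C}{|t|^{3/2}}\,\|f\|_{L^1(\Omega)}.$$
   Context: The (radial) space $\dot H_0^1(\Omega)$ consists of radial functions $f=f(r)$, $r=|x|\ge 1$, that are (locally) absolutely continuous on $[1,\infty)$ with $f(1)=0$ and $\|f'\|_{L^2(r^2dr)}+\|f\|_{L^6(r^2dr)}<\infty$, normed by $\|f'\|_{L^2(r^2dr)}$. $\Delta_D$ is the Dirichlet Laplacian on $\Omega$. On radial functions it is diagonalized by the isometric isomorphism $\mathcal F_0:L^2([1,\infty),s^2ds)\to L^2([0,\infty),d\lambda)$, $$\mathcal F_0f(\lambda)=\sqrt{\tfrac2\pi}\int_1^\infty\frac{\sin\lambda(s-1)}{s}f(s)\,s^2ds,$$ and the Schrödinger propagator is $e^{it\Delta_D}f=\mathcal F_0^*\bigl(e^{-i\lambda^2t}\mathcal F_0f\bigr)$. It is unitary on radial $L^2$, extends isometrically by continuity from $L^2\cap\dot H_0^1$ to radial $\dot H_0^1$, and hence is defined by linearity on radial $L^2+\dot H_0^1$. The inequality is trivial if $\|f\|_{L^1}=\infty$. *)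

(* Defs.v *)
From HB Require Import structures.
From mathcomp Require Import all_boot all_order all_algebra.
From mathcomp Require Import all_classical all_reals all_analysis.
From mathcomp Require Import measurable_realfun.
From mathcomp Require Import complex.

Set Implicit Arguments.
Unset Strict Implicit.
Unset Printing Implicit Defensive.
Import Order.TTheory GRing.Theory Num.Theory.
Import numFieldNormedType.Exports.
Import ComplexField.

Local Open Scope classical_set_scope.
Local Open Scope ring_scope.
Local Open Scope complex_scope.

(* A radial function x |-> f(|x|) on Omega = {x in R^3 : |x| > 1} is represented
   by its complex-valued profile f : R -> R[i]; only the values of f on
   [1, +oo[ matter.  An element of L^p is represented by a Borel function in its
   class; the relations below do not depend on the representative chosen. *)

(* r^2 dr on [1, +oo[; 4 pi times this measure is the image of the Lebesgue
   measure of Omega under x |-> |x|. *)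
Definition radial_measure (R : realType) : set (measurableTypeR R) -> \bar R :=
  fun A => (\int[lebesgue_measure]_(r in A `&` `[1%R, +oo[) (r ^+ 2)%:E)%E.

Section radial_measure_instance.
Context (R : realType).
Local Notation mu := (@radial_measure R).

Let mu0 : mu set0 = 0%E.
Proof. by rewrite /radial_measure set0I integral_set0. Qed.

Let mu_ge0 (A : set (measurableTypeR R)) : (0 <= mu A)%E.
Proof. by apply: integral_ge0 => r _; rewrite lee_fin sqr_ge0. Qed.

Let mu_sigma_additive : semi_sigma_additive mu.
Proof.
move=> F mF tF mU; rewrite /radial_measure setI_bigcupl.
rewrite ge0_integral_bigcup//=; last first.
- apply/trivIsetP => i j _ _ ij.
  move/trivIsetP : tF => /(_ i j Logic.I Logic.I ij).
  by rewrite setIACA => ->; rewrite set0I.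
- by move=> r _; rewrite lee_fin sqr_ge0.
- apply/measurable_EFinP; exact: exprn_measurable.
- by move=> n; apply: measurableI => //; exact: measurable_itv.
apply: is_cvg_ereal_nneg_natsum => n _.
by apply: integral_ge0 => r _; rewrite lee_fin sqr_ge0.
Qed.

HB.instance Definition _ :=
  isMeasure.Build _ _ _ mu mu0 mu_ge0 mu_sigma_additive.

End radial_measure_instance.

(* d lambda on [0, +oo[ *)
Definition spectral_measure (R : realType) :
    {measure set (measurableTypeR R) -> \bar R} :=
  mrestr lebesgue_measure (measurable_itv `[0%R : R, +oo[).

Section complex_valued_functions.
Context (R : realType).
Implicit Types (mu : {measure set (measurableTypeR R) -> \bar R}).
Implicit Types (D : set (measurableTypeR R)) (f g : R -> R[i]) (p : \bar R).

Definition cmeasurable D f :=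
  measurable_fun D (fun x : measurableTypeR R => complex.Re (f x)) /\
  measurable_fun D (fun x : measurableTypeR R => complex.Im (f x)).

Definition cLnorm mu p f : \bar R := 'N[mu]_p[EFin \o (@Normc.normc R \o f)].

Definition cintegral mu f : R[i] :=
  (\int[mu]_x complex.Re (f x))%R +i* (\int[mu]_x complex.Im (f x))%R.

Definition cinner mu f g : R[i] := cintegral mu (fun x => f x * (g x)^*).

(* Where Re f or Im f is not derivable (a null set if f is absolutely
   continuous) the value is irrelevant. *)
Definition cderive f : R -> R[i] :=
  fun x => (fun y => complex.Re (f y))^`()%classic x +i*
           (fun y => complex.Im (f y))^`()%classic x.

Definition expi (x : R) : R[i] := cos x +i* sin x.

Definition abs_continuous (a b : R) f :=
  forall e : R, 0 < e -> exists2 d : R, 0 < d &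
  forall (n : nat) (u v : 'I_n -> R),
    (forall i, [/\ a <= u i, u i <= v i & v i <= b]) ->
    trivIset [set: 'I_n] (fun i => `]u i, v i[%classic) ->
    \sum_(i < n) (v i - u i) < d ->
    \sum_(i < n) Normc.normc (f (v i) - f (u i)) < e.

End complex_valued_functions.

Section propagator.
Context (R : realType).
Implicit Types (t : R) (f g h : R -> R[i]).
Local Notation mu := (@radial_measure R).
Local Notation nu := (spectral_measure R).

Definition radial_L2 f := cmeasurable `[1, +oo[ f /\ (cLnorm mu 2%:E f < +oo)%E.

Definition spectral_L2 h :=
  cmeasurable `[0, +oo[ h /\ (cLnorm nu 2%:E h < +oo)%E.

Definition H01_norm f : \bar R := cLnorm mu 2%:E (cderive f).

Definition dotH01 f :=
  [/\ forall b, abs_continuous 1 b f, f 1 = 0,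
      (H01_norm f < +oo)%E & (cLnorm mu 6%:E f < +oo)%E].

Definition F0_integral f (l : R) : R[i] :=
  (Num.sqrt (2 / pi))%:C *
  cintegral mu (fun s => (sin (l * (s - 1)) / s)%:C * f s).

(* h = F_0 f.  The integral defining F_0 need not converge absolutely for
   f in L^2; as for the Plancherel transform, F_0 f is the limit in
   L^2([0, +oo[, d lambda) of the integrals over [1, n]. *)
Definition is_F0 f h :=
  [/\ radial_L2 f, spectral_L2 h &
      (fun n : nat => cLnorm nu 2%:E
         (F0_integral (fun s => if s <= n%:R then f s else 0) \- h))
        @ \oo --> 0%E].

(* g = F_0^* h, where F_0^* is the Hilbert space adjoint of F_0 *)
Definition is_F0_adjoint h g :=
  [/\ spectral_L2 h, radial_L2 g &
      forall phi psi, is_F0 phi psi -> cinner mu g phi = cinner nu h psi].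

(* g = e^{i t Delta_D} f for f in L^2 *)
Definition is_propagator_L2 t f g :=
  exists2 h, is_F0 f h &
    is_F0_adjoint (fun l => expi (- (l ^+ 2 * t)) * h l) g.

(* g = e^{i t Delta_D} f for f in \dot H^1_0, by continuous extension from
   L^2 \cap \dot H^1_0 *)
Definition is_propagator_H01 t f g :=
  [/\ dotH01 f, dotH01 g & exists f_ g_ : nat -> R -> R[i],
    [/\ forall n, [/\ radial_L2 (f_ n), dotH01 (f_ n), dotH01 (g_ n) &
                      is_propagator_L2 t (f_ n) (g_ n)],
        (fun n => H01_norm (f_ n \- f)) @ \oo --> 0%E &
        (fun n => H01_norm (g_ n \- g)) @ \oo --> 0%E]].

Definition L2_plus_H01 f :=
  exists f1 f2, [/\ radial_L2 f1, dotH01 f2 &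
                    {ae mu, forall r, f r = f1 r + f2 r}].

(* g = e^{i t Delta_D} f for f in L^2 + \dot H^1_0, by linearity *)
Definition is_propagator t f g :=
  exists f1 f2 g1 g2,
    [/\ is_propagator_L2 t f1 g1, is_propagator_H01 t f2 g2,
        {ae mu, forall r, f r = f1 r + f2 r} &
        {ae mu, forall r, g r = g1 r + g2 r}].

(* the norms of L^1(Omega) and L^oo(Omega) *)
Definition L1_norm f : \bar R := ((4 * pi)%:E * cLnorm mu 1%:E f)%E.

Definition Loo_norm f : \bar R := cLnorm mu +oo%E f.

End propagator.

(* Main.v *)
Require Import Defs.
From HB Require Import structures.
From mathcomp Require Import all_boot all_order all_algebra.
From mathcomp Require Import all_classical all_reals all_analysis.
From mathcomp Require Import measurable_realfun ess_sup_inf complex.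
From mathcomp Require Import ring lra.
Import Order.TTheory GRing.Theory Num.Theory.
Import numFieldNormedType.Exports.
Set Implicit Arguments.
Unset Strict Implicit.
Unset Printing Implicit Defensive.
Local Open Scope classical_set_scope.
Local Open Scope ring_scope.

(** On the half-line x = r - 1 >= 0, the profile U(x) = r f(r) of a radial
   function turns the Dirichlet Laplacian into the second derivative with
   U(0) = 0, and F_0 into the sine transform.  By the method of images the
   propagator then has the kernel
     c |t|^(-1/2) (exp(i (x - y)^2 / 4 t) - exp(i (x + y)^2 / 4 t)),
   whose two phases differ by x y / t; hence it is at most C |t|^(-3/2) x y.
   Since x |U(x)| <= r^2 |f(r)|, integrating it against U gives at most
   C |t|^(-3/2) y times the L^1 norm of f, and the estimate follows upon
   dividing by y + 1 >= y.

   The propagator is only characterised by duality, so the kernel is first met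
   in regularised form.  The Dirichlet heat kernel heat_odd e y has, up
   to a constant factor, the transform sin(l y) exp(- e l^2) (is_F0_test), and
   testing the solution against it brings in the complex Gaussian exp(- (e - i t) l^2)
   (propagator_L2_propagated).  The cosine transform of this Gaussian is found
   from differential equations in z and in t (EcE, EsE, Ec_Es_sqr), and the
   resulting kernels satisfy the bound above uniformly in e > 0 (Ec_dispersive,
   Es_dispersive).

   The pairing identity is linear, and it survives limits in energy norm: the
   energy controls the supremum (dirichlet_energy_sup, which rests on the
   fundamental theorem of calculus ac_ftc for absolutely continuous functions),
   while the kernels decay fast.  Thus it holds on the whole of L^2 + H^1_0
   (propagator_propagated).

   Finally e tends to 0.  Averaged over y in [p, q], the heat kernels tend to
   the indicator of [p, q], so that the averages of the solution over short
   intervals obey the estimate (interval_average); Lebesgue differentiation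
   makes it pointwise (profile_bound_ae).  The argument is carried out on real
   and imaginary parts separately. *)

(** * Real and imaginary parts *)

Section complex_modulus.
Context {R : realType}.
Implicit Types z w : R[i].

Lemma normc_sqr z : Normc.normc z ^+ 2 = complex.Re z ^+ 2 + complex.Im z ^+ 2.
Proof. by case: z => a b /=; rewrite sqr_sqrtr// addr_ge0 ?sqr_ge0. Qed.

Lemma normc_ge0 z : 0 <= Normc.normc z.
Proof. by case: z => a b /=. Qed.

Lemma Re_le_normc z : `|complex.Re z| <= Normc.normc z.
Proof. by case: z => x y /=; rewrite -sqrtr_sqr ler_wsqrtr// lerDl sqr_ge0. Qed.

Lemma Im_le_normc z : `|complex.Im z| <= Normc.normc z.
Proof. by case: z => x y /=; rewrite -sqrtr_sqr ler_wsqrtr// lerDr sqr_ge0. Qed.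

Lemma normc_le_Re_Im z : Normc.normc z <= `|complex.Re z| + `|complex.Im z|.
Proof.
rewrite -(@ler_pXn2r _ 2) ?nnegrE ?normc_ge0 ?addr_ge0// normc_sqr.
rewrite -[complex.Re z ^+ 2]real_normK ?num_real//.
rewrite -[complex.Im z ^+ 2]real_normK ?num_real//.
by rewrite sqrrD lerD2r lerDl mulrn_wge0// mulr_ge0.
Qed.

Lemma Re_sub z w : complex.Re (z - w) = complex.Re z - complex.Re w.
Proof. by case: z w => [? ?] [? ?]. Qed.

Lemma Im_sub z w : complex.Im (z - w) = complex.Im z - complex.Im w.
Proof. by case: z w => [? ?] [? ?]. Qed.

Lemma Re_realM (a : R) z : complex.Re (a%:C%C * z) = a * complex.Re z.
Proof. by case: z => x y /=; rewrite mul0r subr0. Qed.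

Lemma Im_realM (a : R) z : complex.Im (a%:C%C * z) = a * complex.Im z.
Proof. by case: z => x y /=; rewrite mul0r addr0. Qed.

Lemma Re_expi_mul (a : R) z :
  complex.Re (expi (- a) * z) = cos a * complex.Re z + sin a * complex.Im z.
Proof. by case: z => p q; rewrite /expi /= cosN sinN; ring. Qed.

Lemma Im_expi_mul (a : R) z :
  complex.Im (expi (- a) * z) = cos a * complex.Im z - sin a * complex.Re z.
Proof. by case: z => p q; rewrite /expi /= cosN sinN; ring. Qed.

End complex_modulus.

(** * Variation of absolutely continuous functions *)

Section interval_families.
Context {R : realType}.
Implicit Types (a b : R) (f : R -> R) (p q : R * R) (s : seq (R * R)).

(** Families of intervals are lists of pairs of endpoints, which can be
   concatenated and refined by induction; touching endpoints are allowed. *)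
Definition apart p q := (p.2 <= q.1) || (q.2 <= p.1).

Definition nonoverlapping a b s :=
  all (fun p => [&& a <= p.1, p.1 <= p.2 & p.2 <= b]) s && pairwise apart s.

Definition total_length s := \sum_(p <- s) (p.2 - p.1).

Definition increments f s := \sum_(p <- s) `|f p.2 - f p.1|.

(** The last inequality is not strict, so that it passes to suprema. *)
Definition ac_on a b f := forall e : R, 0 < e -> exists2 d : R, 0 < d &
  forall s, nonoverlapping a b s -> total_length s < d -> increments f s <= e.

Fixpoint partition_steps (a : R) (l : seq R) : seq (R * R) :=
  if l is x :: l' then (a, x) :: partition_steps x l' else [::].

Lemma partition_steps_nonoverlapping a b l : itv_partition a b l ->
  nonoverlapping a b (partition_steps a l).
Proof.
elim: l a => // x l ih a abl; have xbl := itv_partition_cons abl.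
case: abl => /= /andP[ax pxl] _.
have /andP[al pl] := ih _ xbl.
have xb := itv_partition_le xbl.
rewrite /nonoverlapping /= lexx (ltW ax) xb pl andbT /=; apply/andP; split; last first.
  by rewrite andbT; apply: sub_all al => p /and3P[xp _ _]; rewrite /apart /= xp.
by apply: sub_all al => p /and3P[xp -> ->]; rewrite (le_trans (ltW ax) xp).
Qed.

Lemma partition_steps_length a b l : itv_partition a b l ->
  total_length (partition_steps a l) = b - a.
Proof.
rewrite /total_length.
elim: l a => [a /itv_partition_nil ->|x l ih a abl]; first by rewrite big_nil subrr.
by rewrite /= big_cons (ih _ (itv_partition_cons abl)) /=; ring.
Qed.

Lemma partition_steps_increments a b f l : itv_partition a b l ->
  increments f (partition_steps a l) = variation a b f l.
Proof.
move=> abl; rewrite (variation_zip _ abl) /increments.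
elim: l a abl => [a _|x l ih a abl]; first by rewrite /= !big_nil.
by rewrite /= !big_cons (ih _ (itv_partition_cons abl)).
Qed.

Lemma nonoverlapping_cat a b s s' : nonoverlapping a b s ->
  nonoverlapping a b s' -> (forall p q, p \in s -> q \in s' -> apart p q) ->
  nonoverlapping a b (s ++ s').
Proof.
move=> /andP[a1 p1] /andP[a2 p2] h.
rewrite /nonoverlapping all_cat a1 a2 pairwise_cat p1 p2 !andbT /=.
by apply/allrelP => p q; exact: h.
Qed.

End interval_families.

Section variation_of_ac.
Context {R : realType}.
Implicit Types (a b : R) (f : R -> R) (s : seq (R * R)).
Local Notation TV := total_variation.

(** If increments over total length d are at most 1, then an interval of length
   d / 2 carries variation at most 1, and finitely many of them cover [a, b]. *)
Lemma ac_total_variation_fin a b f : a <= b -> ac_on a b f ->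
  TV a b f \is a fin_num.
Proof.
move=> ab acf; have [d d0 dP] := acf 1 ltr01.
have small x y : a <= x -> x <= y -> y <= b -> y - x < d ->
    (TV x y f \is a fin_num).
  move=> ax xy yb yxd; rewrite ge0_fin_numE ?total_variation_ge0//.
  apply: (@le_lt_trans _ _ 1%:E); last exact: ltry.
  apply: ge_ereal_sup => _ [_ [l xyl <-] <-]; rewrite lee_fin.
  rewrite -(partition_steps_increments _ xyl); apply: dP.
    have /andP[al pl] := partition_steps_nonoverlapping xyl.
    rewrite /nonoverlapping pl andbT; apply: sub_all al => p /and3P[xp -> py].
    by rewrite (le_trans ax xp) (le_trans py yb).
  by rewrite (partition_steps_length xyl).
pose n := Num.truncn ((b - a) / (d / 2)).
have d2 : 0 < d / 2 by lra.
have nP : b - a < n.+1%:R * (d / 2).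
  by rewrite -ltr_pdivrMr// truncnS_gt.
have main k x : a <= x -> x <= b -> x - a < k.+1%:R * (d / 2) ->
    TV a x f \is a fin_num.
  elim: k x => [x ax xb xad|k ih x ax xb xad].
    by apply: small => //; rewrite mul1r in xad; lra.
  pose y := Num.max a (x - d / 2).
  have ay : a <= y by rewrite /y le_max lexx.
  have yx : y <= x by rewrite /y ge_max ax /=; lra.
  rewrite (total_variationD f ay yx) fin_numD ih//=; last 2 first.
  - by rewrite (le_trans yx).
  - have : 0 < k.+1%:R * (d / 2) by rewrite mulr_gt0.
    rewrite /y /Num.max; case: ifPn => _; last by rewrite subrr.
    by rewrite -natr1 mulrDl mul1r in xad; move=> _; lra.
  apply: small => //.
  have : x - d / 2 <= y by rewrite /y le_max lexx orbT.
  lra.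
exact: (main n b).
Qed.

Lemma near_total_variation a b f (e : R) : a <= b -> 0 < e ->
  TV a b f \is a fin_num -> exists s, [/\ nonoverlapping a b s,
    total_length s = b - a & fine (TV a b f) - e <= increments f s].
Proof.
move=> ab e0 tvf.
have [_ [_ [l abl <-] <-] hl] := ub_ereal_sup_adherent e0 tvf.
exists (partition_steps a l); split.
- exact: partition_steps_nonoverlapping.
- exact: partition_steps_length.
- rewrite (partition_steps_increments _ abl) -lee_fin EFinB fineK//.
  exact: ltW hl.
Qed.

Lemma total_variation_fin_sub a b f x y : a <= x -> x <= y -> y <= b ->
  TV a b f \is a fin_num -> TV x y f \is a fin_num.
Proof.
move=> ax xy yb.
rewrite (total_variationD f (le_trans ax xy) yb) (total_variationD f ax xy).
by rewrite !fin_numD => /andP[/andP[_ h] _].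
Qed.

Lemma fine_total_variationB a b f x y : a <= x -> x <= y -> y <= b ->
  TV a b f \is a fin_num ->
  fine (TV a y f) - fine (TV a x f) = fine (TV x y f).
Proof.
move=> ax xy yb tvf.
rewrite (total_variationD f ax xy) fineD.
- by rewrite addrAC subrr add0r.
- exact: (total_variation_fin_sub (lexx a) ax (le_trans xy yb) tvf).
- exact: (total_variation_fin_sub ax xy yb tvf).
Qed.

(** Each interval is replaced by a partition that attains its variation up to
   e; the clause placing every new interval inside an old one keeps the pieces
   of different intervals apart. *)
Lemma refine_nonoverlapping a b f s (e : R) : 0 < e ->
  TV a b f \is a fin_num -> nonoverlapping a b s ->
  exists s', [/\ nonoverlapping a b s', total_length s' = total_length s,
    forall q, q \in s' -> exists2 p, p \in s & (p.1 <= q.1) /\ (q.2 <= p.2) &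
    \sum_(p <- s) fine (TV p.1 p.2 f) - (size s)%:R * e <= increments f s'].
Proof.
move=> e0 tvf; elim: s => [_|p s ih].
  by exists [::]; split => //; rewrite /increments !big_nil mul0r subr0.
rewrite /nonoverlapping /= => /andP[/andP[/and3P[ap pp pb] als] /andP[pals ps]].
have [|s' [ns' ls' cs' is']] := ih; first by rewrite /nonoverlapping als ps.
have [|r [nr lr ir]] := near_total_variation pp e0 (f := f).
  exact: total_variation_fin_sub tvf.
have /andP[ar pr] := nr.
exists (r ++ s'); split.
- apply: nonoverlapping_cat => //.
    rewrite /nonoverlapping pr andbT; apply: sub_all ar => q /and3P[pq -> qp].
    by rewrite (le_trans ap pq) (le_trans qp pb).
  move=> q q' qr /cs'[p' p's [p'q' q'p']].
  have /and3P[h1 _ h2] := allP ar _ qr.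
  have := allP pals _ p's; rewrite /apart => /orP[h|h]; apply/orP.
    by left; lra.
  by right; lra.
- by rewrite /total_length big_cat big_cons /= -!/(total_length _) lr ls'.
- move=> q; rewrite mem_cat => /orP[qr|/cs'[p' p's h]].
    exists p; first by rewrite inE eqxx.
    by have /and3P[h1 _ h2] := allP ar _ qr.
  by exists p' => //; rewrite inE p's orbT.
- rewrite /increments big_cat big_cons /= -!/(increments _ _).
  rewrite -natr1 mulrDl mul1r; lra.
Qed.

(** A function and its variation are absolutely continuous together: a family
   of short intervals can be refined by partitions that nearly attain the
   variation on each of them, without changing its total length. *)
Lemma ac_on_total_variation a b f : a <= b -> ac_on a b f ->
  ac_on a b (fun x => fine (TV a x f)).
Proof.
move=> ab acf e e0; have e2 : 0 < e / 2 by lra.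
have tvf := ac_total_variation_fin ab acf.
have [d d0 dP] := acf _ e2; exists d => // s ns sd.
pose e' := e / 2 / (size s).+1%:R.
have e'0 : 0 < e' by rewrite divr_gt0.
have [s' [ns' ls' _ is']] := refine_nonoverlapping e'0 tvf ns.
have /(_ ns') := dP s'; rewrite ls' => /(_ sd) h.
have he' : (size s)%:R * e' <= e / 2.
  rewrite /e' mulrCA ger_pMr// ler_pdivrMr// mul1r ler_nat.
  exact: leqnSn.
suff -> : increments (fun x => fine (TV a x f)) s =
          \sum_(p <- s) fine (TV p.1 p.2 f) by lra.
have /andP[/allP als _] := ns.
rewrite /increments !big_seq; apply: eq_bigr => p /als/and3P[ap pp pb].
rewrite (fine_total_variationB ap pp pb)// ger0_norm//.
exact/fine_ge0/total_variation_ge0.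
Qed.

End variation_of_ac.

(** * Densities of absolutely continuous functions *)

Section ac_density.
Context {R : realType}.
Local Notation lambda := (@lebesgue_measure R).

Lemma ac_on_Re_Im a b (f : R -> R[i]) : abs_continuous a b f ->
  ac_on a b (fun x => complex.Re (f x)) /\ ac_on a b (fun x => complex.Im (f x)).
Proof.
move=> acf.
suff main e : 0 < e -> exists2 d : R, 0 < d &
    forall s, nonoverlapping a b s -> total_length s < d ->
    \sum_(p <- s) Normc.normc (f p.2 - f p.1) <= e.
  split=> e /main[d d0 dP]; exists d => // s /dP/[apply]; apply: le_trans;
    by apply: ler_sum => p _; rewrite -?Re_sub -?Im_sub ?Re_le_normc ?Im_le_normc.
move=> /acf[d d0 dP]; exists d => // s /andP[/allP als /(pairwiseP (0, 0)) ps] sd.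
pose p (i : 'I_(size s)) := nth (0, 0) s i.
have sum_ord (F : R * R -> R) : \sum_(q <- s) F q = \sum_(i < size s) F (p i).
  by rewrite (big_nth (0, 0)) big_mkord.
rewrite sum_ord; apply/ltW.
apply: (dP _ (fun i => (p i).1) (fun i => (p i).2)).
- move=> i; have := als (p i); rewrite mem_nth// => /(_ erefl)/and3P[? ? ?].
  by split.
- apply/trivIsetP => /= i j _ _ ij.
  wlog lt_ij : i j ij / (i < j)%N.
    move=> h; move: (ij); rewrite -val_eqE neq_ltn => /orP[|] ?; first exact: h.
    by rewrite setIC h// eq_sym.
  have := ps i j; rewrite !inE => /(_ (ltn_ord i) (ltn_ord j) lt_ij).
  rewrite -!/(p _) => sep; rewrite -subset0 => x [] /=.
  rewrite !in_itv/= => /andP[h1 h2] /andP[h3 h4].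
  by move: sep; rewrite /apart => /orP[] ?; lra.
- by rewrite -(sum_ord (fun q => q.2 - q.1)).
Qed.

Lemma ac_on_continuous a b (f : R -> R) e : ac_on a b f -> 0 < e ->
  exists2 d, 0 < d & forall x y, a <= x -> x <= y -> y <= b -> y - x < d ->
    `|f y - f x| <= e.
Proof.
move=> acf /acf[d d0 dP]; exists d => // x y ax xy yb yxd.
have := dP [:: (x, y)].
rewrite /nonoverlapping /total_length /increments /= !big_seq1 /= ax xy yb.
by apply.
Qed.

(** Composition with this projection extends a function on [a, b] by constants,
   which makes it the distribution function of a measure on the line. *)
Definition clamp (a b x : R) := Num.max a (Num.min b x).

Lemma clamp_itv a b x : a <= b -> a <= clamp a b x <= b.
Proof. by move=> ab; rewrite /clamp le_max lexx ge_max ab ge_min lexx. Qed.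

Lemma clamp_id a b x : a <= x -> x <= b -> clamp a b x = x.
Proof. by move=> ax xb; rewrite /clamp min_r// max_r. Qed.

Lemma le_clamp a b x y : x <= y -> clamp a b x <= clamp a b y.
Proof.
move=> xy; rewrite /clamp; have [?|?] := leP b x; have [?|?] := leP b y;
  have [?|?] := leP a b; have [?|?] := leP a x; have [?|?] := leP a y; lra.
Qed.

Lemma clampB a b x y : x <= y -> clamp a b y - clamp a b x <= y - x.
Proof.
move=> xy; rewrite /clamp; have [?|?] := leP b x; have [?|?] := leP b y;
  have [?|?] := leP a b; have [?|?] := leP a x; have [?|?] := leP a y; lra.
Qed.

(** Finite measure makes I bounded; I then lies between the open and the
   half-open interval from inf I to sup I, which have the same length. *)
Lemma open_itv_endpoints (I : set R) (d : R) : open I -> is_interval I ->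
  (lambda I < d%:E)%E -> exists u v, [/\ u <= v, I `<=` `]u, v]%classic,
    `]u, v[%classic `<=` I & (v - u)%:E = lambda I].
Proof.
move=> oI iI Id.
have [->|/set0P I0] := eqVneq I set0.
  exists 0, 0; split => //; first by rewrite set_itv_ge// bnd_simp ltxx.
  by rewrite subrr measure0.
have mI : measurable I by exact: open_measurable.
have d0 : 0 < d by rewrite -lte_fin (le_lt_trans _ Id)// measure_ge0.
have bnd x y : I x -> I y -> x <= y -> y - x < d.
  move=> Ix Iy xy; rewrite -lte_fin (le_lt_trans _ Id)//.
  have -> : (y - x)%:E = lambda `[x, y]%classic.
    rewrite lebesgue_measure_itv/= lte_fin; case: ltgtP xy => // ->.
    by rewrite subrr.
  apply: le_measure; rewrite ?inE//.
  by move=> z /=; rewrite in_itv/= => /andP[xz zy]; apply: (iI x y) => //; rewrite xz.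
have [x0 Ix0] := I0.
have ubI : has_ubound I.
  exists (x0 + d) => y Iy; have [yx|xy] := leP y x0; first lra.
  have := bnd _ _ Ix0 Iy (ltW xy); lra.
have lbI : has_lbound I.
  exists (x0 - d) => y Iy; have [yx|xy] := leP x0 y; first lra.
  have := bnd _ _ Iy Ix0 (ltW xy); lra.
have supI : has_sup I by [].
have infI : has_inf I by [].
have sub1 : `]inf I, sup I[%classic `<=` I.
  move=> z /=; rewrite in_itv/= => /andP[uz zv].
  have [x Ix xz] := inf_lt I0 uz; have [y Iy zy] := sup_gt I0 zv.
  by apply: (iI x y) => //; rewrite (ltW xz) (ltW zy).
have sub2 : I `<=` `]inf I, sup I]%classic.
  move=> z Iz /=; rewrite in_itv/= (ub_le_sup ubI Iz) andbT lt_neqAle.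
  rewrite (ge_inf lbI Iz) andbT; apply/eqP => zI.
  have [e /= e0 eI] : nbhs z I by apply: open_nbhs_nbhs.
  have : I (z - e / 2).
    apply: eI => /=; rewrite opprB addrC subrK ger0_norm; lra.
  by move/(ge_inf lbI); rewrite zI; lra.
have uv : inf I <= sup I.
  by rewrite (le_trans (ge_inf lbI Ix0))// ub_le_sup.
exists (inf I), (sup I); split => //.
apply/eqP; rewrite eq_le; apply/andP; split.
  have -> : (sup I - inf I)%:E = lambda `]inf I, sup I[%classic.
    rewrite lebesgue_measure_itv/= lte_fin; case: ltgtP uv => // ->.
    by rewrite subrr.
  by apply: le_measure; rewrite ?inE.
have -> : (sup I - inf I)%:E = lambda `]inf I, sup I]%classic.
  rewrite lebesgue_measure_itv/= lte_fin; case: ltgtP uv => // ->.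
  by rewrite subrr.
by apply: le_measure; rewrite ?inE.
Qed.

Lemma lebesgue_stieltjes_itv_oc (F : cumulative R R) u v : u <= v ->
  lebesgue_stieltjes_measure F `]u, v]%classic = (F v - F u)%:E.
Proof.
move=> uv; rewrite /lebesgue_stieltjes_measure/= /measure_extension/=.
rewrite measurable_mu_extE/=; last exact: is_ocitv.
by rewrite wlength_itv_bnd.
Qed.

(** Cover a null set by an open set of small length and cut the latter into
   disjoint open intervals: absolute continuity bounds the Stieltjes mass of
   finitely many of them, uniformly. *)
Lemma stieltjes_ac a b (F : cumulative R R) (G : R -> R) : a < b ->
  ac_on a b G -> (forall x, F x = G (clamp a b x)) ->
  forall B, measurable B -> lambda B = 0%E ->
  lebesgue_stieltjes_measure F B = 0%E.
Proof.
move=> ab acG FG B mB B0.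
apply/eqP; rewrite eq_le measure_ge0 andbT; apply/lee_addgt0Pr => e e0.
rewrite add0e; have [d d0 dP] := acG _ e0.
have [|U [oU BU UBd]] := lebesgue_regularity_outer mB _ d0.
  by apply: (@le_lt_trans _ _ 0%E); [rewrite -B0|exact: ltry].
have mU : measurable U by exact: open_measurable.
have Ud : (lambda U < d%:E)%E.
  rewrite -(setDUK BU); apply: (le_lt_trans _ UBd).
  apply: (le_trans (measureU2 _ _ _)) => //; first exact: measurableD.
  by rewrite -[leRHS]add0e; apply: leeD2r; rewrite -B0.
pose I := open_disjoint_itv oU.
have UE : U = \bigcup_k I k by exact: open_disjoint_itv_bigcup.
have tI : trivIset setT I by exact: open_disjoint_itv_trivIset.
have mI k : measurable (I k).
  by apply: open_measurable; exact: open_disjoint_itv_open.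
have Id k : (lambda (I k) < d%:E)%E.
  apply: le_lt_trans Ud; apply: le_measure; rewrite ?inE; [exact: mI|exact: mU|].
  by rewrite UE; exact: bigcup_sup.
have ends k := @open_itv_endpoints (I k) d (@open_disjoint_itv_open R U oU k)
  (@open_disjoint_itv_is_interval R U oU k) (Id k).
have /choice[u /choice[v uvP]] := ends.
have uv k : u k <= v k by have [] := uvP k.
(* an empty interval may have been given endpoints inside another one *)
pose p k := if u k < v k then (clamp a b (u k), clamp a b (v k)) else (a, a).
have clampI x : a <= clamp a b x /\ clamp a b x <= b.
  by apply/andP/clamp_itv/ltW.
have pI k : [&& a <= (p k).1, (p k).1 <= (p k).2 & (p k).2 <= b].
  rewrite /p; case: ifP => _ /=; last by rewrite lexx ltW.
  by rewrite (clampI _).1 (clampI _).2 le_clamp.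
have apartP j k : (j < k)%N -> apart (p j) (p k).
  move=> jk; have [_ _ Ij _] := uvP j; have [_ _ Ik _] := uvP k.
  have /and3P[aj _ _] := pI j; have /and3P[ak _ _] := pI k.
  rewrite /apart; move: aj ak; rewrite /p.
  case: ifPn => [ltj _|_ _ ->]; last by [].
  case: ifPn => [ltk _|_ _]; last by rewrite /= (clampI _).1 orbT.
  suff [h|h] : v j <= u k \/ v k <= u j.
  - by apply/orP; left; exact: le_clamp.
  - by apply/orP; right; exact: le_clamp.
  have [|ukvj] := leP (v j) (u k); first by left.
  have [|ujvk] := leP (v k) (u j); first by right.
  pose m := Num.max (u j) (u k); pose M := Num.min (v j) (v k).
  have mM : m < M by rewrite /m /M gt_max !lt_min ltj ltk ukvj ujvk.
  have [m1 m2] : u j <= m /\ u k <= m by rewrite /m !le_max !lexx orbT.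
  have [M1 M2] : M <= v j /\ M <= v k by rewrite /M !ge_min !lexx orbT.
  have /trivIsetP/(_ j k Logic.I Logic.I) := tI.
  rewrite neq_ltn jk => /(_ isT); rewrite -subset0 => /(_ ((m + M) / 2)).
  by case; split; [apply: Ij|apply: Ik]; rewrite /= in_itv/=; apply/andP; split; lra.
pose s n := [seq p k | k <- iota 0 n].
have ns n : nonoverlapping a b (s n).
  rewrite /nonoverlapping; apply/andP; split.
    by apply/allP => _ /mapP[k _ ->] /=; exact: pI.
  apply/(pairwiseP (0, 0)) => i j; rewrite !inE size_map size_iota => ni nj ij.
  rewrite !(nth_map 0%N) ?size_iota// !nth_iota// !add0n.
  exact: apartP.
have ls n : total_length (s n) < d.
  rewrite -lte_fin; apply: le_lt_trans Ud.
  rewrite /total_length big_map -sumEFin.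
  apply: (@le_trans _ _ (\sum_(k <- iota 0 n) lambda (I k))%E).
    apply: lee_sum => k _; have [_ _ _ <-] := uvP k.
    rewrite lee_fin /p; case: ifPn => _ /=; first exact: clampB.
    by rewrite subrr subr_ge0.
  rewrite UE measure_bigcup//=; last by move=> i _; exact: mI.
  have -> : iota 0 n = index_iota 0 n by rewrite /index_iota subn0.
  rewrite [leLHS](eq_bigl (fun k => k \in [set: nat])); last first.
    by move=> k; rewrite in_setT.
  exact: nneseries_lim_ge.
apply: (@le_trans _ _ (lebesgue_stieltjes_measure F U)); first by apply: le_measure; rewrite ?inE.
rewrite UE measure_bigcup//=; last by move=> i _; exact: mI.
apply: lime_le.
  exact: is_cvg_nneseries.
apply: nearW => n; apply: (@le_trans _ _ (increments G (s n))%:E); last first.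
  by rewrite lee_fin; apply: dP.
rewrite /increments big_map -sumEFin.
rewrite /index_iota subn0 (eq_bigl xpredT); last by move=> k; rewrite in_setT.
apply: lee_sum => k _; have [_ Ik _ _] := uvP k.
apply: (@le_trans _ _ (lebesgue_stieltjes_measure F `]u k, v k]%classic)).
  by apply: le_measure; rewrite ?inE//; exact: mI.
rewrite lebesgue_stieltjes_itv_oc// lee_fin !FG /p.
case: ifPn => [_|]; first exact: ler_norm.
rewrite -leNgt => vu; have -> : u k = v k by apply/eqP; rewrite eq_le uv.
by rewrite !subrr normr0.
Qed.

(** The Stieltjes measure of G does not charge null sets; g is its
   Radon-Nikodym density. *)
Lemma ac_density a b (G : R -> R) : a < b -> ac_on a b G ->
  {in `[a, b] &, {homo G : x y / x <= y}} ->
  exists g : R -> R, lambda.-integrable setT (EFin \o g) /\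
    forall x, a <= x -> x <= b -> G x - G a = \int[lambda]_(t in `[a, x]) g t.
Proof.
move=> ab acG ndG.
pose F0 x := G (clamp a b x).
have clampI x : clamp a b x \in `[a, b] by rewrite in_itv/= clamp_itv// ltW.
have ndF : {homo F0 : x y / x <= y}.
  by move=> x y xy; apply: ndG => //; exact: le_clamp.
have rcF : right_continuous F0.
  move=> x; apply/cvgrPdist_le => e e0.
  have [d d0 dP] := ac_on_continuous acG e0.
  near=> y.
  have xy : x < y by near: y; exact: nbhs_right_gt.
  have yxd : y - x < d.
    rewrite ltrBlDl; near: y; apply: nbhs_right_lt; lra.
  have /andP[h1 _] := clamp_itv x (ltW ab).
  have /andP[_ h2] := clamp_itv y (ltW ab).
  rewrite distrC; apply: dP => //; first exact/le_clamp/ltW.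
  by apply: le_lt_trans yxd; exact/clampB/ltW.
pose F : cumulative R R := HB.pack F0 (isCumulative.Build R _ R F0 ndF rcF).
have Dfin : (lebesgue_stieltjes_measure F `]a, b]%classic < +oo)%E.
  by rewrite lebesgue_stieltjes_itv_oc ?ltry// ltW.
have mab : measurable (`]a, b]%classic : set (measurableTypeR R)).
  exact: measurable_itv.
pose nu : {finite_measure set (measurableTypeR R) -> \bar R} :=
  @mfrestr _ (measurableTypeR R) R _ (lebesgue_stieltjes_measure F) mab Dfin.
have nul : nu `<< lambda.
  move=> N N0 A mA AN; rewrite /nu /= /mfrestr /mrestr.
  apply/eqP; rewrite eq_le measure_ge0 andbT.
  rewrite -(stieltjes_ac ab acG (F := F) _ mA (N0 _ mA AN))//.
  by apply: le_measure; rewrite ?inE//; exact: measurableI.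
pose f := Radon_Nikodym_SigmaFinite.f nu lambda.
have fi : lambda.-integrable setT f.
  exact: Radon_Nikodym_SigmaFinite.f_integrable.
have ffin x : f x \is a fin_num.
  exact: Radon_Nikodym_SigmaFinite.f_fin_num.
have fE : EFin \o (fine \o f) = f by apply/funext => x /=; rewrite fineK.
exists (fine \o f); split; first by rewrite fE.
move=> x ax xb; rewrite /Rintegral.
under eq_integral do rewrite fineK//.
rewrite -Radon_Nikodym_SigmaFinite.f_integral//.
rewrite /nu /= /mfrestr /mrestr.
have -> : `[a, x]%classic `&` `]a, b]%classic = `]a, x]%classic :> set R.
  apply/seteqP; split => y /=; rewrite !in_itv/=.
    by move=> [/andP[_ ->] /andP[-> _]].
  by move=> /andP[ay yx]; rewrite ay (ltW ay) yx (le_trans yx xb).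
rewrite lebesgue_stieltjes_itv_oc//= /F0 !clamp_id//.
exact: ltW.
Unshelve. all: by end_near. Qed.

End ac_density.

Section ac_ftc.
Context {R : realType}.
Local Notation lambda := (@lebesgue_measure R).

Lemma ac_onB a b (f g : R -> R) : ac_on a b f -> ac_on a b g ->
  ac_on a b (fun x => f x - g x).
Proof.
move=> acf acg e e0; have e2 : 0 < e / 2 by lra.
have [d d0 dP] := acf _ e2; have [d' d'0 d'P] := acg _ e2.
exists (Num.min d d'); first by rewrite lt_min d0.
move=> s ns; rewrite lt_min => /andP[/(dP _ ns) h /(d'P _ ns) h'].
apply: (@le_trans _ _ (increments f s + increments g s)); last by lra.
rewrite /increments -big_split; apply: ler_sum => p _ /=.
have -> : f p.2 - g p.2 - (f p.1 - g p.1) = (f p.2 - f p.1) - (g p.2 - g p.1).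
  by ring.
exact: ler_normB.
Qed.

(** If V is the variation of f, then V and V - f are both nondecreasing and
   absolutely continuous, so that f is a difference of two functions with a
   density; at Lebesgue points of g the integral of g has derivative g. *)
Lemma ac_ftc a b (f : R -> R) : a < b -> ac_on a b f ->
  exists g : R -> R, [/\ lambda.-integrable setT (EFin \o g),
    forall x, a <= x -> x <= b -> f x - f a = \int[lambda]_(t in `[a, x]) g t &
    {ae lambda, forall x, x \in `]a, b[ -> f^`()%classic x = g x}].
Proof.
move=> ab acf; have ab' := ltW ab.
have tvf := ac_total_variation_fin ab' acf.
pose V x := fine (total_variation a x f).
have acV : ac_on a b V by exact: ac_on_total_variation.
have dV x y : x \in `[a, b] -> y \in `[a, b] -> x <= y ->
    `|f y - f x| <= V y - V x.
  rewrite !in_itv/= => /andP[ax xb] /andP[ay yb] xy.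
  rewrite (fine_total_variationB ax xy yb tvf) -lee_fin fineK.
    exact: total_variation_ge.
  exact: total_variation_fin_sub tvf.
have [g1 [ig1 g1E]] : exists g : R -> R, lambda.-integrable setT (EFin \o g) /\
    forall x, a <= x -> x <= b -> V x - V a = \int[lambda]_(t in `[a, x]) g t.
  apply: ac_density => // x y xab yab xy.
  by rewrite -subr_ge0 (le_trans _ (dV _ _ xab yab xy)).
have [g2 [ig2 g2E]] : exists g : R -> R, lambda.-integrable setT (EFin \o g) /\
    forall x, a <= x -> x <= b ->
      (V x - f x) - (V a - f a) = \int[lambda]_(t in `[a, x]) g t.
  apply: (@ac_density _ a b (fun x => V x - f x)) => //; first exact: ac_onB.
  move=> x y xab yab xy; have := dV _ _ xab yab xy.
  by have := ler_norm (f y - f x); lra.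
have sub (g : R -> R) (A : set R) : measurable A ->
    lambda.-integrable setT (EFin \o g) -> lambda.-integrable A (EFin \o g).
  by move=> mA; apply: integrableS.
pose g x := g1 x - g2 x.
have ig : lambda.-integrable setT (EFin \o g).
  have -> : EFin \o g = ((EFin \o g1) \- (EFin \o g2))%E by [].
  exact: integrableB.
have gE x : a <= x -> x <= b -> f x - f a = \int[lambda]_(t in `[a, x]) g t.
  move=> ax xb; rewrite /g RintegralB//; [|exact: sub|exact: sub].
  by rewrite -g1E// -g2E//; ring.
exists g; split => //.
have locg : locally_integrable setT g.
  by apply: open_integrable_locally => //; exact: openT.
have := @FTC1 R g (BLeft a) (fun y => sub g _ (measurable_itv _) ig) locg.
apply: filterS; first exact: (ae_filter_ringOfSetsType lambda).
move=> x /= h xab; have /andP[ax xb] : a < x < b by move: xab; rewrite in_itv.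
have [dF <-] := h ax.
rewrite !derive1E -[RHS]addr0 -(derive_cst (f a) x 1) -deriveD//.
apply: near_eq_derive; near=> y.
transitivity (\int[lambda]_(t in `[a, y]) g t + f a); last by [].
rewrite -gE ?subrK//.
- by apply: ltW; near: y; exact: lt_nbhsr.
- by apply: ltW; near: y; exact: lt_nbhsl.
Unshelve. all: by end_near. Qed.

End ac_ftc.

(** * Integrals up to null sets, and measures with density *)

Section integral_ae.
Context d (T : measurableType d) (R : realType).
Variable mu : {measure set T -> \bar R}.
Import HBNNSimple.
Local Open Scope ereal_scope.

Lemma ae_mono (P Q : T -> Prop) : (forall x, P x -> Q x) ->
  {ae mu, forall x, P x} -> {ae mu, forall x, Q x}.
Proof.
move=> PQ [N [mN N0 PN]]; exists N; split => // x nQ; apply: PN.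
by apply: contra_not nQ; exact: PQ.
Qed.

Lemma ae_mono2 (P P' Q : T -> Prop) : (forall x, P x -> P' x -> Q x) ->
  {ae mu, forall x, P x} -> {ae mu, forall x, P' x} -> {ae mu, forall x, Q x}.
Proof.
move=> PQ [N [mN N0 PN]] [N' [mN' N'0 PN']]; exists (N `|` N'); split => //.
- exact: measurableU.
- apply/eqP; rewrite eq_le measure_ge0 andbT.
  by apply: (le_trans (measureU2 _ _ _)) => //; rewrite [X in X + _]N0 [X in _ + X]N'0 adde0.
- move=> x nQ; apply: contrapT => /not_orP[nN nN']; apply: nQ.
  apply: PQ; apply: contrapT; last by move/PN'.
  by move/PN.
Qed.

(** The integral is a supremum over simple functions, so that negligible sets
   may be discarded even from non-measurable integrands. *)
Lemma ge0_le_integral_ae (f g : T -> \bar R) : (forall x, 0 <= f x) ->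
  (forall x, 0 <= g x) -> {ae mu, forall x, f x <= g x} ->
  \int[mu]_x f x <= \int[mu]_x g x.
Proof.
move=> f0 g0 [N [mN N0 fgN]].
rewrite ge0_integralTE// [leRHS]ge0_integralTE//.
apply: ge_ereal_sup => _ [h /= hf <-].
have mC : measurable (~` N) by exact: measurableC.
have hCE x : proj_nnsfun h mC x = if x \in ~` N then h x else 0%R.
  by rewrite -mrestrict patchE.
have hC x : (proj_nnsfun h mC x)%:E <= g x.
  rewrite hCE; case: ifPn => [/set_mem xN|_] //.
  apply: (le_trans (hf x)); apply: contrapT => fg.
  by apply: xN; apply: fgN.
apply: ereal_sup_ubound; exists (proj_nnsfun h mC) => //.
rewrite -!integralT_nnsfun; apply: ge0_ae_eq_integral => //.
- exact/measurable_EFinP.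
- exact/measurable_EFinP.
- by move=> x _; rewrite lee_fin.
- by move=> x _; rewrite lee_fin.
exists N; split => // x /not_implyP[_ hx]; apply: contrapT => Nx; apply: hx.
by congr (_%:E); rewrite hCE mem_set.
Qed.

Lemma ge0_eq_integral_ae (f g : T -> \bar R) : (forall x, 0 <= f x) ->
  (forall x, 0 <= g x) -> {ae mu, forall x, f x = g x} ->
  \int[mu]_x f x = \int[mu]_x g x.
Proof.
move=> f0 g0 fg; apply/eqP; rewrite eq_le; apply/andP; split;
  apply: ge0_le_integral_ae => //; move: fg; apply: filterS => x ->; exact: lexx.
Qed.

Lemma eq_integral_ae (f g : T -> \bar R) : {ae mu, forall x, f x = g x} ->
  \int[mu]_x f x = \int[mu]_x g x.
Proof.
move=> fg; rewrite integralE [RHS]integralE; congr (_ - _).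
- apply: ge0_eq_integral_ae => //; move: fg; apply: filterS => x fgx.
  by rewrite !funeposE fgx.
- apply: ge0_eq_integral_ae => //; move: fg; apply: filterS => x fgx.
  by rewrite !funenegE fgx.
Qed.

End integral_ae.

Section integral_density.
Context d (T : measurableType d) (R : realType).
Variables (mu nu : {measure set T -> \bar R}) (w : T -> R).
Hypotheses (mw : measurable_fun setT w) (w0 : forall x, 0 <= w x)
  (nuE : forall A, measurable A -> nu A = (\int[mu]_(x in A) (w x)%:E)%E).
Import HBNNSimple.
Local Open Scope ereal_scope.

Let density_indic (E : set T) : measurable E ->
  \int[nu]_x (\1_E x)%:E = \int[mu]_x ((\1_E x)%:E * (w x)%:E).
Proof.
move=> mE; rewrite integral_indic// setIT nuE// integral_mkcond.
apply: eq_integral => x _; rewrite patchE indicE.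
by case: ifPn => _; rewrite ?mul1e ?mul0e.
Qed.

Let density_nnsfun (h : {nnsfun T >-> R}) :
  \int[nu]_x (h x)%:E = \int[mu]_x ((h x)%:E * (w x)%:E).
Proof.
have mindic r : measurable_fun setT (fun x => (r * \1_(h @^-1` [set r]) x)%:E).
  by apply/measurable_EFinP; exact: measurable_funM.
under eq_integral do rewrite fimfunE -fsumEFin//.
under [RHS]eq_integral.
  move=> x _; rewrite fimfunE -fsumEFin// ge0_mule_fsuml; last first.
    by move=> r; exact: nnfun_muleindic_ge0.
  over.
rewrite ge0_integral_fsum//; last first.
  by move=> r x _; exact: nnfun_muleindic_ge0.
rewrite ge0_integral_fsum//; last 2 first.
- by move=> r; apply: emeasurable_funM => //; exact/measurable_EFinP.
- by move=> r x _; apply: mule_ge0; rewrite ?lee_fin//; exact: nnfun_muleindic_ge0.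
apply: eq_fsbigr => r _.
under eq_integral do rewrite EFinM.
under [RHS]eq_integral do rewrite EFinM -muleA.
have [r0|r0] := leP 0%R r; last first.
  have h0 : h @^-1` [set r] = set0.
    by rewrite -subset0 => x /= hx; have : (0 <= h x)%R by []; rewrite hx leNgt r0.
  by rewrite h0 !integral0_eq// => x _; rewrite indic0 ?mul0e ?mule0.
have mr : measurable (h @^-1` [set r]) by exact: measurable_sfunP.
rewrite !ge0_integralZl//.
- by rewrite density_indic.
- apply: emeasurable_funM; apply/measurable_EFinP => //.
- by move=> x _; apply: mule_ge0; rewrite lee_fin.
- exact/measurable_EFinP.
Qed.

(** By linearity on simple functions, then by monotone convergence. *)
Lemma ge0_integral_density (f : T -> \bar R) : measurable_fun setT f ->
  (forall x, 0 <= f x) -> \int[nu]_x f x = \int[mu]_x (f x * (w x)%:E).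
Proof.
move=> mf f0; pose h := nnsfun_approx measurableT mf.
transitivity (limn (fun n => \int[nu]_x (h n x)%:E)).
  rewrite -monotone_convergence//=.
  - apply: eq_integral => x _; apply/esym/cvg_lim => //.
    exact: cvg_nnsfun_approx.
  - by move=> n; exact/measurable_EFinP.
  - by move=> n x _; rewrite lee_fin.
  - by move=> x _ m n mn; rewrite lee_fin; exact/lefP/nd_nnsfun_approx.
under eq_fun do rewrite density_nnsfun.
rewrite -monotone_convergence//=.
- apply: eq_integral => x _; apply/cvg_lim => //; apply: cvgeZr => //.
  exact: cvg_nnsfun_approx.
- by move=> n; apply: emeasurable_funM; exact/measurable_EFinP.
- by move=> n x _; apply: mule_ge0; rewrite lee_fin.
- move=> x _ m n mn; apply: lee_wpmul2r; rewrite ?lee_fin//.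
  exact/lefP/nd_nnsfun_approx.
Qed.

End integral_density.

(** * Calculus on the half-line *)

Section real_dominated_convergence.
Context d (T : measurableType d) (R : realType).
Variable mu : {measure set T -> \bar R}.

Lemma Rintegral_DCT (D : set T) (f_ : nat -> T -> R) (f g : T -> R) :
  measurable D -> (forall n, measurable_fun D (f_ n)) ->
  (forall x, D x -> f_ ^~ x @ \oo --> f x) ->
  mu.-integrable D (EFin \o g) -> (forall n x, D x -> `|f_ n x| <= g x) ->
  mu.-integrable D (EFin \o f) /\
  (fun n => \int[mu]_(x in D) f_ n x) @ \oo --> \int[mu]_(x in D) f x.
Proof.
move=> mD mf_ f_f ig f_g.
have mf : measurable_fun D f by exact: (measurable_fun_cvg mf_).
have [||//|||fi _ h] := @dominated_convergence _ _ _ mu D mD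
  (fun n => EFin \o f_ n) (EFin \o f) (EFin \o g).
- by move=> n; exact/measurable_EFinP.
- exact/measurable_EFinP.
- by apply: aeW => x Dx; apply: cvg_EFin; [exact: nearW|exact: f_f].
- exact: ig.
- by apply: aeW => x n Dx; rewrite /= lee_fin f_g.
split => //; apply: fine_cvg; rewrite fineK//.
exact: integrable_fin_num fi.
Qed.

End real_dominated_convergence.

Local Notation "'d1 f" := (partial1of2 f) (at level 10, f at next level).

Section derivative_rules.
Context {R : realType}.
Implicit Types (f g : R -> R) (x df dg c : R).

Lemma is_derive_mul f g x df dg : is_derive x 1 f df -> is_derive x 1 g dg ->
  is_derive x 1 (fun t => f t * g t) (df * g x + f x * dg).
Proof.
move=> hf hg; have h := is_deriveM hf hg.
have -> : (fun t => f t * g t) = f * g by [].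
apply: is_derive_eq h _.
by rewrite addrC /GRing.scale /= [g x * df]mulrC.
Qed.

Lemma is_derive_add f g x df dg : is_derive x 1 f df -> is_derive x 1 g dg ->
  is_derive x 1 (fun t => f t + g t) (df + dg).
Proof. by move=> hf hg; exact: (is_deriveD hf hg). Qed.

Lemma is_derive_sub f g x df dg : is_derive x 1 f df -> is_derive x 1 g dg ->
  is_derive x 1 (fun t => f t - g t) (df - dg).
Proof. by move=> hf hg; exact: (is_deriveB hf hg). Qed.

Lemma is_derive_const c x : is_derive x 1 (fun _ : R => c) 0.
Proof. exact: is_derive_cst. Qed.

Lemma is_derive_idR x : is_derive x 1 (fun t : R => t) 1.
Proof. exact: is_derive_id. Qed.

Lemma is_derive_lin c x : is_derive x 1 (fun t => c * t) c.
Proof.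
have := is_derive_mul (is_derive_const c x) (is_derive_idR x).
by rewrite mul0r add0r mulr1.
Qed.

Lemma is_derive_sqr c x : is_derive x 1 (fun t => c * t ^+ 2) (2 * c * x).
Proof.
have h := is_derive_mul (is_derive_lin c x) (is_derive_idR x).
have -> : (fun t => c * t ^+ 2) = (fun t => c * t * t).
  by apply/funext => t; rewrite expr2 mulrA.
by apply: (is_derive_eq h); ring.
Qed.

Lemma is_derive_cosf f x df : is_derive x 1 f df ->
  is_derive x 1 (fun t => cos (f t)) (- sin (f x) * df).
Proof. by move=> hf; exact: (@is_derive1_comp _ cos f x). Qed.

Lemma is_derive_sinf f x df : is_derive x 1 f df ->
  is_derive x 1 (fun t => sin (f t)) (cos (f x) * df).
Proof. by move=> hf; exact: (@is_derive1_comp _ sin f x). Qed.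

Lemma is_derive_expf f x df : is_derive x 1 f df ->
  is_derive x 1 (fun t => expR (f t)) (expR (f x) * df).
Proof. by move=> hf; exact: (@is_derive1_comp _ (@expR R) f x). Qed.

Lemma is_derive_cont f x df : is_derive x 1 f df -> {for x, continuous f}.
Proof.
by move=> [h _]; apply/differentiable_continuous/derivable1_diffP.
Qed.

End derivative_rules.

Section half_line.
Context {R : realType}.
Local Notation lambda := (@lebesgue_measure R).
Local Notation D0 := (`[0%R, +oo[%classic : set R).

(** Decay is measured against this weight, whose primitive is the arctangent. *)
Definition lorentz (x : R) : R := (1 + x ^+ 2)^-1.

Lemma lorentz_gt0 x : 0 < lorentz x.
Proof. by rewrite invr_gt0 ltr_pwDl// sqr_ge0. Qed.

Lemma lorentz_ge0 x : 0 <= lorentz x.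
Proof. exact/ltW/lorentz_gt0. Qed.

Lemma lorentz_le1 x : lorentz x <= 1.
Proof. by rewrite invf_le1 ?lerDl ?sqr_ge0// ltr_pwDl// sqr_ge0. Qed.

Lemma measurable_lorentz (D : set R) : measurable_fun D lorentz.
Proof.
apply: measurable_funTS; apply: continuous_measurable_fun.
exact: (@continuous_oneDsqrV R).
Qed.

Lemma integrable_lorentz : lambda.-integrable D0 (EFin \o lorentz).
Proof.
apply/integrableP; split; first by apply/measurable_EFinP; exact: measurable_lorentz.
under eq_integral do rewrite /= ger0_norm ?lorentz_ge0//.
have := @integral0y_oneDsqr R; rewrite /oneDsqr /lorentz => ->.
exact: ltry.
Qed.

Lemma decay_integrable (D : set (measurableTypeR R)) (f : R -> R) A : measurable D -> D `<=` D0 ->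
  measurable_fun D f -> (forall x, D x -> `|f x| <= A * lorentz x) ->
  lambda.-integrable D (EFin \o f).
Proof.
move=> mD DD0 mf fA.
apply: (@le_integrable _ _ _ lambda _ mD _ (EFin \o (fun x => A * lorentz x))).
- exact/measurable_EFinP.
- move=> x Dx; rewrite /= lee_fin (le_trans (fA x Dx))//; exact: ler_norm.
- apply: (@integrableS _ _ _ lambda D0) => //.
  rewrite (_ : _ \o _ = (fun x => A%:E * (EFin \o lorentz) x)%E); last first.
    by apply/funext => x /=; rewrite EFinM.
  by apply: integrableZl => //; exact: integrable_lorentz.
Qed.

Lemma continuous_decay_integrable (f : R -> R) A : continuous f ->
  (forall x, 0 <= x -> `|f x| <= A * lorentz x) ->
  lambda.-integrable D0 (EFin \o f).
Proof.
move=> cf fA; apply: (@decay_integrable _ _ A) => //.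
- by apply: measurable_funTS; exact: continuous_measurable_fun.
- by move=> x /=; rewrite in_itv/= andbT; exact: fA.
Qed.

(** The fundamental theorem of calculus on [0, n + 1], then dominated
   convergence. *)
Lemma half_line_FTC (F f : R -> R) (A : R) : (forall x : R, is_derive x 1 F (f x)) ->
  continuous f -> (forall x, 0 <= x -> `|f x| <= A * lorentz x) ->
  F x @[x --> +oo] --> 0 ->
  \int[lambda]_(x in D0) f x = - F 0.
Proof.
move=> dF cf fA F0.
have fi := continuous_decay_integrable cf fA.
have FTC n : \int[lambda]_(x in `[0%R, n.+1%:R]) f x = F n.+1%:R - F 0.
  rewrite /Rintegral (@continuous_FTC2 _ f F)//.
  - exact: continuous_subspaceT.
  - have cF x : {for x, continuous F} by exact: is_derive_cont (dF x).
    split; first by move=> x _; case: (dF x).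
    + by apply: cvg_at_right_filter; exact: cF.
    + by apply: cvg_at_left_filter; exact: cF.
  - by move=> x _; rewrite derive1E; have [_ ->] := dF x.
have cv1 : (fun n => \int[lambda]_(x in `[0%R, n.+1%:R]) f x) @ \oo --> - F 0.
  under eq_fun do rewrite FTC.
  suff : (fun n => F n.+1%:R - F 0) @ \oo --> 0 - F 0 by rewrite sub0r.
  apply: cvgB; last exact: cvg_cst.
  have /cvg_pinftyP := F0; apply.
  by rewrite (cvg_shiftS (fun n : nat => n%:R : R)); exact: cvgr_idn.
apply: (cvg_unique _ _ cv1) => //.
have [||x /=|||_] := @Rintegral_DCT _ _ _ lambda D0
  (fun n => f \_ `[0%R, n.+1%:R]) f (fun x => `|f x|).
- by [].
- move=> n; apply: measurable_funTS; apply/(measurable_restrictT _ _).1 => //.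
  by apply: measurable_funTS; exact: continuous_measurable_fun.
- rewrite in_itv/= andbT => x0; apply: cvg_near_cst; near=> n.
  rewrite patchE mem_set//= in_itv/= x0 /=.
  near: n; apply: filterS (nbhs_infty_ger x) => n xn.
  by rewrite (le_trans xn)// ler_nat.
- by move/integrable_norm : fi.
- move=> n x _; rewrite patchE; case: ifPn => // _.
  by rewrite normr0.
under eq_fun do rewrite -Rintegral_mkcondr.
rewrite (_ : (fun n => _) = (fun n => \int[lambda]_(x in `[0%R, n.+1%:R]) f x))//.
apply/funext => n; congr (Rintegral _ _ _); apply/seteqP; split => x /=.
  by case.
by rewrite !in_itv/= => /andP[-> ->].
Unshelve. all: by end_near. Qed.

Lemma is_derive_under_integral (f df : R -> R -> R) (z A : R) :
  (forall z l : R, 0 <= l -> is_derive z 1 (f ^~ l) (df z l)) ->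
  (forall z, lambda.-integrable D0 (EFin \o f z)) ->
  (forall z l, 0 <= l -> `|df z l| <= A * lorentz l) ->
  is_derive z 1 (fun z : R => \int[lambda]_(l in D0) f z l)
    (\int[lambda]_(l in D0) df z l).
Proof.
move=> dfP fi dfA.
have A0 : 0 <= A.
  have := le_trans (normr_ge0 _) (dfA 0 0 (lexx 0)).
  by rewrite pmulr_lge0 ?lorentz_gt0.
have d1E y l : 0 <= l -> ('d1 f) y l = df y l.
  by move=> l0; rewrite partial1of2E; have [_ ->] := dfP y l l0.
have zI : (`]z - 1, z + 1[%classic : set R) z by rewrite /= in_itv/=; lra.
have der y l : (`]z - 1, z + 1[%classic : set R) y -> D0 l ->
    derivable (f ^~ l) y 1.
  by move=> _ /=; rewrite in_itv/= andbT => l0; case: (dfP y l l0).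
have iG : lambda.-integrable D0 (EFin \o (fun l => A * lorentz l)).
  apply: (@decay_integrable _ _ A) => //.
  - by apply: measurable_funM => //; exact: measurable_lorentz.
  - by move=> x _; rewrite ger0_norm// mulr_ge0 ?lorentz_ge0.
have G0 l : 0 <= A * lorentz l by rewrite mulr_ge0 ?lorentz_ge0.
have bnd y l : (`]z - 1, z + 1[%classic : set R) y -> D0 l ->
    `|('d1 f) y l| <= A * lorentz l.
  by move=> _ /=; rewrite in_itv/= andbT => l0; rewrite d1E// dfA.
apply: DeriveDef.
  exact: (@derivable_under_integral _ _ _ lambda f D0 _ z _ _ zI _ der _ G0 iG).
rewrite -derive1E.
rewrite (@differentiation_under_integral _ _ _ lambda f D0 _ z _ _ zI _ der _ G0 iG)//.
apply: eq_Rintegral => l; rewrite inE/= in_itv/= andbT => l0.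
exact: d1E.
Qed.

End half_line.

(** Differentiates along the syntax of the function; what remains is the
   equality of the derivative found with the one announced. *)
Ltac derive_tac := eapply is_derive_eq; [repeat first
  [ apply is_derive_const | apply is_derive_idR | apply is_derive_sqr
  | apply is_derive_lin | eapply is_derive_cosf | eapply is_derive_sinf
  | eapply is_derive_expf | eapply is_derive_mul | eapply is_derive_sub
  | eapply is_derive_add ] | cbv beta].

Section gaussian_decay.
Context {R : realType}.
Implicit Types (p x c : R).

(** The constant in exp(- p x^2) <= C / (1 + x^2)^2 that comes from squaring
   exp(p x^2 / 2) >= 1 + p x^2 / 2. *)
Definition gauss_cst p : R := (Num.min 1 (p / 2)) ^- 2.

Lemma gauss_cst_ge0 p : 0 <= gauss_cst p.
Proof. by rewrite /gauss_cst invr_ge0 sqr_ge0. Qed.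

Lemma gauss_decay p x : 0 < p ->
  expR (- p * x ^+ 2) <= gauss_cst p * lorentz x ^+ 2.
Proof.
move=> p0; rewrite /gauss_cst /lorentz; set m := Num.min 1 (p / 2).
have m0 : 0 < m by rewrite lt_min ltr01 divr_gt0.
have [m1 mp] : m <= 1 /\ m <= p / 2 by rewrite /m !ge_min !lexx orbT.
have x0 : 0 <= x ^+ 2 by exact: sqr_ge0.
have q0 : 0 < 1 + x ^+ 2 by lra.
rewrite exprVn -invfM -exprMn mulNr expRN.
rewrite lef_pV2 ?posrE ?expR_gt0 ?exprn_gt0 ?mulr_gt0//.
have -> : p * x ^+ 2 = p * x ^+ 2 / 2 + p * x ^+ 2 / 2 by lra.
have mq : 0 <= m * (1 + x ^+ 2) by apply: mulr_ge0; exact: ltW.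
rewrite expRD -expr2 ler_pXn2r ?nnegrE ?expR_ge0//.
apply: le_trans (expR_ge1Dx _).
have : m * x ^+ 2 <= p / 2 * x ^+ 2 by rewrite ler_wpM2r.
lra.
Qed.

Lemma gauss_decay_mul p x c (y : R) : 0 < p -> 0 <= c ->
  `|y| <= c * (1 + x ^+ 2) * expR (- p * x ^+ 2) ->
  `|y| <= c * gauss_cst p * lorentz x.
Proof.
move=> p0 c0 h; apply: (le_trans h).
have q0 : 0 < 1 + x ^+ 2 by have := sqr_ge0 x; lra.
apply: (@le_trans _ _ (c * (1 + x ^+ 2) * (gauss_cst p * lorentz x ^+ 2))).
  by apply: ler_wpM2l; [apply: mulr_ge0 => //; exact: ltW|exact: gauss_decay].
rewrite le_eqVlt; apply/orP; left; apply/eqP; rewrite /lorentz.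
by field; rewrite gt_eqF.
Qed.

End gaussian_decay.

Section bounded_waves.
Context {R : realType}.

Lemma normM_le1 (a b : R) : `|a| <= 1 -> `|a * b| <= `|b|.
Proof. by move=> a1; rewrite normrM ler_piMl. Qed.

Lemma cos_norm (x : R) : `|cos x| <= 1.
Proof. by rewrite ler_norml cos_geN1 cos_le1. Qed.

Lemma sin_norm (x : R) : `|sin x| <= 1.
Proof. by rewrite ler_norml sin_geN1 sin_le1. Qed.

Lemma lin_le_sqr (l : R) : `|l| <= 1 + l ^+ 2.
Proof. by rewrite -real_normK ?num_real//; have := sqr_ge0 (`|l| - 1); nra. Qed.

Lemma continuous_cos_lin z : continuous (fun l : R => cos (l * z)).
Proof. by move=> x; eapply is_derive_cont; derive_tac; reflexivity. Qed.

Lemma continuous_sin_lin z : continuous (fun l : R => sin (l * z)).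
Proof. by move=> x; eapply is_derive_cont; derive_tac; reflexivity. Qed.

End bounded_waves.

(** * Fourier transforms of complex Gaussians *)

Section decaying_functions.
Context {R : realType}.
Local Notation lambda := (@lebesgue_measure R).
Local Notation D0 := (`[0%R, +oo[%classic : set R).
Implicit Types f g : R -> R.

Definition decaying f := continuous f /\
  exists A, forall x, 0 <= x -> `|f x| <= A * lorentz x.

Lemma decaying_integrable f : decaying f -> lambda.-integrable D0 (EFin \o f).
Proof. by move=> [cf [A fA]]; exact: continuous_decay_integrable fA. Qed.

Lemma decayingD f g : decaying f -> decaying g -> decaying (fun x => f x + g x).
Proof.
move=> [cf [A fA]] [cg [B gB]]; split.
  by move=> x; apply: cvgD; [exact: cf|exact: cg].
exists (A + B) => x x0; rewrite (le_trans (ler_normD _ _))// mulrDl.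
by rewrite lerD ?fA ?gB.
Qed.

Lemma decayingZ c f : decaying f -> decaying (fun x => c * f x).
Proof.
move=> [cf [A fA]]; split.
  by move=> x; apply: cvgM; [exact: cvg_cst|exact: cf].
exists (`|c| * A) => x x0.
by rewrite normrM -mulrA ler_wpM2l// fA.
Qed.

Lemma Rintegral_lin f g a b : decaying f -> decaying g ->
  \int[lambda]_(x in D0) (a * f x + b * g x) =
  a * \int[lambda]_(x in D0) f x + b * \int[lambda]_(x in D0) g x.
Proof.
move=> hf hg; rewrite RintegralD//.
- by rewrite !RintegralZl//; exact: decaying_integrable.
- exact/decaying_integrable/decayingZ.
- exact/decaying_integrable/decayingZ.
Qed.

Lemma lorentz_cvg0 (F : R -> R) A :
  (forall x, 0 <= x -> `|F x| <= A * lorentz x) -> F x @[x --> +oo] --> 0.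
Proof.
move=> FA.
have A0 : 0 <= A.
  have := le_trans (normr_ge0 _) (FA 0 (lexx 0)).
  by rewrite pmulr_lge0 ?lorentz_gt0.
apply/cvgrPdist_le => e e0; near=> x; rewrite sub0r normrN.
have x0 : 1 <= x by near: x; exact: nbhs_pinfty_ge (num_real _).
have x00 : 0 <= x by lra.
apply: (le_trans (FA x x00)).
rewrite /lorentz ler_pdivrMr; last by have := sqr_ge0 x; lra.
have xA : A / e <= x by near: x; exact: nbhs_pinfty_ge (num_real _).
rewrite ler_pdivrMr// in xA; nra.
Unshelve. all: by end_near. Qed.

Lemma decaying_FTC (F f : R -> R) : (forall x : R, is_derive x 1 F (f x)) ->
  decaying f -> decaying F -> \int[lambda]_(x in D0) f x = - F 0.
Proof.
move=> dF [cf [A fA]] [_ [B FB]].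
by apply: half_line_FTC cf fA _ => //; exact: lorentz_cvg0 FB.
Qed.

End decaying_functions.

Section gaussian_ode.
Context {R : realType}.
Variables (p q : R) (u v : R -> R).
Hypotheses
  (du : forall z : R, is_derive z 1 u (- (2 * z) * (p * u z - q * v z)))
  (dv : forall z : R, is_derive z 1 v (- (2 * z) * (q * u z + p * v z))).

(** In complex notation, the real and imaginary parts of the statement that
   w' = - 2 z (p + i q) w makes exp((p + i q) z^2) w constant. *)
Lemma gaussian_ode_re (z : R) :
  expR (p * z ^+ 2) * (cos (q * z ^+ 2) * u z - sin (q * z ^+ 2) * v z) = u 0.
Proof.
pose M (z : R) := expR (p * z ^+ 2) *
  (cos (q * z ^+ 2) * u z - sin (q * z ^+ 2) * v z).
transitivity (M 0); last first.
  by rewrite /M expr0n !mulr0 expR0 cos0 sin0 !mul1r mul0r subr0.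
apply: (@is_derive_0_is_cst R M z 0) => {}z; rewrite /M.
eapply is_derive_eq; [repeat first [ apply is_derive_sqr | apply du | apply dv
  | eapply is_derive_cosf | eapply is_derive_sinf | eapply is_derive_expf
  | eapply is_derive_mul | eapply is_derive_sub ] | cbv beta].
by ring.
Qed.

Lemma gaussian_ode_im (z : R) :
  expR (p * z ^+ 2) * (sin (q * z ^+ 2) * u z + cos (q * z ^+ 2) * v z) = v 0.
Proof.
pose M (z : R) := expR (p * z ^+ 2) *
  (sin (q * z ^+ 2) * u z + cos (q * z ^+ 2) * v z).
transitivity (M 0); last first.
  by rewrite /M expr0n !mulr0 expR0 cos0 sin0 !mul1r mul0r add0r.
apply: (@is_derive_0_is_cst R M z 0) => {}z; rewrite /M.
eapply is_derive_eq; [repeat first [ apply is_derive_sqr | apply du | apply dv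
  | eapply is_derive_cosf | eapply is_derive_sinf | eapply is_derive_expf
  | eapply is_derive_mul | eapply is_derive_add ] | cbv beta].
by ring.
Qed.

End gaussian_ode.

Section gaussian_fourier.
Context {R : realType}.
Local Notation lambda := (@lebesgue_measure R).
Local Notation D0 := (`[0%R, +oo[%classic : set R).
Variable (e : R).
Hypothesis e0 : 0 < e.

(** Real and imaginary parts of exp(- (e - i t) l^2). *)
Definition cos_chirp (t l : R) : R := expR (- e * l ^+ 2) * cos (t * l ^+ 2).
Definition sin_chirp (t l : R) : R := expR (- e * l ^+ 2) * sin (t * l ^+ 2).

Lemma continuous_cos_chirp t : continuous (cos_chirp t).
Proof. by move=> x; eapply is_derive_cont; derive_tac; reflexivity. Qed.

Lemma continuous_sin_chirp t : continuous (sin_chirp t).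
Proof. by move=> x; eapply is_derive_cont; derive_tac; reflexivity. Qed.

Lemma cos_chirp_le t l : `|cos_chirp t l| <= expR (- e * l ^+ 2).
Proof.
rewrite /cos_chirp mulrC (le_trans (normM_le1 _ (cos_norm _)))//.
by rewrite ger0_norm ?expR_ge0.
Qed.

Lemma sin_chirp_le t l : `|sin_chirp t l| <= expR (- e * l ^+ 2).
Proof.
rewrite /sin_chirp mulrC (le_trans (normM_le1 _ (sin_norm _)))//.
by rewrite ger0_norm ?expR_ge0.
Qed.

Lemma decaying_weight (C P : R -> R) (c : R) : continuous C -> continuous P -> 0 <= c ->
  (forall l, `|C l| <= expR (- e * l ^+ 2)) ->
  (forall l, `|P l| <= c * (1 + l ^+ 2)) -> decaying (fun l => P l * C l).
Proof.
move=> cC cP c0 leC leP; split.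
  by move=> x; apply: cvgM; [exact: cP|exact: cC].
exists (c * gauss_cst e) => l _; apply: gauss_decay_mul => //.
by rewrite normrM ler_pM.
Qed.

Lemma decaying_cos_weight (C : R -> R) z : continuous C ->
  (forall l, `|C l| <= expR (- e * l ^+ 2)) ->
  decaying (fun l => cos (l * z) * C l).
Proof.
move=> cC leC; apply: (@decaying_weight _ _ 1) => //.
  exact: continuous_cos_lin.
by move=> l; rewrite mul1r (le_trans (cos_norm _))// lerDl sqr_ge0.
Qed.

Lemma decaying_sin_weight (C : R -> R) z : continuous C ->
  (forall l, `|C l| <= expR (- e * l ^+ 2)) ->
  decaying (fun l => sin (l * z) * C l).
Proof.
move=> cC leC; apply: (@decaying_weight _ _ 1) => //.
  exact: continuous_sin_lin.
by move=> l; rewrite mul1r (le_trans (sin_norm _))// lerDl sqr_ge0.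
Qed.

Lemma decaying_lsin_weight (C : R -> R) z : continuous C ->
  (forall l, `|C l| <= expR (- e * l ^+ 2)) ->
  decaying (fun l => l * sin (l * z) * C l).
Proof.
move=> cC leC; apply: (@decaying_weight _ _ 1) => //.
  by move=> x; apply: cvgM; [exact: cvg_id|exact: continuous_sin_lin].
move=> l; rewrite mul1r mulrC (le_trans (normM_le1 _ (sin_norm _)))//.
exact: lin_le_sqr.
Qed.

Lemma is_derive_cos_weight (C : R -> R) (z : R) : continuous C ->
  (forall l, `|C l| <= expR (- e * l ^+ 2)) ->
  is_derive z 1 (fun z : R => \int[lambda]_(l in D0) (cos (l * z) * C l))
    (- \int[lambda]_(l in D0) (l * sin (l * z) * C l)).
Proof.
move=> cC leC.
have h := @is_derive_under_integral R (fun z l => cos (l * z) * C l)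
  (fun z l => - 1 * (l * sin (l * z) * C l)) z (1 * gauss_cst e).
apply: (@is_derive_eq _ _ _ _ _ _ _ _ (h _ _ _)).
- by move=> y l _; derive_tac; ring.
- by move=> y; exact/decaying_integrable/decaying_cos_weight.
- move=> y l _; apply: gauss_decay_mul => //; rewrite mul1r mulN1r normrN mulrAC.
  rewrite mulrC; apply: (le_trans (normM_le1 _ (sin_norm _))).
  by rewrite normrM ler_pM ?lin_le_sqr.
- by rewrite RintegralZl ?mulN1r//; exact/decaying_integrable/decaying_lsin_weight.
Qed.

Lemma decaying_chirp (C : R -> R) : continuous C ->
  (forall l, `|C l| <= expR (- e * l ^+ 2)) -> decaying C.
Proof.
move=> cC leC; have := decaying_cos_weight 0 cC leC.
have -> : (fun l => cos (l * 0) * C l) = C => [|//].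
by apply/funext => l; rewrite mulr0 cos0 mul1r.
Qed.

Lemma decaying_lchirp (C : R -> R) : continuous C ->
  (forall l, `|C l| <= expR (- e * l ^+ 2)) -> decaying (fun l => l * C l).
Proof.
move=> cC leC; apply: (@decaying_weight _ _ 1) => //; first by move=> x; exact: cvg_id.
by move=> l; rewrite mul1r; exact: lin_le_sqr.
Qed.

Lemma decaying_sqrchirp (C : R -> R) : continuous C ->
  (forall l, `|C l| <= expR (- e * l ^+ 2)) ->
  decaying (fun l => l ^+ 2 * C l).
Proof.
move=> cC leC; apply: (@decaying_weight _ _ 1) => //.
  exact: exprn_continuous.
by move=> l; rewrite mul1r ger0_norm ?sqr_ge0// lerDr.
Qed.

#[local] Hint Resolve continuous_cos_chirp continuous_sin_chirp cos_chirp_le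
  sin_chirp_le : core.

Definition Ec t z := \int[lambda]_(l in D0) (cos (l * z) * cos_chirp t l).
Definition Es t z := \int[lambda]_(l in D0) (cos (l * z) * sin_chirp t l).
Let Sc t z := \int[lambda]_(l in D0) (l * sin (l * z) * cos_chirp t l).
Let Ss t z := \int[lambda]_(l in D0) (l * sin (l * z) * sin_chirp t l).

(** The derivative in l of sin(l z) exp(- (e - i t) l^2) has integral 0. *)
Let ibp_c t z : z * Ec t z = 2 * e * Sc t z + 2 * t * Ss t z.
Proof.
pose F l := sin (l * z) * cos_chirp t l.
pose f l := 1 * (z * (cos (l * z) * cos_chirp t l)) +
  (- 1) * (2 * e * (l * sin (l * z) * cos_chirp t l) +
           2 * t * (l * sin (l * z) * sin_chirp t l)).
have d1 : decaying (fun l => z * (cos (l * z) * cos_chirp t l)).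
  by apply: decayingZ; exact: decaying_cos_weight.
have d2 : decaying (fun l => 2 * e * (l * sin (l * z) * cos_chirp t l) +
           2 * t * (l * sin (l * z) * sin_chirp t l)).
  by apply: decayingD; apply: decayingZ; exact: decaying_lsin_weight.
have : \int[lambda]_(l in D0) f l = - F 0.
  apply: decaying_FTC.
  - by move=> l; rewrite /F /f /cos_chirp /sin_chirp; derive_tac; ring.
  - by apply: decayingD; apply: decayingZ.
  - exact: decaying_sin_weight.
rewrite /F mul0r sin0 mul0r oppr0 /f Rintegral_lin//.
rewrite Rintegral_lin; [|exact: decaying_lsin_weight..].
rewrite RintegralZl//; last exact/decaying_integrable/decaying_cos_weight.
by rewrite -/(Ec t z) -/(Sc t z) -/(Ss t z); lra.
Qed.

Let ibp_s t z : z * Es t z = 2 * e * Ss t z - 2 * t * Sc t z.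
Proof.
pose F l := sin (l * z) * sin_chirp t l.
pose f l := 1 * (z * (cos (l * z) * sin_chirp t l)) +
  (- 1) * (2 * e * (l * sin (l * z) * sin_chirp t l) +
           (- (2 * t)) * (l * sin (l * z) * cos_chirp t l)).
have d1 : decaying (fun l => z * (cos (l * z) * sin_chirp t l)).
  by apply: decayingZ; exact: decaying_cos_weight.
have d2 : decaying (fun l => 2 * e * (l * sin (l * z) * sin_chirp t l) +
           (- (2 * t)) * (l * sin (l * z) * cos_chirp t l)).
  by apply: decayingD; apply: decayingZ; exact: decaying_lsin_weight.
have : \int[lambda]_(l in D0) f l = - F 0.
  apply: decaying_FTC.
  - by move=> l; rewrite /F /f /cos_chirp /sin_chirp; derive_tac; ring.
  - by apply: decayingD; apply: decayingZ.
  - exact: decaying_sin_weight.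
rewrite /F mul0r sin0 mul0r oppr0 /f Rintegral_lin//.
rewrite Rintegral_lin; [|exact: decaying_lsin_weight..].
rewrite RintegralZl//; last exact/decaying_integrable/decaying_cos_weight.
by rewrite -/(Es t z) -/(Sc t z) -/(Ss t z); lra.
Qed.

(** Real and imaginary parts of 1 / (4 (e - i t)). *)
Definition chirp_re t : R := e / (4 * (e ^+ 2 + t ^+ 2)).
Definition chirp_im t : R := t / (4 * (e ^+ 2 + t ^+ 2)).

Let et_gt0 t : 0 < e ^+ 2 + t ^+ 2.
Proof. by rewrite ltr_pwDl ?exprn_gt0// sqr_ge0. Qed.

(** Differentiation under the integral brings down l sin(l z), and integration
   by parts trades the factor l for z. *)
Let dEc t (z : R) : is_derive z 1 (Ec t)
  (- (2 * z) * (chirp_re t * Ec t z - chirp_im t * Es t z)).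
Proof.
apply: (is_derive_eq (is_derive_cos_weight z (@continuous_cos_chirp t)
  (@cos_chirp_le t))); rewrite -/(Sc t z).
have et := et_gt0 t.
have h : (2 * (e ^+ 2 + t ^+ 2)) * Sc t z = e * (z * Ec t z) - t * (z * Es t z).
  by rewrite ibp_c ibp_s; ring.
have -> : Sc t z = (e * (z * Ec t z) - t * (z * Es t z)) / (2 * (e ^+ 2 + t ^+ 2)).
  by rewrite -h; field; rewrite gt_eqF.
by rewrite /chirp_re /chirp_im; field; rewrite gt_eqF.
Qed.

Let dEs t (z : R) : is_derive z 1 (Es t)
  (- (2 * z) * (chirp_im t * Ec t z + chirp_re t * Es t z)).
Proof.
apply: (is_derive_eq (is_derive_cos_weight z (@continuous_sin_chirp t)
  (@sin_chirp_le t))); rewrite -/(Ss t z).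
have et := et_gt0 t.
have h : (2 * (e ^+ 2 + t ^+ 2)) * Ss t z = t * (z * Ec t z) + e * (z * Es t z).
  by rewrite ibp_c ibp_s; ring.
have -> : Ss t z = (t * (z * Ec t z) + e * (z * Es t z)) / (2 * (e ^+ 2 + t ^+ 2)).
  by rewrite -h; field; rewrite gt_eqF.
by rewrite /chirp_re /chirp_im; field; rewrite gt_eqF.
Qed.

Let const_c t z : expR (chirp_re t * z ^+ 2) *
  (cos (chirp_im t * z ^+ 2) * Ec t z - sin (chirp_im t * z ^+ 2) * Es t z) =
  Ec t 0.
Proof. exact: (gaussian_ode_re (dEc t) (dEs t)). Qed.

Let const_s t z : expR (chirp_re t * z ^+ 2) *
  (sin (chirp_im t * z ^+ 2) * Ec t z + cos (chirp_im t * z ^+ 2) * Es t z) =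
  Es t 0.
Proof. exact: (gaussian_ode_im (dEc t) (dEs t)). Qed.

(** The transform w = Ec + i Es solves w' = - 2 z (p + i q) w in z, where
   p + i q = 1 / (4 (e - i t)); hence w(z) = exp(- (p + i q) z^2) w(0). *)
Lemma EcE t z : Ec t z = expR (- chirp_re t * z ^+ 2) *
  (cos (chirp_im t * z ^+ 2) * Ec t 0 + sin (chirp_im t * z ^+ 2) * Es t 0).
Proof.
rewrite -(const_c t z) -(const_s t z) mulNr expRN.
have := cos2Dsin2 (chirp_im t * z ^+ 2).
set c := cos _; set s := sin _ => h.
have E0 : expR (chirp_re t * z ^+ 2) != 0 by rewrite gt_eqF ?expR_gt0.
apply/esym; rewrite -[RHS]mul1r -h; field. exact: E0.
Qed.

Lemma EsE t z : Es t z = expR (- chirp_re t * z ^+ 2) *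
  (cos (chirp_im t * z ^+ 2) * Es t 0 - sin (chirp_im t * z ^+ 2) * Ec t 0).
Proof.
rewrite -(const_c t z) -(const_s t z) mulNr expRN.
have := cos2Dsin2 (chirp_im t * z ^+ 2).
set c := cos _; set s := sin _ => h.
have E0 : expR (chirp_re t * z ^+ 2) != 0 by rewrite gt_eqF ?expR_gt0.
apply/esym; rewrite -[RHS]mul1r -h; field. exact: E0.
Qed.

End gaussian_fourier.

Section modulus_ode.
Context {R : realType}.
Variables (e : R) (u v : R -> R).
Hypotheses (et_gt0 : forall t, 0 < e ^+ 2 + t ^+ 2)
  (du : forall t : R, is_derive t 1 u
    (- (t * u t + e * v t) / (2 * (e ^+ 2 + t ^+ 2))))
  (dv : forall t : R, is_derive t 1 v
    ((e * u t - t * v t) / (2 * (e ^+ 2 + t ^+ 2)))).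

(** The integral w = u + i v of a Gaussian of complex width satisfies
   2 (e - i t) w' = i w, which fixes its modulus. *)
Lemma modulus_ode (t : R) : (u t ^+ 2 + v t ^+ 2) ^+ 2 * (e ^+ 2 + t ^+ 2) =
  (u 0 ^+ 2 + v 0 ^+ 2) ^+ 2 * (e ^+ 2 + 0 ^+ 2).
Proof.
pose M t := (u t * u t + v t * v t) * (u t * u t + v t * v t) *
  (e ^+ 2 + t * t).
have ME s : (u s ^+ 2 + v s ^+ 2) ^+ 2 * (e ^+ 2 + s ^+ 2) = M s.
  by rewrite /M; ring.
rewrite !ME; apply: (@is_derive_0_is_cst R M t 0) => {}t; rewrite /M.
eapply is_derive_eq; [repeat first [ apply du | apply dv
  | apply is_derive_const | apply is_derive_idR
  | eapply is_derive_mul | eapply is_derive_add ] | cbv beta].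
by field; rewrite gt_eqF.
Qed.

End modulus_ode.

Section gaussian_constants.
Context {R : realType}.
Local Notation lambda := (@lebesgue_measure R).
Local Notation D0 := (`[0%R, +oo[%classic : set R).
Variable (e : R).
Hypothesis e0 : 0 < e.

Let Ac t := \int[lambda]_(l in D0) (cos_chirp e t l).
Let As t := \int[lambda]_(l in D0) (sin_chirp e t l).
Let Pc t := \int[lambda]_(l in D0) (l ^+ 2 * cos_chirp e t l).
Let Ps t := \int[lambda]_(l in D0) (l ^+ 2 * sin_chirp e t l).

Let dc t : decaying (cos_chirp e t).
Proof.
exact: (decaying_chirp e0 (@continuous_cos_chirp _ e t) (@cos_chirp_le _ e t)).
Qed.
Let ds t : decaying (sin_chirp e t).
Proof.
exact: (decaying_chirp e0 (@continuous_sin_chirp _ e t) (@sin_chirp_le _ e t)).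
Qed.
Let dpc t : decaying (fun l => l ^+ 2 * cos_chirp e t l).
Proof.
exact: (decaying_sqrchirp e0 (@continuous_cos_chirp _ e t) (@cos_chirp_le _ e t)).
Qed.
Let dps t : decaying (fun l => l ^+ 2 * sin_chirp e t l).
Proof.
exact: (decaying_sqrchirp e0 (@continuous_sin_chirp _ e t) (@sin_chirp_le _ e t)).
Qed.

Let Ec0E t : Ec e t 0 = Ac t.
Proof. by apply: eq_Rintegral => l _; rewrite mulr0 cos0 mul1r. Qed.

Let Es0E t : Es e t 0 = As t.
Proof. by apply: eq_Rintegral => l _; rewrite mulr0 cos0 mul1r. Qed.

(** The derivative of l exp(- (e - i t) l^2) has integral 0. *)
Let ibp_c t : Ac t = 2 * e * Pc t + 2 * t * Ps t.
Proof.
pose F l := l * cos_chirp e t l.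
pose f l := 1 * cos_chirp e t l + (- 1) *
  (2 * e * (l ^+ 2 * cos_chirp e t l) + 2 * t * (l ^+ 2 * sin_chirp e t l)).
have d2 : decaying (fun l => 2 * e * (l ^+ 2 * cos_chirp e t l) +
    2 * t * (l ^+ 2 * sin_chirp e t l)).
  by apply: decayingD; apply: decayingZ.
have : \int[lambda]_(l in D0) f l = - F 0.
  apply: decaying_FTC.
  - by move=> l; rewrite /F /f /cos_chirp /sin_chirp; derive_tac; ring.
  - by apply: decayingD; apply: decayingZ.
  - exact: (decaying_lchirp e0 (@continuous_cos_chirp _ e t) (@cos_chirp_le _ e t)).
rewrite /F mul0r oppr0 /f Rintegral_lin// Rintegral_lin//.
by rewrite -/(Ac t) -/(Pc t) -/(Ps t); lra.
Qed.

Let ibp_s t : As t = 2 * e * Ps t - 2 * t * Pc t.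
Proof.
pose F l := l * sin_chirp e t l.
pose f l := 1 * sin_chirp e t l + (- 1) *
  (2 * e * (l ^+ 2 * sin_chirp e t l) + (- (2 * t)) * (l ^+ 2 * cos_chirp e t l)).
have d2 : decaying (fun l => 2 * e * (l ^+ 2 * sin_chirp e t l) +
    (- (2 * t)) * (l ^+ 2 * cos_chirp e t l)).
  by apply: decayingD; apply: decayingZ.
have : \int[lambda]_(l in D0) f l = - F 0.
  apply: decaying_FTC.
  - by move=> l; rewrite /F /f /cos_chirp /sin_chirp; derive_tac; ring.
  - by apply: decayingD; apply: decayingZ.
  - exact: (decaying_lchirp e0 (@continuous_sin_chirp _ e t) (@sin_chirp_le _ e t)).
rewrite /F mul0r oppr0 /f Rintegral_lin// Rintegral_lin//.
by rewrite -/(As t) -/(Pc t) -/(Ps t); lra.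
Qed.

Let et_gt0 t : 0 < e ^+ 2 + t ^+ 2.
Proof. by rewrite ltr_pwDl ?exprn_gt0// sqr_ge0. Qed.

Let sqr_chirp_le (y l : R) : `|y| <= expR (- e * l ^+ 2) ->
  `|l ^+ 2 * y| <= 1 * gauss_cst e * lorentz l.
Proof.
move=> h; apply: gauss_decay_mul => //; rewrite mul1r normrM ler_pM//.
by rewrite ger0_norm ?sqr_ge0// lerDr.
Qed.

Let dAc (t : R) : is_derive t 1 Ac (- Ps t).
Proof.
have h := @is_derive_under_integral R (cos_chirp e)
  (fun t l => - 1 * (l ^+ 2 * sin_chirp e t l)) t (1 * gauss_cst e).
apply: (@is_derive_eq _ _ _ _ _ _ _ _ (h _ _ _)).
- by move=> s l _; rewrite /cos_chirp /sin_chirp; derive_tac; ring.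
- by move=> s; exact: decaying_integrable.
- by move=> s l _; rewrite mulN1r normrN; apply: sqr_chirp_le; exact: sin_chirp_le.
- by rewrite RintegralZl ?mulN1r//; exact: decaying_integrable.
Qed.

Let dAs (t : R) : is_derive t 1 As (Pc t).
Proof.
apply: (@is_derive_under_integral R (sin_chirp e)
  (fun t l => l ^+ 2 * cos_chirp e t l) t (1 * gauss_cst e)).
- by move=> s l _; rewrite /cos_chirp /sin_chirp; derive_tac; ring.
- by move=> s; exact: decaying_integrable.
- by move=> s l _; apply: sqr_chirp_le; exact: cos_chirp_le.
Qed.

(** Half of the mass of the centred normal law of variance 1 / (2 e). *)
Lemma gauss_integral_half : \int[lambda]_(l in D0) expR (- e * l ^+ 2) =
  Num.sqrt (pi / e) / 2.
Proof.
pose s := Num.sqrt (2 * e)^-1.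
have s2 : s ^+ 2 = (2 * e)^-1 by rewrite sqr_sqrtr// invr_ge0 mulr_ge0// ltW.
have s0 : s != 0 by rewrite gt_eqF// sqrtr_gt0 invr_gt0 mulr_gt0.
have pdfE x : normal_pdf 0 s x = normal_peak s * expR (- e * x ^+ 2).
  rewrite normal_pdfE// /normal_fun subr0 s2.
  by congr (_ * expR _); rewrite -[_^-1 *+ 2]mulr_natr; field; rewrite gt_eqF.
have pk : normal_peak s = (Num.sqrt (pi / e))^-1.
  rewrite /normal_peak s2; congr (Num.sqrt _)^-1.
  by rewrite -mulr_natr; field; rewrite gt_eqF.
have r0 : 0 < Num.sqrt (pi / e) by rewrite sqrtr_gt0 divr_gt0 ?pi_gt0.
have := @integral_normal_pdf R 0 s.
rewrite ge0_symfun_integralT; last first.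
- by move=> x; rewrite /= !pdfE sqrrN.
- exact: continuous_normal_pdf.
- by move=> x; exact: normal_pdf_ge0.
have -> : [set x : R | 0 <= x] = D0.
  by apply/seteqP; split => x /=; rewrite in_itv/= andbT.
have ig : lambda.-integrable D0 (EFin \o (fun l => expR (- e * l ^+ 2))).
  apply: (@continuous_decay_integrable _ _ (1 * gauss_cst e)) => [x|x _].
    by eapply is_derive_cont; derive_tac; reflexivity.
  apply: gauss_decay_mul => //; rewrite mul1r ger0_norm ?expR_ge0//.
  by rewrite ler_peMl ?expR_ge0// lerDl sqr_ge0.
under eq_integral do rewrite pdfE EFinM.
have RE : (\int[lambda]_(l in D0) (expR (- e * l ^+ 2))%:E =
    (\int[lambda]_(l in D0) expR (- e * l ^+ 2))%R%:E)%E.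
  by rewrite /Rintegral fineK//; exact: integrable_fin_num ig.
rewrite integralZl// RE -!EFinM pk => -[h].
apply: (@mulfI _ (2 * (Num.sqrt (pi / e))^-1)).
  by rewrite mulf_neq0// invr_eq0 gt_eqF.
by rewrite -mulrA h; field; rewrite gt_eqF.
Qed.

Lemma Ec0_eq : Ec e 0 0 = Num.sqrt (pi / e) / 2.
Proof.
rewrite Ec0E /Ac -gauss_integral_half; apply: eq_Rintegral => l _.
by rewrite /cos_chirp mul0r cos0 mulr1.
Qed.

Lemma Es0_eq0 z : Es e 0 z = 0.
Proof.
transitivity (\int[lambda]_(l in D0) (0 : R)).
  by apply: eq_Rintegral => l _; rewrite /sin_chirp mul0r sin0 !mulr0.
by rewrite Rintegral_cst// mul0r.
Qed.

Let dAc' (t : R) : is_derive t 1 Ac (- (t * Ac t + e * As t) / (2 * (e ^+ 2 + t ^+ 2))).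
Proof.
apply: (is_derive_eq (dAc t)); have et := et_gt0 t.
have <- : (2 * (e ^+ 2 + t ^+ 2)) * Ps t = t * Ac t + e * As t.
  by rewrite ibp_c ibp_s; ring.
by field; rewrite gt_eqF.
Qed.

Let dAs' (t : R) : is_derive t 1 As ((e * Ac t - t * As t) / (2 * (e ^+ 2 + t ^+ 2))).
Proof.
apply: (is_derive_eq (dAs t)); have et := et_gt0 t.
have <- : (2 * (e ^+ 2 + t ^+ 2)) * Pc t = e * Ac t - t * As t.
  by rewrite ibp_c ibp_s; ring.
by field; rewrite gt_eqF.
Qed.

(** Since modulus_ode fixes the modulus of w(0) as a function of t, it is enough
   to know it at t = 0. *)
Lemma Ec_Es_sqr t : (Ec e t 0 ^+ 2 + Es e t 0 ^+ 2) ^+ 2 * (e ^+ 2 + t ^+ 2) =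
  (pi / 4) ^+ 2.
Proof.
rewrite Ec0E Es0E (modulus_ode et_gt0 dAc' dAs') -Ec0E -Es0E Es0_eq0 Ec0_eq.
have q0 : 0 <= pi / e :> R by rewrite divr_ge0 ?pi_ge0// ltW.
have -> : (Num.sqrt (pi / e) / 2) ^+ 2 = (pi / e) / 4.
  by rewrite exprMn sqr_sqrtr//; field; rewrite gt_eqF.
by field; rewrite gt_eqF.
Qed.

Lemma Ec_Es_le t : t != 0 ->
  Ec e t 0 ^+ 2 + Es e t 0 ^+ 2 <= pi / (4 * `|t|).
Proof.
move=> t0; have t0' : 0 < `|t| by rewrite normr_gt0.
set q := _ + _.
have q0 : 0 <= q by rewrite addr_ge0 ?sqr_ge0.
have -> : pi / (4 * `|t|) = (pi / 4) / `|t| by field; rewrite gt_eqF.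
rewrite ler_pdivlMr// -(@ler_pXn2r _ 2) ?nnegrE ?mulr_ge0 ?divr_ge0 ?pi_ge0//.
rewrite -(Ec_Es_sqr t) -/q exprMn ler_wpM2l ?sqr_ge0// real_normK ?num_real//.
by rewrite lerDr sqr_ge0.
Qed.

End gaussian_constants.

(** * The dispersive bound for regularised kernels *)

Section kernel_bounds.
Context {R : realType}.
Local Notation lambda := (@lebesgue_measure R).
Local Notation D0 := (`[0%R, +oo[%classic : set R).

Lemma lipschitz_of_derive (f df : R -> R) (a b K : R) : a <= b ->
  (forall x : R, is_derive x 1 f (df x)) ->
  (forall x, a <= x -> x <= b -> `|df x| <= K) ->
  `|f b - f a| <= K * (b - a).
Proof.
move=> ab fP dfK; have [c] := @MVT_segment R f df a b ab (fun x _ => fP x)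
  (continuous_subspaceT (fun x => is_derive_cont (fP x))).
rewrite in_itv/= => /andP[ac cb] ->.
by rewrite normrM (ger0_norm (_ : 0 <= b - a)) ?subr_ge0// ler_wpM2r ?subr_ge0 ?dfK.
Qed.

(** On u, v >= 0 the function exp((- p + i q) u) has modulus at most 1, hence a
   derivative bounded by p + |q|. *)
Lemma chirp_lipschitz (p q u v : R) : 0 <= p -> 0 <= u -> 0 <= v ->
  `|expR (- p * u) * cos (q * u) - expR (- p * v) * cos (q * v)| <=
    (p + `|q|) * `|u - v| /\
  `|expR (- p * u) * sin (q * u) - expR (- p * v) * sin (q * v)| <=
    (p + `|q|) * `|u - v|.
Proof.
move=> p0; wlog vu : u v / v <= u.
  move=> h u0 v0; have [vu|/ltW uv] := leP v u; first exact: h.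
  rewrite distrC [`|u - v|]distrC [X in _ /\ X <= _]distrC; exact: h.
move=> u0 v0; rewrite [`|u - v|]ger0_norm ?subr_ge0//.
have e1 x : v <= x -> expR (- p * x) <= 1.
  move=> vx; rewrite -expR0 ler_expR mulNr oppr_le0 mulr_ge0//.
  exact: le_trans vx.
split.
  apply: (@lipschitz_of_derive (fun x => expR (- p * x) * cos (q * x))
    (fun x => expR (- p * x) * (- p * cos (q * x) - q * sin (q * x)))) => //.
    by move=> x; derive_tac; ring.
  move=> x vx _; rewrite normrM ger0_norm ?expR_ge0//.
  rewrite -[leRHS]mul1r ler_pM ?expR_ge0 ?e1//.
  rewrite (le_trans (ler_normB _ _))// lerD//.
    by rewrite normrM normrN (ger0_norm p0) ler_piMr ?cos_norm.
  by rewrite normrM ler_piMr ?sin_norm.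
apply: (@lipschitz_of_derive (fun x => expR (- p * x) * sin (q * x))
  (fun x => expR (- p * x) * (- p * sin (q * x) + q * cos (q * x)))) => //.
  by move=> x; derive_tac; ring.
move=> x vx _; rewrite normrM ger0_norm ?expR_ge0//.
rewrite -[leRHS]mul1r ler_pM ?expR_ge0 ?e1//.
rewrite (le_trans (ler_normD _ _))// lerD//.
  by rewrite normrM normrN (ger0_norm p0) ler_piMr ?sin_norm.
by rewrite normrM ler_piMr ?cos_norm.
Qed.

Variable (e : R).
Hypothesis e0 : 0 < e.

Lemma chirp_re_gt0 t : 0 < chirp_re e t.
Proof.
have et : 0 < e ^+ 2 + t ^+ 2 by rewrite ltr_pwDl ?exprn_gt0// sqr_ge0.
by rewrite /chirp_re divr_gt0// mulr_gt0.
Qed.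

Lemma chirp_rate t : t != 0 -> chirp_re e t + `|chirp_im e t| <= 3 / 8 / `|t|.
Proof.
move=> t0; have t0' : 0 < `|t| by rewrite normr_gt0.
have t2 : t ^+ 2 = `|t| ^+ 2 by rewrite real_normK ?num_real.
have et : 0 < e ^+ 2 + `|t| ^+ 2 by rewrite ltr_pwDl ?exprn_gt0// sqr_ge0.
rewrite /chirp_re /chirp_im normrM t2 normfV.
have et4 : 0 <= 4 * (e ^+ 2 + `|t| ^+ 2) by apply: mulr_ge0 => //; exact: ltW.
rewrite (ger0_norm et4).
rewrite -mulrDl ler_pdivrMr ?mulr_gt0//.
have -> : 3 / 8 / `|t| * (4 * (e ^+ 2 + `|t| ^+ 2)) =
    (3 / 2) * (e ^+ 2 + `|t| ^+ 2) / `|t|.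
  by field; rewrite gt_eqF.
rewrite ler_pdivlMr//.
have := sqr_ge0 (e - `|t|); have := sqr_ge0 (e - `|t| / 2); nra.
Qed.

Definition decay_rate (t : R) : R := Num.sqrt pi / (`|t| * Num.sqrt `|t|).

Lemma decay_rate_ge0 t : 0 <= decay_rate t.
Proof. by rewrite divr_ge0 ?mulr_ge0. Qed.

Lemma Ec_Es_norm t : t != 0 -> `|Ec e t 0| + `|Es e t 0| <= Num.sqrt pi / Num.sqrt `|t|.
Proof.
move=> t0; have t0' : 0 < `|t| by rewrite normr_gt0.
have s0 : 0 < Num.sqrt `|t| by rewrite sqrtr_gt0.
have h := Ec_Es_le e0 t0.
rewrite -(@ler_pXn2r _ 2) ?nnegrE ?addr_ge0 ?divr_ge0//.
rewrite expr_div_n !sqr_sqrtr ?pi_ge0//.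
have E : pi / `|t| = 4 * (pi / (4 * `|t|)) by field; rewrite gt_eqF.
rewrite -[Ec e t 0 ^+ 2]real_normK ?num_real// in h.
rewrite -[Es e t 0 ^+ 2]real_normK ?num_real// in h.
rewrite E; move: h; set Q := pi / _; set a := `|_|; set b := `|_| => h.
have := sqr_ge0 (a - b); have := sqr_ge0 a; have := sqr_ge0 b; nra.
Qed.

Let combine (a b A B K : R) : `|a| <= K -> `|b| <= K ->
  `|a * A + b * B| <= K * (`|A| + `|B|).
Proof.
move=> aK bK; rewrite (le_trans (ler_normD _ _))// !normrM mulrDr.
by rewrite lerD ?ler_wpM2r.
Qed.

(** The exponents of the incident and of the reflected wave differ by 4 x y
   times 1 / (4 (e - i t)), which gains the factor x y / |t| over the size
   |t|^(-1/2) of each wave. *)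
Lemma chirp_difference t x y (a b A B : R) : t != 0 -> 0 <= x -> 0 <= y ->
  let K := (chirp_re e t + `|chirp_im e t|) * `|(x - y) ^+ 2 - (x + y) ^+ 2| in
  `|a| <= K -> `|b| <= K -> `|A| + `|B| <= Num.sqrt pi / Num.sqrt `|t| ->
  `|a * A + b * B| <= 3 / 2 * decay_rate t * (x * y).
Proof.
move=> t0 x0 y0 K aK bK AB; apply: (le_trans (combine A B aK bK)).
have t0' : 0 < `|t| by rewrite normr_gt0.
have s0 : 0 < Num.sqrt `|t| by rewrite sqrtr_gt0.
have p0 : 0 <= chirp_re e t by exact/ltW/chirp_re_gt0.
have -> : 3 / 2 * decay_rate t * (x * y) =
    3 / 8 / `|t| * (4 * (x * y)) * (Num.sqrt pi / Num.sqrt `|t|).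
  by rewrite /decay_rate; field; rewrite !gt_eqF.
rewrite /K (_ : `|(x - y) ^+ 2 - (x + y) ^+ 2| = 4 * (x * y)); last first.
  rewrite (_ : (x - y) ^+ 2 - (x + y) ^+ 2 = - (4 * (x * y))); last by ring.
  by rewrite normrN ger0_norm// !mulr_ge0.
apply: ler_pM => //; rewrite ?mulr_ge0 ?addr_ge0//.
by rewrite ler_wpM2r ?mulr_ge0// chirp_rate.
Qed.

Lemma Ec_dispersive t x y : t != 0 -> 0 <= x -> 0 <= y ->
  `|Ec e t (x - y) - Ec e t (x + y)| <= 3 / 2 * decay_rate t * (x * y).
Proof.
move=> t0 x0 y0; rewrite (EcE e0 t (x - y)) (EcE e0 t (x + y)).
have p0 : 0 <= chirp_re e t by exact/ltW/chirp_re_gt0.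
have [h1 h2] := chirp_lipschitz (chirp_im e t) p0 (sqr_ge0 (x - y)) (sqr_ge0 (x + y)).
have := chirp_difference t0 x0 y0 h1 h2 (Ec_Es_norm t0).
by apply: le_trans; rewrite le_eqVlt; apply/orP; left; apply/eqP; congr (`|_|); ring.
Qed.

Lemma Es_dispersive t x y : t != 0 -> 0 <= x -> 0 <= y ->
  `|Es e t (x - y) - Es e t (x + y)| <= 3 / 2 * decay_rate t * (x * y).
Proof.
move=> t0 x0 y0; rewrite (EsE e0 t (x - y)) (EsE e0 t (x + y)).
have p0 : 0 <= chirp_re e t by exact/ltW/chirp_re_gt0.
have [h1 h2] := chirp_lipschitz (chirp_im e t) p0 (sqr_ge0 (x - y)) (sqr_ge0 (x + y)).
have AB : `|- Ec e t 0| + `|Es e t 0| <= Num.sqrt pi / Num.sqrt `|t|.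
  by rewrite normrN; exact: Ec_Es_norm.
have := chirp_difference t0 x0 y0 h2 h1 AB.
by apply: le_trans; rewrite le_eqVlt; apply/orP; left; apply/eqP; congr (`|_|); ring.
Qed.

Lemma Ec_gauss t z : `|Ec e t z| <=
  (`|Ec e t 0| + `|Es e t 0|) * expR (- chirp_re e t * z ^+ 2).
Proof.
rewrite (EcE e0 t z) normrM ger0_norm ?expR_ge0// mulrC ler_wpM2r ?expR_ge0//.
rewrite -[leRHS]mul1r; apply: combine; [exact: cos_norm|exact: sin_norm].
Qed.

Lemma Es_gauss t z : `|Es e t z| <=
  (`|Ec e t 0| + `|Es e t 0|) * expR (- chirp_re e t * z ^+ 2).
Proof.
rewrite (EsE e0 t z) normrM ger0_norm ?expR_ge0// mulrC ler_wpM2r ?expR_ge0//.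
set c := cos _; set d := sin _.
have d1 : `|- d| <= 1 by rewrite normrN sin_norm.
have := @combine c (- d) (Es e t 0) (Ec e t 0) 1 (cos_norm _) d1.
by rewrite mul1r mulNr [`|Es e t 0| + _]addrC.
Qed.

Lemma shifted_gauss_decay (p y : R) : 0 < p -> exists2 A, 0 <= A &
  forall s, expR (- p * (s - y) ^+ 2) <= A * lorentz s ^+ 2.
Proof.
move=> p0; pose k := 2 * (1 + y ^+ 2).
have k0 : 0 <= k by have := sqr_ge0 y; rewrite /k; lra.
exists (gauss_cst p * k ^+ 2) => [|s].
  by rewrite mulr_ge0 ?gauss_cst_ge0 ?sqr_ge0.
apply: (le_trans (gauss_decay _ p0)); rewrite -mulrA ler_wpM2l ?gauss_cst_ge0//.
have kl : 0 <= k * lorentz s by rewrite mulr_ge0// lorentz_ge0.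
rewrite -exprMn ler_pXn2r ?nnegrE ?lorentz_ge0//.
have q0 : 0 < 1 + s ^+ 2 by have := sqr_ge0 s; lra.
have q1 : 0 < 1 + (s - y) ^+ 2 by have := sqr_ge0 (s - y); lra.
rewrite /lorentz ler_pdivlMr// mulrC ler_pdivrMr// /k.
have := sqr_ge0 (s - 2 * y); have := sqr_ge0 (y * (s - y)); nra.
Qed.

Lemma kernel_decay (E : R -> R) (p c y : R) : 0 < p ->
  (forall z, `|E z| <= c * expR (- p * z ^+ 2)) ->
  exists2 A, 0 <= A & forall x, `|E (x - y) - E (x + y)| <= A * lorentz x ^+ 2.
Proof.
move=> p0 Ec.
have c0 : 0 <= c.
  have := le_trans (normr_ge0 _) (Ec 0).
  by rewrite pmulr_lge0 ?expR_gt0.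
have [A A0 hA] := shifted_gauss_decay y p0.
have [B B0 hB] := shifted_gauss_decay (- y) p0.
exists (c * A + c * B) => [|x]; first by rewrite addr_ge0 ?mulr_ge0.
rewrite (le_trans (ler_normB _ _))// mulrDl lerD//.
  by rewrite (le_trans (Ec _))// -mulrA ler_wpM2l.
rewrite (le_trans (Ec _))// -mulrA ler_wpM2l// (le_trans _ (hB x))//.
by rewrite opprK.
Qed.

Lemma sin_sin_transform (C : R -> R) x y : continuous C ->
  (forall l, `|C l| <= expR (- e * l ^+ 2)) ->
  \int[lambda]_(l in D0) (sin (l * x) * (sin (l * y) * C l)) =
  (\int[lambda]_(l in D0) (cos (l * (x - y)) * C l) -
   \int[lambda]_(l in D0) (cos (l * (x + y)) * C l)) / 2.
Proof.
move=> cC leC.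
transitivity (\int[lambda]_(l in D0) (2^-1 * (cos (l * (x - y)) * C l) +
    (- 2^-1) * (cos (l * (x + y)) * C l))).
  apply: eq_Rintegral => l _; rewrite !mulrDr mulrN cosB cosD.
  by field.
rewrite Rintegral_lin; [|exact: (decaying_cos_weight e0)..].
by ring.
Qed.

End kernel_bounds.

(** * Radial and spectral integrals *)

Section lebesgue_shift.
Context {R : realType}.
Local Notation lambda := (@lebesgue_measure R).
Local Open Scope ereal_scope.

Let shift (a : R) : measurableTypeR R -> measurableTypeR R := fun x => (a + x)%R.

Let measurable_shift (a : R) : measurable_fun setT (shift a).
Proof. by apply: measurable_funD. Qed.

Let lebesgue_measure_shift (a : R) (A : set (measurableTypeR R)) :
  measurable A -> lambda A = pushforward lambda (shift a) A.
Proof.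
move=> mA; pose f_mixin := isMeasurableFun.Build _ _ _ _ _ (measurable_shift a).
pose f : {mfun _ >-> _} := HB.pack (shift a) f_mixin.
apply: (@lebesgue_measure_unique R (pushforward lambda f)) => // X.
move=> /ocitvP[->|[[u v] /= uv ->]]; first by rewrite !measure0.
have E : f @^-1` `]u, v]%classic = `](u - a)%R, (v - a)%R]%classic.
  apply/seteqP; split => x /=; rewrite !in_itv/= /shift => /andP[h1 h2];
    by apply/andP; split; lra.
rewrite /pushforward E !lebesgue_measure_itv/= !lte_fin ltrD2r uv -!EFinB.
by congr (_%:E); lra.
Qed.

(** Translation invariance, from the uniqueness of Lebesgue measure. *)
Lemma ge0_integral_shift (a : R) (f : R -> \bar R) : measurable_fun setT f ->
  (forall x, 0 <= f x) ->
  \int[lambda]_x f x = \int[lambda]_x f (a + x)%R.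
Proof.
move=> mf f0; pose g_mixin := isMeasurableFun.Build _ _ _ _ _ (measurable_shift a).
pose g : {mfun _ >-> _} := HB.pack (shift a) g_mixin.
transitivity (\int[pushforward lambda g]_x f x).
  apply: eq_measure_integral => A mA _; exact: lebesgue_measure_shift.
rewrite (ge0_integral_pushforward (phi := g))//.
Qed.

End lebesgue_shift.

Section radial_integrals.
Context {R : realType}.
Local Notation lambda := (@lebesgue_measure R).
Local Notation D0 := (`[0%R, +oo[%classic : set R).
Local Notation D1 := (`[1%R, +oo[%classic : set R).
Local Notation mu := (@radial_measure R).
Local Notation nu := (spectral_measure R).
Local Open Scope ereal_scope.

Let w (x : measurableTypeR R) : R := (x ^+ 2 * \1_D1 x)%R.

Let mw : measurable_fun [set: measurableTypeR R] w.
Proof. by apply: measurable_funM => //; exact: measurable_indic. Qed.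

Let w0 x : (0 <= w x)%R.
Proof. by rewrite mulr_ge0 ?sqr_ge0. Qed.

Let muE (A : set (measurableTypeR R)) : measurable A ->
  mu A = \int[lambda]_(x in A) (w x)%:E.
Proof.
move=> mA; rewrite /= /radial_measure integral_mkcondr; apply: eq_integral => x _.
by rewrite patchE /w indicE; case: ifPn => _; rewrite ?mulr1 ?mulr0.
Qed.

Let nuE (A : set (measurableTypeR R)) : measurable A ->
  nu A = \int[lambda]_(x in A) (\1_D0 x)%:E.
Proof.
by move=> mA; rewrite integral_indic//= /mrestr setIC.
Qed.

Lemma radial_ae_D1 : {ae mu, forall x, D1 x}.
Proof.
exists (~` D1); split => //; first exact: measurableC.
rewrite muE; last exact: measurableC.
rewrite integral0_eq// => x Dx; rewrite /w indicE memNset//.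
by rewrite mulr0.
Qed.

Lemma spectral_ae_D0 : {ae nu, forall x, D0 x}.
Proof.
exists (~` D0); split => //; first exact: measurableC.
by rewrite /= /mrestr setICl measure0.
Qed.

Lemma ge0_radial_integral (f : R -> \bar R) : measurable_fun D1 f ->
  (forall x, 0 <= f x) ->
  \int[mu]_x f x = \int[lambda]_(x in D1) (f x * (x ^+ 2)%:E).
Proof.
move=> mf f0.
transitivity (\int[mu]_x (f \_ D1) x).
  apply: eq_integral_ae; apply: ae_mono radial_ae_D1 => x Dx.
  by rewrite patchE mem_set.
rewrite (@ge0_integral_density _ (measurableTypeR R) R lambda mu w mw w0 muE).
- rewrite [RHS]integral_mkcond; apply: eq_integral => x _.
  rewrite !patchE /w indicE; case: ifPn => _; rewrite ?mulr1//.
  by rewrite mulr0 mule0.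
- exact/(measurable_restrictT _ _).1.
- by move=> x; rewrite patchE; case: ifPn.
Qed.

Lemma ge0_spectral_integral (f : R -> \bar R) : measurable_fun D0 f ->
  (forall x, 0 <= f x) ->
  \int[nu]_x f x = \int[lambda]_(x in D0) f x.
Proof.
move=> mf f0.
transitivity (\int[nu]_x (f \_ D0) x).
  apply: eq_integral_ae; apply: ae_mono spectral_ae_D0 => x Dx.
  by rewrite patchE mem_set.
have mi : measurable_fun [set: measurableTypeR R] (\1_D0 : measurableTypeR R -> R).
  exact: measurable_indic.
rewrite (@ge0_integral_density _ (measurableTypeR R) R lambda nu _ mi _ nuE)//.
- rewrite [RHS]integral_mkcond; apply: eq_integral => x _.
  rewrite !patchE indicE; case: ifPn => _; rewrite ?mule1//.
  by rewrite mul0e.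
- exact/(measurable_restrictT _ _).1.
- by move=> x; rewrite patchE; case: ifPn.
Qed.

Lemma ge0_radial_integral0 (f : R -> \bar R) : measurable_fun D1 f ->
  (forall x, 0 <= f x) ->
  \int[mu]_x f x = \int[lambda]_(x in D0) (f (1 + x)%R * ((1 + x) ^+ 2)%:E).
Proof.
move=> mf f0; rewrite ge0_radial_integral// integral_mkcond.
rewrite (ge0_integral_shift 1).
- rewrite [RHS]integral_mkcond; apply: eq_integral => x _.
  rewrite !patchE; congr (if _ then _ else _).
  by apply/idP/idP; rewrite !inE/= !in_itv/= !andbT lerDl.
- apply/(measurable_restrictT _ _).1 => //; apply: emeasurable_funM => //.
  by apply/measurable_EFinP.
- by move=> x; rewrite patchE; case: ifPn => // _; rewrite mule_ge0// lee_fin sqr_ge0.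
Qed.

Local Close Scope ereal_scope.

Lemma Rintegral_posneg (m : {measure set (measurableTypeR R) -> \bar R})
  (D : set (measurableTypeR R)) (f : R -> R) : (\int[m]_(x in D) (f x)%:E =
  \int[m]_(x in D) (Num.max (f x) 0)%:E - \int[m]_(x in D) (Num.max (- f x) 0)%:E)%E.
Proof.
rewrite integralE; congr (_ - _)%E; apply: eq_integral => x _.
  by rewrite funeposE EFin_max.
by rewrite funenegE EFin_max.
Qed.

Lemma radial_Rintegral (f : R -> R) : measurable_fun D1 f ->
  \int[mu]_x f x = \int[lambda]_(x in D0) (f (1 + x) * (1 + x) ^+ 2).
Proof.
move=> mf; rewrite /Rintegral Rintegral_posneg [in RHS]Rintegral_posneg.
have mm : measurable_fun D1 (fun x => (Num.max (f x) 0)%:E).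
  by apply/measurable_EFinP; exact: measurable_maxr.
have mm' : measurable_fun D1 (fun x => (Num.max (- f x) 0)%:E).
  by apply/measurable_EFinP; apply: measurable_maxr => //; exact: measurableT_comp.
rewrite ge0_radial_integral0//; last by move=> x; rewrite lee_fin le_max lexx orbT.
rewrite ge0_radial_integral0//; last by move=> x; rewrite lee_fin le_max lexx orbT.
congr (fine (_ - _)); apply: eq_integral => x _; rewrite -EFinM;
  by rewrite maxr_pMl ?sqr_ge0// mul0r ?mulNr.
Qed.

Lemma spectral_Rintegral (f : R -> R) : measurable_fun D0 f ->
  \int[nu]_x f x = \int[lambda]_(x in D0) f x.
Proof.
move=> mf; rewrite /Rintegral Rintegral_posneg [in RHS]Rintegral_posneg.
have mm : measurable_fun D0 (fun x => (Num.max (f x) 0)%:E).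
  by apply/measurable_EFinP; exact: measurable_maxr.
have mm' : measurable_fun D0 (fun x => (Num.max (- f x) 0)%:E).
  by apply/measurable_EFinP; apply: measurable_maxr => //; exact: measurableT_comp.
rewrite ge0_spectral_integral//; last by move=> x; rewrite lee_fin le_max lexx orbT.
by rewrite ge0_spectral_integral//; last by move=> x; rewrite lee_fin le_max lexx orbT.
Qed.

End radial_integrals.

(** * The heat kernel of the half-line *)

Section heat_kernel.
Context {R : realType}.
Local Notation lambda := (@lebesgue_measure R).
Local Notation D0 := (`[0%R, +oo[%classic : set R).

(** Such functions stay decaying, hence integrable, after multiplication by a
   polynomial of degree two. *)
Definition strongly_decaying (h : R -> R) := continuous h /\
  exists A, forall x, `|h x| <= A * lorentz x ^+ 2.

Lemma strongly_decaying_mul (P h : R -> R) c : strongly_decaying h ->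
  continuous P -> (forall x, `|P x| <= c * (1 + x ^+ 2)) ->
  decaying (fun x => P x * h x).
Proof.
move=> [ch [A hA]] cP Pc; split.
  by move=> x; apply: cvgM; [exact: cP|exact: ch].
exists (c * A) => x _; rewrite normrM.
have q0 : 0 < 1 + x ^+ 2 by have := sqr_ge0 x; lra.
have -> : c * A * lorentz x = (c * (1 + x ^+ 2)) * (A * lorentz x ^+ 2).
  by rewrite /lorentz; field; rewrite gt_eqF.
by rewrite ler_pM.
Qed.

Section strongly_decaying_transforms.
Variable h : R -> R.
Hypothesis sh : strongly_decaying h.

Lemma strongly_decayingW : decaying h.
Proof.
have := @strongly_decaying_mul (fun=> 1) h 1 sh.
have -> : (fun x => 1 * h x) = h by apply/funext => x; rewrite mul1r.
apply; first by move=> x; exact: cvg_cst.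
by move=> x; rewrite normr1 mul1r lerDl sqr_ge0.
Qed.

Lemma strongly_decaying_cos l : decaying (fun x => cos (x * l) * h x).
Proof.
apply: (@strongly_decaying_mul _ _ 1 sh); first exact: continuous_cos_lin.
by move=> x; rewrite mul1r (le_trans (cos_norm _))// lerDl sqr_ge0.
Qed.

Lemma strongly_decaying_sin l : decaying (fun x => sin (x * l) * h x).
Proof.
apply: (@strongly_decaying_mul _ _ 1 sh); first exact: continuous_sin_lin.
by move=> x; rewrite mul1r (le_trans (sin_norm _))// lerDl sqr_ge0.
Qed.

Lemma strongly_decaying_xcos l : decaying (fun x => cos (x * l) * (x * h x)).
Proof.
have -> : (fun x => cos (x * l) * (x * h x)) = (fun x => (cos (x * l) * x) * h x).
  by apply/funext => x; rewrite mulrA.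
apply: (@strongly_decaying_mul _ _ 1 sh).
  by move=> x; apply: cvgM; [exact: continuous_cos_lin|exact: cvg_id].
by move=> x; rewrite mul1r (le_trans (normM_le1 _ (cos_norm _)))// lin_le_sqr.
Qed.

Lemma strongly_decaying_xsin l : decaying (fun x => sin (x * l) * (x * h x)).
Proof.
have -> : (fun x => sin (x * l) * (x * h x)) = (fun x => (sin (x * l) * x) * h x).
  by apply/funext => x; rewrite mulrA.
apply: (@strongly_decaying_mul _ _ 1 sh).
  by move=> x; apply: cvgM; [exact: continuous_sin_lin|exact: cvg_id].
by move=> x; rewrite mul1r (le_trans (normM_le1 _ (sin_norm _)))// lin_le_sqr.
Qed.

Lemma is_derive_sin_transform (l : R) :
  is_derive l 1 (fun l : R => \int[lambda]_(x in D0) (sin (x * l) * h x))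
    (\int[lambda]_(x in D0) (cos (x * l) * (x * h x))).
Proof.
have [ch [A hA]] := sh.
apply: (@is_derive_under_integral R (fun l x => sin (x * l) * h x)
  (fun l x => cos (x * l) * (x * h x)) l A).
- by move=> k x _; derive_tac; ring.
- by move=> k; exact/decaying_integrable/strongly_decaying_sin.
- move=> k x _; rewrite (le_trans (normM_le1 _ (cos_norm _)))// normrM.
  have q0 : 0 < 1 + x ^+ 2 by have := sqr_ge0 x; lra.
  have -> : A * lorentz x = (1 + x ^+ 2) * (A * lorentz x ^+ 2).
    by rewrite /lorentz; field; rewrite gt_eqF.
  by rewrite ler_pM ?lin_le_sqr.
Qed.

Lemma is_derive_cos_transform (l : R) :
  is_derive l 1 (fun l : R => \int[lambda]_(x in D0) (cos (x * l) * h x))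
    (- \int[lambda]_(x in D0) (sin (x * l) * (x * h x))).
Proof.
have [ch [A hA]] := sh.
have hd := @is_derive_under_integral R (fun l x => cos (x * l) * h x)
  (fun l x => - 1 * (sin (x * l) * (x * h x))) l A.
apply: (@is_derive_eq _ _ _ _ _ _ _ _ (hd _ _ _)).
- by move=> k x _; derive_tac; ring.
- by move=> k; exact/decaying_integrable/strongly_decaying_cos.
- move=> k x _; rewrite mulN1r normrN.
  rewrite (le_trans (normM_le1 _ (sin_norm _)))// normrM.
  have q0 : 0 < 1 + x ^+ 2 by have := sqr_ge0 x; lra.
  have -> : A * lorentz x = (1 + x ^+ 2) * (A * lorentz x ^+ 2).
    by rewrite /lorentz; field; rewrite gt_eqF.
  by rewrite ler_pM ?lin_le_sqr.
- by rewrite RintegralZl ?mulN1r//; exact/decaying_integrable/strongly_decaying_xsin.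
Qed.

End strongly_decaying_transforms.

Section rotation_ode.
Variables (e y : R) (S C : R -> R).
Hypotheses
  (dS : forall l : R, is_derive l 1 S (y * C l - 2 * e * l * S l))
  (dC : forall l : R, is_derive l 1 C (- (y * S l) - 2 * e * l * C l))
  (S0 : S 0 = 0) (C0 : C 0 = 1).

(** The vector exp(e l^2) (S, C) rotates with angular velocity y. *)
Lemma rotation_ode (l : R) : S l = sin (l * y) * expR (- e * l ^+ 2).
Proof.
pose M (l : R) := expR (e * l ^+ 2) * (cos (l * y) * S l - sin (l * y) * C l).
pose N (l : R) := expR (e * l ^+ 2) * (sin (l * y) * S l + cos (l * y) * C l).
have M0 : M l = 0.
  transitivity (M 0); last by rewrite /M S0 mul0r sin0 mul0r mulr0 subr0 mulr0.
  apply: (@is_derive_0_is_cst R M l 0) => {}l; rewrite /M.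
  eapply is_derive_eq; [repeat first [ apply is_derive_const
    | apply is_derive_idR | apply is_derive_sqr | apply dS | apply dC
    | eapply is_derive_cosf | eapply is_derive_sinf | eapply is_derive_expf
    | eapply is_derive_mul | eapply is_derive_sub ] | cbv beta].
  by ring.
have N1 : N l = 1.
  transitivity (N 0).
    apply: (@is_derive_0_is_cst R N l 0) => k; rewrite /N.
    eapply is_derive_eq; [repeat first [ apply is_derive_const
      | apply is_derive_idR | apply is_derive_sqr | apply dS | apply dC
      | eapply is_derive_cosf | eapply is_derive_sinf | eapply is_derive_expf
      | eapply is_derive_mul | eapply is_derive_add ] | cbv beta].
    by ring.
  by rewrite /N S0 C0 mul0r sin0 cos0 expr0n mulr0 expR0 mul0r add0r !mul1r.
have h := cos2Dsin2 (l * y).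
have E : expR (e * l ^+ 2) * S l = sin (l * y).
  rewrite -[RHS]mulr1 -N1 -[LHS]mulr1 -h -[RHS]addr0 -(mulr0 (cos (l * y))) -M0.
  by rewrite /M /N; ring.
have E0 : expR (e * l ^+ 2) != 0 by rewrite gt_eqF ?expR_gt0.
by rewrite mulNr expRN -E [_ * S l]mulrC mulfK.
Qed.

End rotation_ode.

Variable (e y : R).
Hypotheses (e0 : 0 < e).

(** The heat kernel of the line at time e. *)
Definition heat (z : R) : R := expR (- (4 * e)^-1 * z ^+ 2) / (2 * Num.sqrt (pi * e)).

(** The mirror charge at - y makes the kernel vanish at 0; with the opposite
   sign one gets the Neumann kernel, which enters the derivative. *)
Definition heat_odd (x : R) : R := heat (x - y) - heat (x + y).
Definition heat_even (x : R) : R := heat (x - y) + heat (x + y).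

Lemma heat_ge0 z : 0 <= heat z.
Proof. by rewrite divr_ge0 ?expR_ge0// mulr_ge0. Qed.

Lemma heatN z : heat (- z) = heat z.
Proof. by rewrite /heat sqrrN. Qed.

Lemma normal_heat m x : normal_pdf m (Num.sqrt (2 * e)) x = heat (x - m).
Proof.
have s2 : Num.sqrt (2 * e) ^+ 2 = 2 * e by rewrite sqr_sqrtr// mulr_ge0// ltW.
have s0 : Num.sqrt (2 * e) != 0 by rewrite gt_eqF// sqrtr_gt0 mulr_gt0.
rewrite normal_pdfE// /normal_fun s2 /normal_peak s2 /heat mulrC; congr (_ / _).
  by congr (expR _); rewrite -[_ *+ 2]mulr_natr; field; rewrite gt_eqF.
have -> : 2 * e * pi *+ 2 = 2 ^+ 2 * (pi * e) by rewrite -mulr_natr; ring.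
by rewrite sqrtrM ?sqr_ge0// sqrtr_sqr ger0_norm.
Qed.

Lemma is_derive_heat (c x : R) :
  is_derive x 1 (fun x => heat (x + c)) (- (2 * e)^-1 * (x + c) * heat (x + c)).
Proof.
have -> : (fun x => heat (x + c)) = (fun x => expR (- (4 * e)^-1 *
    ((x + c) * (x + c))) * (2 * Num.sqrt (pi * e))^-1).
  by apply/funext => z; rewrite /heat expr2.
rewrite /heat expr2; set k := (2 * Num.sqrt _)^-1.
by derive_tac; field; rewrite gt_eqF.
Qed.

Lemma strongly_decaying_heat c : strongly_decaying (fun x => heat (x + c)).
Proof.
split; first by move=> x; exact: is_derive_cont (is_derive_heat c x).
have p0 : 0 < (4 * e)^-1 by rewrite invr_gt0 mulr_gt0.
have [A A0 hA] := shifted_gauss_decay (- c) p0.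
exists (A / (2 * Num.sqrt (pi * e))) => x; rewrite ger0_norm ?heat_ge0//.
rewrite /heat mulrAC ler_wpM2r ?invr_ge0 ?mulr_ge0//.
by have := hA x; rewrite opprK.
Qed.

Lemma is_derive_heat_odd (x : R) : is_derive x 1 heat_odd
  (- (2 * e)^-1 * (x * heat_odd x - y * heat_even x)).
Proof.
have := is_derive_sub (is_derive_heat (- y) x) (is_derive_heat y x).
by move/is_derive_eq; apply; rewrite /heat_odd /heat_even; ring.
Qed.

Lemma is_derive_heat_even (x : R) : is_derive x 1 heat_even
  (- (2 * e)^-1 * (x * heat_even x - y * heat_odd x)).
Proof.
have := is_derive_add (is_derive_heat (- y) x) (is_derive_heat y x).
by move/is_derive_eq; apply; rewrite /heat_odd /heat_even; ring.
Qed.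

Lemma strongly_decaying_heat_odd : strongly_decaying heat_odd.
Proof.
have [c1 [A hA]] := strongly_decaying_heat (- y).
have [c2 [B hB]] := strongly_decaying_heat y.
split; first by move=> x; exact: is_derive_cont (is_derive_heat_odd x).
exists (A + B) => x; rewrite (le_trans (ler_normB _ _))// mulrDl.
exact: lerD (hA x) (hB x).
Qed.

Lemma strongly_decaying_heat_even : strongly_decaying heat_even.
Proof.
have [c1 [A hA]] := strongly_decaying_heat (- y).
have [c2 [B hB]] := strongly_decaying_heat y.
split; first by move=> x; exact: is_derive_cont (is_derive_heat_even x).
exists (A + B) => x; rewrite (le_trans (ler_normD _ _))// mulrDl.
exact: lerD (hA x) (hB x).
Qed.

Let so := strongly_decaying_heat_odd.
Let se := strongly_decaying_heat_even.

Lemma heat_even_mass : \int[lambda]_(x in D0) heat_even x = 1.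
Proof.
have evenE x : heat_even (- x) = heat_even x.
  rewrite /heat_even -opprD heatN (_ : - x + y = - (x - y)); last by ring.
  by rewrite heatN addrC.
have ev0 x : 0 <= heat_even x by rewrite addr_ge0 ?heat_ge0.
have := @ge0_symfun_integralT R heat_even ev0 se.1 (fun x => esym (evenE x)).
have -> : [set x : R | 0 <= x] = D0.
  by apply/seteqP; split => x /=; rewrite in_itv/= andbT.
have -> : (\int[lambda]_x (heat_even x)%:E = 2%:E)%E.
  under eq_integral do rewrite EFinD.
  rewrite ge0_integralD//.
  - under eq_integral do rewrite -normal_heat.
    rewrite integral_normal_pdf.
    have hy x : heat (x + y) = normal_pdf (- y) (Num.sqrt (2 * e)) x.
      by rewrite normal_heat opprK.
    under eq_integral do rewrite hy.
    by rewrite integral_normal_pdf -EFinD.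
  - by move=> x _; rewrite lee_fin heat_ge0.
  - apply/measurable_EFinP; apply: continuous_measurable_fun.
    exact: (strongly_decaying_heat (- y)).1.
  - by move=> x _; rewrite lee_fin heat_ge0.
  - apply/measurable_EFinP; apply: continuous_measurable_fun.
    exact: (strongly_decaying_heat y).1.
rewrite -[X in (_ = _ * X)%E]fineK; last first.
  exact/integrable_fin_num/decaying_integrable/strongly_decayingW.
rewrite -EFinM => -[]; rewrite -/(Rintegral lambda D0 heat_even) => h.
by apply: (@mulfI _ 2) => //; rewrite mulr1 -h.
Qed.

(** Differentiation in l and integration by parts in x show that the sine
   transform of heat_odd and the cosine transform of heat_even solve the system
   of rotation_ode. *)
Lemma heat_odd_transform l : \int[lambda]_(x in D0) (sin (x * l) * heat_odd x) =
  sin (l * y) * expR (- e * l ^+ 2).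
Proof.
pose S l := \int[lambda]_(x in D0) (sin (x * l) * heat_odd x).
pose C l := \int[lambda]_(x in D0) (cos (x * l) * heat_even x).
pose T l := \int[lambda]_(x in D0) (cos (x * l) * (x * heat_odd x)).
pose U l := \int[lambda]_(x in D0) (sin (x * l) * (x * heat_even x)).
have e2 : 2 * e != 0 by rewrite gt_eqF// mulr_gt0.
have TE k : T k = y * C k - 2 * e * k * S k.
  have : \int[lambda]_(x in D0) (1 * (- k * (sin (x * k) * heat_odd x)) +
      (- (2 * e)^-1) * (1 * (cos (x * k) * (x * heat_odd x)) +
        - y * (cos (x * k) * heat_even x))) = - (cos (0 * k) * heat_odd 0).
    apply: (@decaying_FTC R (fun x => cos (x * k) * heat_odd x)).
    - move=> x; have h := is_derive_heat_odd x.
      eapply is_derive_eq; [eapply is_derive_mul; [|exact: h]|cbv beta].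
        by derive_tac; reflexivity.
      by cbv beta; ring.
    - apply: decayingD; apply: decayingZ; first exact/decayingZ/strongly_decaying_sin.
      apply: decayingD; apply: decayingZ; first exact: strongly_decaying_xcos.
      exact: strongly_decaying_cos.
    - exact: strongly_decaying_cos.
  have -> : heat_odd 0 = 0 by rewrite /heat_odd sub0r add0r heatN subrr.
  rewrite mulr0 oppr0 Rintegral_lin; last 2 first.
  - exact/decayingZ/strongly_decaying_sin.
  - apply: decayingD; apply: decayingZ; first exact: strongly_decaying_xcos.
    exact: strongly_decaying_cos.
  rewrite RintegralZl//; last exact/decaying_integrable/strongly_decaying_sin.
  rewrite Rintegral_lin; [|exact: strongly_decaying_xcos|exact: strongly_decaying_cos].
  rewrite -/(S k) -/(C k) -/(T k) => h.
  have : (2 * e) * (1 * (- k * S k) + - (2 * e)^-1 * (1 * T k + - y * C k)) = 0.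
    by rewrite h mulr0.
  rewrite mulrDr [2 * e * (- _ * _)]mulrA mulrN divff//; lra.
have UE k : U k = y * S k + 2 * e * k * C k.
  have : \int[lambda]_(x in D0) (1 * (k * (cos (x * k) * heat_even x)) +
      (- (2 * e)^-1) * (1 * (sin (x * k) * (x * heat_even x)) +
        - y * (sin (x * k) * heat_odd x))) = - (sin (0 * k) * heat_even 0).
    apply: (@decaying_FTC R (fun x => sin (x * k) * heat_even x)).
    - move=> x; have h := is_derive_heat_even x.
      eapply is_derive_eq; [eapply is_derive_mul; [|exact: h]|cbv beta].
        by derive_tac; reflexivity.
      by cbv beta; ring.
    - apply: decayingD; apply: decayingZ; first exact/decayingZ/strongly_decaying_cos.
      apply: decayingD; apply: decayingZ; first exact: strongly_decaying_xsin.
      exact: strongly_decaying_sin.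
    - exact: strongly_decaying_sin.
  rewrite mul0r sin0 mul0r oppr0 Rintegral_lin; last 2 first.
  - exact/decayingZ/strongly_decaying_cos.
  - apply: decayingD; apply: decayingZ; first exact: strongly_decaying_xsin.
    exact: strongly_decaying_sin.
  rewrite RintegralZl//; last exact/decaying_integrable/strongly_decaying_cos.
  rewrite Rintegral_lin; [|exact: strongly_decaying_xsin|exact: strongly_decaying_sin].
  rewrite -/(S k) -/(C k) -/(U k) => h.
  have : (2 * e) * (1 * (k * C k) + - (2 * e)^-1 * (1 * U k + - y * S k)) = 0.
    by rewrite h mulr0.
  rewrite mulrDr [2 * e * (- _ * _)]mulrA mulrN divff//; lra.
apply: (@rotation_ode e y S C) => [k|k||].
- by apply: (is_derive_eq (is_derive_sin_transform so k)); rewrite -/(T k) TE.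
- apply: (is_derive_eq (is_derive_cos_transform se k)); rewrite -/(U k) UE.
  by ring.
- transitivity (\int[lambda]_(x in D0) (0 : R)).
    by apply: eq_Rintegral => x _; rewrite mulr0 sin0 mul0r.
  by rewrite Rintegral_cst// mul0r.
- rewrite -heat_even_mass; apply: eq_Rintegral => x _.
  by rewrite mulr0 cos0 mul1r.
Qed.

End heat_kernel.

(** * Square norms and profiles *)

Section square_norms.
Context {R : realType}.
Implicit Types (m : {measure set (measurableTypeR R) -> \bar R}) (f : R -> R[i]).
Local Open Scope ereal_scope.

Definition sqnorm m f := \int[m]_x (Normc.normc (f x) ^+ 2)%:E.

Lemma sqnorm_ge0 m f : 0 <= sqnorm m f.
Proof. by apply: integral_ge0 => x _; rewrite lee_fin sqr_ge0. Qed.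

Lemma cLnorm2E m f : cLnorm m 2%:E f = sqnorm m f `^ 2^-1.
Proof.
rewrite /cLnorm unlock; congr (_ `^ _); apply: eq_integral => x _ /=.
by rewrite ger0_norm ?normc_ge0// powR_mulrn// normc_ge0.
Qed.

Lemma sqnormE m f : sqnorm m f = cLnorm m 2%:E f `^ 2.
Proof.
by rewrite cLnorm2E -poweRrM mulVf// poweRe1// sqnorm_ge0.
Qed.

Lemma cLnorm2_lty m f : cLnorm m 2%:E f < +oo -> sqnorm m f < +oo.
Proof. by rewrite sqnormE; exact: poweR_lty. Qed.

Lemma cLnorm2_le m f (e : R) : (0 <= e)%R -> sqnorm m f <= (e ^+ 2)%:E ->
  cLnorm m 2%:E f <= e%:E.
Proof.
move=> e0 h; rewrite cLnorm2E.
have -> : e%:E = (e ^+ 2)%:E `^ 2^-1.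
  by rewrite poweR_EFin powR12_sqrt ?sqr_ge0// sqrtr_sqr ger0_norm.
apply: gt0_ler_poweR => //; rewrite ?invr_ge0// in_itv/= ?leey ?andbT.
  exact: sqnorm_ge0.
by rewrite lee_fin sqr_ge0.
Qed.

Lemma sqnorm_le m f (e : R) : (0 <= e)%R -> cLnorm m 2%:E f <= e%:E ->
  sqnorm m f <= (e ^+ 2)%:E.
Proof.
move=> e0 h; rewrite sqnormE.
have -> : (e ^+ 2)%:E = e%:E `^ 2 by rewrite poweR_EFin powR_mulrn.
apply: gt0_ler_poweR => //; rewrite in_itv/= ?leey ?andbT//.
exact: Lnorm_ge0.
Qed.

Lemma ge0_cvge0P (u : nat -> \bar R) : (forall n, 0 <= u n) ->
  u @ \oo --> 0 <-> forall e : R, (0 < e)%R -> \forall n \near \oo, u n <= e%:E.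
Proof.
move=> u0; split=> [/fine_cvgP[fu /cvgrPdist_le cu] e e0|h].
  near=> n; have fn : u n \is a fin_num by near: n.
  rewrite -(fineK fn) lee_fin; have : (`|0 - fine (u n)| <= e)%R by near: n; exact: cu.
  by rewrite sub0r normrN ger0_norm// fine_ge0.
apply/fine_cvgP; split.
  apply: filterS (h 1%R ltr01) => n un.
  by rewrite ge0_fin_numE// (le_lt_trans un)// ltry.
apply/cvgrPdist_le => e e0; apply: filterS (h e e0) => n un.
have fn : u n \is a fin_num by rewrite ge0_fin_numE// (le_lt_trans un)// ltry.
by rewrite sub0r normrN /= ger0_norm ?fine_ge0// -lee_fin fineK.
Unshelve. all: by end_near. Qed.

Lemma cLnorm2_cvg0P m (f_ : nat -> R -> R[i]) :
  (fun n => cLnorm m 2%:E (f_ n)) @ \oo --> 0 <->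
  forall e : R, (0 < e)%R -> \forall n \near \oo, sqnorm m (f_ n) <= e%:E.
Proof.
rewrite ge0_cvge0P; last by move=> n; exact: Lnorm_ge0.
split=> h e e0.
  have s0 : (0 < Num.sqrt e)%R by rewrite sqrtr_gt0.
  apply: filterS (h _ s0) => n hn.
  by rewrite -(sqr_sqrtr (ltW e0)); exact: (sqnorm_le (ltW s0)).
have e20 : (0 < e ^+ 2)%R by rewrite exprn_gt0.
by apply: filterS (h _ e20) => n; apply: cLnorm2_le; exact: ltW.
Qed.

Lemma sqnorm_Re m f : \int[m]_x (complex.Re (f x) ^+ 2)%:E <= sqnorm m f.
Proof.
apply: ge0_le_integral_ae => [x|x|]; rewrite ?lee_fin ?sqr_ge0//.
apply: aeW => x; rewrite lee_fin normc_sqr lerDl; exact: sqr_ge0.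
Qed.

Lemma sqnorm_Im m f : \int[m]_x (complex.Im (f x) ^+ 2)%:E <= sqnorm m f.
Proof.
apply: ge0_le_integral_ae => [x|x|]; rewrite ?lee_fin ?sqr_ge0//.
apply: aeW => x; rewrite lee_fin normc_sqr lerDr; exact: sqr_ge0.
Qed.

End square_norms.

Section radial_profiles.
Context {R : realType}.
Local Notation lambda := (@lebesgue_measure R).
Local Notation D0 := (`[0%R, +oo[%classic : set R).
Local Notation D1 := (`[1%R, +oo[%classic : set R).
Local Notation mu := (@radial_measure R).
Local Notation nu := (spectral_measure R).

(** The substitution r = 1 + x, U(x) = r u(r) turns radial functions on the
   exterior of the ball into functions on the half-line, isometrically. *)
Definition profile (u : R -> R) (x : R) : R := u (1 + x) * (1 + x).

Lemma measurable_shift1 (u : R -> R) : measurable_fun D1 u ->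
  measurable_fun D0 (fun x => u (1 + x)).
Proof.
move=> mu1; apply: (@measurable_comp _ _ _ _ _ _ D1) => //.
  by move=> _ [x /= + <-]; rewrite !in_itv/= !andbT lerDl.
by apply: measurable_funTS; apply: measurable_funD.
Qed.

Lemma measurable_profile (u : R -> R) : measurable_fun D1 u ->
  measurable_fun D0 (profile u).
Proof.
move=> mu1; apply: measurable_funM; first exact: measurable_shift1.
by apply: measurable_funTS; apply: measurable_funD.
Qed.

Lemma integrable_sqr_profile (u : R -> R) : measurable_fun D1 u ->
  (\int[mu]_x (u x ^+ 2)%:E < +oo)%E ->
  lambda.-integrable D0 (EFin \o (fun x => profile u x ^+ 2)).
Proof.
move=> mu1 fin; apply/integrableP; split.
  by apply/measurable_EFinP; apply: measurable_funX; exact: measurable_profile.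
apply: le_lt_trans fin; rewrite ge0_radial_integral0.
- rewrite le_eqVlt; apply/orP; left; apply/eqP; apply: eq_integral => x _ /=.
  by rewrite -EFinM ger0_norm ?sqr_ge0// /profile exprMn.
- by apply/measurable_EFinP; exact: measurable_funX.
- by move=> x; rewrite lee_fin sqr_ge0.
Qed.

Lemma integrable_sqr_spectral (v : R -> R) : measurable_fun D0 v ->
  (\int[nu]_x (v x ^+ 2)%:E < +oo)%E ->
  lambda.-integrable D0 (EFin \o (fun x => v x ^+ 2)).
Proof.
move=> mv fin; apply/integrableP; split.
  by apply/measurable_EFinP; apply: measurable_funX.
apply: le_lt_trans fin; rewrite ge0_spectral_integral.
- rewrite le_eqVlt; apply/orP; left; apply/eqP; apply: eq_integral => x _ /=.
  by rewrite ger0_norm ?sqr_ge0.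
- by apply/measurable_EFinP; exact: measurable_funX.
- by move=> x; rewrite lee_fin sqr_ge0.
Qed.

Lemma radial_L2_profile (f : R -> R[i]) : radial_L2 f ->
  [/\ measurable_fun D1 (fun x => complex.Re (f x)),
      measurable_fun D1 (fun x => complex.Im (f x)),
      lambda.-integrable D0 (EFin \o (fun x => profile (fun r => complex.Re (f r)) x ^+ 2)) &
      lambda.-integrable D0 (EFin \o (fun x => profile (fun r => complex.Im (f r)) x ^+ 2))].
Proof.
move=> [[mRe mIm] /cLnorm2_lty fin]; split => //.
- by apply: integrable_sqr_profile => //; exact: le_lt_trans (sqnorm_Re _ _) fin.
- by apply: integrable_sqr_profile => //; exact: le_lt_trans (sqnorm_Im _ _) fin.
Qed.

Lemma spectral_L2_profile (h : R -> R[i]) : spectral_L2 h ->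
  [/\ measurable_fun D0 (fun x => complex.Re (h x)),
      measurable_fun D0 (fun x => complex.Im (h x)),
      lambda.-integrable D0 (EFin \o (fun x => complex.Re (h x) ^+ 2)) &
      lambda.-integrable D0 (EFin \o (fun x => complex.Im (h x) ^+ 2))].
Proof.
move=> [[mRe mIm] /cLnorm2_lty fin]; split => //.
- by apply: integrable_sqr_spectral => //; exact: le_lt_trans (sqnorm_Re _ _) fin.
- by apply: integrable_sqr_spectral => //; exact: le_lt_trans (sqnorm_Im _ _) fin.
Qed.

End radial_profiles.

(** * The sine transform *)

Section sine_transform.
Context {R : realType}.
Local Notation lambda := (@lebesgue_measure R).
Local Notation D0 := (`[0%R, +oo[%classic : set R).
Local Notation D1 := (`[1%R, +oo[%classic : set R).
Local Notation mu := (@radial_measure R).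
Local Notation nu := (spectral_measure R).

Definition F0_const : R := Num.sqrt (2 / pi).

Lemma F0_const_ge0 : 0 <= F0_const. Proof. exact: sqrtr_ge0. Qed.

Definition sine_transform (U : R -> R) (l : R) : R :=
  F0_const * \int[lambda]_(x in D0) (sin (x * l) * U x).

Definition truncate (n : nat) (U : R -> R) (x : R) : R :=
  if 1 + x <= n%:R then U x else 0.

Lemma integrable_bounded_mul (D : set (measurableTypeR R)) (b U : R -> R) :
  measurable D -> measurable_fun D b -> (forall x, `|b x| <= 1) ->
  lambda.-integrable D (EFin \o U) ->
  lambda.-integrable D (EFin \o (fun x => b x * U x)).
Proof.
move=> mD mb b1 iU; apply: (le_integrable mD _ _ iU).
  apply/measurable_EFinP; apply: measurable_funM => //.
  by apply/measurable_EFinP; case/integrableP: iU.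
by move=> x _ /=; rewrite lee_fin; exact: normM_le1.
Qed.

Lemma measurable_sin_lin (D : set (measurableTypeR R)) l :
  measurable_fun D (fun x : R => sin (x * l)).
Proof.
by apply: measurable_funTS; apply: continuous_measurable_fun; exact: continuous_sin_lin.
Qed.

Lemma continuous_sine_transform (U : R -> R) :
  lambda.-integrable D0 (EFin \o U) -> continuous (sine_transform U).
Proof.
move=> iU l; apply: cvgM; first exact: cvg_cst.
have lI : l \in (`]l - 1, l + 1[%classic : set R) by rewrite inE/= in_itv/=; lra.
apply: (@continuity_under_integral R _ _ lambda (fun l x => sin (x * l) * U x)
  D0 _ (l - 1) (l + 1) _ _ (fun x => `|U x|)) => //.
- move=> k _; apply: integrable_bounded_mul => // [|x]; last exact: sin_norm.
  exact: measurable_sin_lin.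
- apply: aeW => x _ k _; apply: cvgM; last exact: cvg_cst.
  have cs : continuous (fun k : R => sin (x * k)).
    by move=> j; eapply is_derive_cont; derive_tac; reflexivity.
  exact: cs.
- by move/integrable_norm : iU.
- by move=> k _; apply: aeW => x _; apply: normM_le1; exact: sin_norm.
Qed.

Lemma radial_sine_integral (u : R -> R) (l : R) : measurable_fun D1 u ->
  F0_const * \int[mu]_s (sin (l * (s - 1)) / s * u s) =
  sine_transform (profile u) l.
Proof.
move=> mu1; congr (_ * _); rewrite radial_Rintegral.
  apply: eq_Rintegral => x; rewrite inE/= in_itv/= andbT => x0.
  have x1 : 1 + x != 0 by rewrite gt_eqF//; lra.
  rewrite /profile (_ : 1 + x - 1 = x); last by ring.
  by rewrite [l * x]mulrC; field.
apply: measurable_funM => //; apply: measurable_funM.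
  have : continuous (fun s : R => sin (l * (s - 1))).
    by move=> s; eapply is_derive_cont; derive_tac; reflexivity.
  by move/continuous_measurable_fun => h; exact: measurable_funTS.
apply: subspace_continuous_measurable_fun => //.
apply: continuous_in_subspaceT => x; rewrite inE/= in_itv/= andbT => x1.
by apply: cvgV; [rewrite gt_eqF//; lra|exact: cvg_id].
Qed.

Lemma measurable_truncation (n : nat) (u : R -> R) : measurable_fun D1 u ->
  measurable_fun D1 (fun s => if s <= n%:R then u s else 0).
Proof.
move=> mu1; apply: measurable_fun_if => //.
  by apply: measurable_fun_ler.
by apply: measurable_funS mu1 => // x [].
Qed.

Lemma F0_integral_Re_Im (f : R -> R[i]) (n : nat) (l : R) :
  measurable_fun D1 (fun r => complex.Re (f r)) ->
  measurable_fun D1 (fun r => complex.Im (f r)) ->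
  let F := F0_integral (fun s => if s <= n%:R then f s else 0) l in
  complex.Re F =
    sine_transform (truncate n (profile (fun r => complex.Re (f r)))) l /\
  complex.Im F =
    sine_transform (truncate n (profile (fun r => complex.Im (f r)))) l.
Proof.
move=> mRe mIm F.
have trE (u : R -> R) : profile (fun s => if s <= n%:R then u s else 0) =
    truncate n (profile u).
  apply/funext => x; rewrite /profile /truncate; case: ifP => _ //.
  by rewrite mul0r.
rewrite /F /F0_integral -/F0_const Re_realM Im_realM /cintegral /=.
rewrite -!trE -!radial_sine_integral; [|exact: measurable_truncation..].
split; congr (_ * _); apply: eq_Rintegral => s _.
- by rewrite Re_realM; congr (_ * _); case: ifP.
- by rewrite Im_realM; congr (_ * _); case: ifP.
Qed.

(** With the index shifted by 2 the domain is a nondegenerate interval. *)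
Lemma sine_transform_truncate (n : nat) (U : R -> R) (l : R) :
  sine_transform (truncate n.+2 U) l =
  F0_const * \int[lambda]_(x in `[0%R, n.+1%:R]) (sin (x * l) * U x).
Proof.
rewrite /sine_transform; congr (_ * _).
rewrite Rintegral_mkcond [RHS]Rintegral_mkcond; apply: eq_Rintegral => x _.
rewrite !patchE /truncate.
have -> : (x \in D0) = (0 <= x).
  by apply/idP/idP; rewrite inE/= in_itv/= andbT.
have -> : (x \in (`[0%R, n.+1%:R]%classic : set R)) = (0 <= x) && (x <= n.+1%:R).
  by apply/idP/idP; rewrite inE/= in_itv/=.
have -> : (1 + x <= n.+2%:R) = (x <= n.+1%:R) by rewrite -[n.+2%:R]natr1 addrC lerD2r.
by case: (0 <= x) => //=; case: ifP; rewrite ?mulr0.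
Qed.

(** Integration by parts over [0, n + 1] gains a factor 1 / l with boundary terms
   bounded uniformly in n, and the trivial bound takes care of small l. *)
Lemma sine_transform_decay (u du : R -> R) : decaying u -> decaying du ->
  (forall x : R, is_derive x 1 u (du x)) -> exists2 K, 0 <= K &
  forall (n : nat) l, sine_transform (truncate n.+2 u) l ^+ 2 <= K * lorentz l.
Proof.
move=> du_ ddu hu.
have [cu [A uA]] := du_; have [cdu _] := ddu.
have iu := decaying_integrable du_; have idu := decaying_integrable ddu.
pose B := \int[lambda]_(x in D0) `|u x|.
pose B' := \int[lambda]_(x in D0) `|du x|.
have A0 : 0 <= A.
  have := le_trans (normr_ge0 _) (uA 0 (lexx 0)).
  by rewrite pmulr_lge0 ?lorentz_gt0.
have B0 : 0 <= B by apply: Rintegral_ge0.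
have B'0 : 0 <= B' by apply: Rintegral_ge0.
have uA' x : 0 <= x -> `|u x| <= A.
  by move=> /uA/le_trans; apply; rewrite ler_piMr ?lorentz_le1.
have c0 := F0_const_ge0.
pose K1 := B + A + A + B'.
exists ((F0_const * K1) ^+ 2 * 2) => [|n l]; first by rewrite mulr_ge0 ?sqr_ge0.
rewrite sine_transform_truncate exprMn.
set N : R := n.+1%:R; set I := \int[_]_(x in _) _.
have N0 : 0 < N by rewrite ltr0n.
have sub : `[0%R, N]%classic `<=` D0.
  by move=> x /=; rewrite !in_itv/= => /andP[->].
have norm_le (g c : R -> R) : lambda.-integrable D0 (EFin \o g) ->
    continuous c -> (forall x, `|c x| <= 1) ->
    `|\int[lambda]_(x in `[0%R, N]) (c x * g x)| <= \int[lambda]_(x in D0) `|g x|.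
  move=> ig cc c1.
  have igN : lambda.-integrable `[0%R, N] (EFin \o g) by exact: integrableS ig.
  have icg : lambda.-integrable `[0%R, N] (EFin \o (fun x => c x * g x)).
    apply: integrable_bounded_mul => //.
    by apply: measurable_funTS; exact: continuous_measurable_fun.
  rewrite (le_trans (le_normr_Rintegral _ icg))//.
  apply: (@le_trans _ _ (\int[lambda]_(x in `[0%R, N]) `|g x|)).
    apply: le_Rintegral => //.
    - by move/integrable_norm : icg.
    - by move/integrable_norm : igN.
    - by move=> x _; exact: normM_le1.
  have ing : lambda.-integrable D0 (EFin \o (fun x => `|g x|)).
    by move/integrable_norm : ig.
  rewrite /Rintegral fine_le//.
  - apply: integrable_fin_num => //; first exact: integrableS ing.
  - exact: integrable_fin_num.
  - by apply: ge0_subset_integral => //; case/integrableP: ing.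
have I1 : `|I| <= K1.
  have h := norm_le u (fun x => sin (x * l)) iu (@continuous_sin_lin R l)
    (fun x => sin_norm _).
  by rewrite (le_trans h)// /K1 -/B; lra.
have I2 : `|l * I| <= K1.
  have E : \int[lambda]_(x in `[0%R, N]) (- l * (sin (x * l) * u x) + cos (x * l) * du x) =
      cos (N * l) * u N - cos (0 * l) * u 0.
    have dF (x : R) : is_derive x 1 (fun x => cos (x * l) * u x)
        (- l * (sin (x * l) * u x) + cos (x * l) * du x).
      have h := hu x; eapply is_derive_eq; [eapply is_derive_mul; [|exact: h]|cbv beta].
        by derive_tac; reflexivity.
      by cbv beta; ring.
    have cF (x : R) : {for x, continuous (fun x : R => cos (x * l) * u x)}.
      exact: is_derive_cont (dF x).
    rewrite /Rintegral (@continuous_FTC2 _ _ (fun x : R => cos (x * l) * u x))//.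
    - apply: continuous_subspaceT => x; apply: cvgD.
        apply: cvgM; first exact: cvg_cst.
        by apply: cvgM; [exact: continuous_sin_lin|exact: cu].
      by apply: cvgM; [exact: continuous_cos_lin|exact: cdu].
    - split; first by move=> x _; case: (dF x).
      + by apply: cvg_at_right_filter; exact: cF.
      + by apply: cvg_at_left_filter; exact: cF.
    - by move=> x _; rewrite derive1E; have [_ ->] := dF x.
  have igN (g c : R -> R) : lambda.-integrable D0 (EFin \o g) ->
      continuous c -> (forall x, `|c x| <= 1) ->
      lambda.-integrable `[0%R, N] (EFin \o (fun x => c x * g x)).
    move=> ig cc c1; apply: integrable_bounded_mul => //.
      by apply: measurable_funTS; exact: continuous_measurable_fun.
    exact: integrableS ig.
  have is1 := igN _ _ iu (@continuous_sin_lin R l) (fun x => sin_norm _).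
  have ic1 := igN _ _ idu (@continuous_cos_lin R l) (fun x => cos_norm _).
  have is2 : lambda.-integrable `[0%R, N] (EFin \o (fun x => - l * (sin (x * l) * u x))).
    rewrite (_ : _ \o _ = (fun x => (- l)%:E * (sin (x * l) * u x)%:E)%E).
      exact: integrableZl.
    by apply/funext => x /=; rewrite EFinM.
  move: E; rewrite RintegralD// RintegralZl// -/I => E.
  have -> : l * I = \int[lambda]_(x in `[0%R, N]) (cos (x * l) * du x) -
      (cos (N * l) * u N - cos (0 * l) * u 0).
    by rewrite -E; ring.
  rewrite (le_trans (ler_normB _ _))// /K1.
  have h1 : `|\int[lambda]_(x in `[0%R, N]) (cos (x * l) * du x)| <= B'.
    exact: (norm_le du (fun x => cos (x * l)) idu (@continuous_cos_lin R l)
      (fun x => cos_norm _)).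
  have h2 : `|cos (N * l) * u N - cos (0 * l) * u 0| <= A + A.
    rewrite (le_trans (ler_normB _ _))// lerD//.
      by rewrite (le_trans (normM_le1 _ (cos_norm _)))// uA'// ltW.
    by rewrite (le_trans (normM_le1 _ (cos_norm _)))// uA'.
  lra.
have K10 : 0 <= K1 by rewrite /K1; lra.
have -> : (F0_const * K1) ^+ 2 * 2 * lorentz l =
    F0_const ^+ 2 * (K1 ^+ 2 * 2 * lorentz l) by ring.
rewrite ler_wpM2l ?sqr_ge0//.
have q0 : 0 < 1 + l ^+ 2 by have := sqr_ge0 l; lra.
rewrite /lorentz ler_pdivlMr//.
have s1 : I ^+ 2 <= K1 ^+ 2.
  by rewrite -[I ^+ 2]real_normK ?num_real// ler_pXn2r ?nnegrE.
have s2 : (l * I) ^+ 2 <= K1 ^+ 2.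
  by rewrite -[(l * I) ^+ 2]real_normK ?num_real// ler_pXn2r ?nnegrE.
by rewrite exprMn in s2; nra.
Qed.

End sine_transform.

(** * Test functions and their spectral transform *)

Section test_functions.
Context {R : realType}.
Local Notation lambda := (@lebesgue_measure R).
Local Notation D0 := (`[0%R, +oo[%classic : set R).
Local Notation D1 := (`[1%R, +oo[%classic : set R).
Local Notation mu := (@radial_measure R).
Local Notation nu := (spectral_measure R).

Lemma measurable_truncate (D : set (measurableTypeR R)) (n : nat) (U : R -> R) :
  measurable D -> measurable_fun D U -> measurable_fun D (truncate n U).
Proof.
move=> mD mU; apply: measurable_fun_if => //.
  apply: measurable_fun_ler => //; apply: measurable_funTS.
  by apply: measurable_funD.
by apply: measurable_funS mU => // x [].
Qed.

Lemma truncate_le (n : nat) (U : R -> R) x : `|truncate n U x| <= `|U x|.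
Proof. by rewrite /truncate; case: ifP => // _; rewrite normr0. Qed.

Lemma integrable_truncate (n : nat) (U : R -> R) :
  lambda.-integrable D0 (EFin \o U) ->
  lambda.-integrable D0 (EFin \o truncate n U).
Proof.
move=> iU; apply: (le_integrable _ _ _ iU) => //.
  apply/measurable_EFinP; apply: measurable_truncate => //.
  by apply/measurable_EFinP; case/integrableP: iU.
by move=> x _ /=; rewrite lee_fin; exact: truncate_le.
Qed.

Lemma truncate_cvg (U : R -> R) x : (fun n => truncate n U x) @ \oo --> U x.
Proof.
apply: cvg_near_cst; near=> n; rewrite /truncate ifT//.
by near: n; exact: nbhs_infty_ger.
Unshelve. all: by end_near. Qed.

Lemma sine_transform_truncate_cvg (U : R -> R) l :
  lambda.-integrable D0 (EFin \o U) ->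
  (fun n => sine_transform (truncate n U) l) @ \oo --> sine_transform U l.
Proof.
move=> iU; apply: cvgM; first exact: cvg_cst.
have ms := @measurable_sin_lin R D0 l.
have ib (V : R -> R) : lambda.-integrable D0 (EFin \o V) ->
    lambda.-integrable D0 (EFin \o (fun x => sin (x * l) * V x)).
  by move=> iV; apply: integrable_bounded_mul => // x; exact: sin_norm.
have [|||||//] := @Rintegral_DCT _ _ _ lambda D0
  (fun n x => sin (x * l) * truncate n U x)
  (fun x => sin (x * l) * U x) (fun x => `|U x|).
- by [].
- move=> n; have := ib _ (integrable_truncate n iU).
  by case/integrableP => /measurable_EFinP.
- by move=> x _; apply: cvgM; [exact: cvg_cst|exact: truncate_cvg].
- by move/integrable_norm : iU.
- move=> n x _; rewrite (le_trans (normM_le1 _ (sin_norm _)))//.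
  exact: truncate_le.
Qed.

Variable (e y : R).
Hypothesis e0 : 0 < e.

Definition test_profile (s : R) : R := heat_odd e y (s - 1) / s.
Definition test_spectrum (l : R) : R :=
  F0_const * (sin (l * y) * expR (- e * l ^+ 2)).

Lemma measurable_test_profile : measurable_fun D1 test_profile.
Proof.
apply: subspace_continuous_measurable_fun => //.
apply: continuous_in_subspaceT => s; rewrite inE/= in_itv/= andbT => s1.
apply: cvgM; last by apply: cvgV; [rewrite gt_eqF//; lra|exact: cvg_id].
apply: (continuous_comp (f := fun s : R => s - 1) (g := heat_odd e y)).
  by apply: cvgB; [exact: cvg_id|exact: cvg_cst].
exact: (strongly_decaying_heat_odd y e0).1.
Qed.

Lemma profile_test x : 0 <= x -> profile test_profile x = heat_odd e y x.
Proof.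
move=> x0; rewrite /profile /test_profile (_ : 1 + x - 1 = x); last by ring.
by rewrite divfK// gt_eqF//; lra.
Qed.

Lemma decaying_test_spectrum : decaying test_spectrum.
Proof.
apply: decayingZ.
have -> : (fun l => sin (l * y) * expR (- e * l ^+ 2)) =
    (fun l => sin (l * y) * cos_chirp e 0 l).
  by apply/funext => l; rewrite /cos_chirp mul0r cos0 mulr1.
apply: (decaying_sin_weight e0); first exact: continuous_cos_chirp.
exact: cos_chirp_le.
Qed.

Lemma decaying_sqr (f : R -> R) : decaying f -> exists2 A, 0 <= A &
  forall x, 0 <= x -> f x ^+ 2 <= A * lorentz x.
Proof.
move=> [_ [A fA]].
have A0 : 0 <= A.
  have := le_trans (normr_ge0 _) (fA 0 (lexx 0)).
  by rewrite pmulr_lge0 ?lorentz_gt0.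
exists (A ^+ 2) => [|x x0]; first exact: sqr_ge0.
rewrite -real_normK ?num_real//.
apply: (@le_trans _ _ ((A * lorentz x) ^+ 2)).
  by rewrite ler_pXn2r ?nnegrE ?mulr_ge0 ?lorentz_ge0// fA.
rewrite exprMn ler_wpM2l ?sqr_ge0// expr2 ler_piMr ?lorentz_ge0 ?lorentz_le1//.
Qed.

Lemma decaying_sqr_integrable (f : R -> R) : decaying f ->
  lambda.-integrable D0 (EFin \o (fun x => f x ^+ 2)).
Proof.
move=> df; have [A A0 hA] := decaying_sqr df.
apply: (@decay_integrable _ _ _ A) => //.
  apply: measurable_funX; apply: measurable_funTS.
  exact: continuous_measurable_fun df.1.
move=> x /=; rewrite in_itv/= andbT => x0.
by rewrite ger0_norm ?sqr_ge0// hA.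
Qed.

Definition test_fun (s : R) : R[i] := (test_profile s)%:C%C.
Definition test_hat (l : R) : R[i] := (test_spectrum l)%:C%C.

Lemma radial_L2_test : radial_L2 test_fun.
Proof.
split; first by split; [exact: measurable_test_profile|exact: measurable_cst].
rewrite cLnorm2E; apply: poweR_lty.
rewrite /sqnorm ge0_radial_integral0.
- have : (\int[lambda]_(x in D0) (heat_odd e y x ^+ 2)%:E < +oo)%E.
    have /integrableP[_ h] := decaying_sqr_integrable
      (strongly_decayingW (strongly_decaying_heat_odd y e0)).
    apply: le_lt_trans h; rewrite le_eqVlt; apply/orP; left; apply/eqP.
    by apply: eq_integral => x _ /=; rewrite ger0_norm ?sqr_ge0.
  apply: le_lt_trans; rewrite le_eqVlt; apply/orP; left; apply/eqP.
  apply: eq_integral => x; rewrite inE => Dx.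
  have x0 : 0 <= x by move: Dx; rewrite /= in_itv/= andbT.
  rewrite -EFinM; congr (_%:E); rewrite -profile_test// /profile exprMn.
  by rewrite normc_sqr /= expr0n addr0.
- apply/measurable_EFinP.
  have -> : (fun x => Normc.normc (test_fun x) ^+ 2) = (fun x => test_profile x ^+ 2).
    by apply/funext => x; rewrite normc_sqr /= expr0n addr0.
  by apply: measurable_funX; exact: measurable_test_profile.
- by move=> x; rewrite lee_fin sqr_ge0.
Qed.

Lemma spectral_L2_test : spectral_L2 test_hat.
Proof.
have ms : measurable_fun D0 test_spectrum.
  by apply: measurable_funTS; exact: continuous_measurable_fun decaying_test_spectrum.1.
split; first by split; [exact: ms|exact: measurable_cst].
rewrite cLnorm2E; apply: poweR_lty.
have E : (fun x => Normc.normc (test_hat x) ^+ 2) = (fun x => test_spectrum x ^+ 2).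
  by apply/funext => x; rewrite normc_sqr /= expr0n addr0.
rewrite /sqnorm ge0_spectral_integral.
- have /integrableP[_ h] := decaying_sqr_integrable decaying_test_spectrum.
  apply: le_lt_trans h; rewrite le_eqVlt; apply/orP; left; apply/eqP.
  apply: eq_integral => x _; rewrite normc_sqr /= expr0n addr0.
  by rewrite ger0_norm ?sqr_ge0.
- by apply/measurable_EFinP; rewrite E; exact: measurable_funX.
- by move=> x; rewrite lee_fin sqr_ge0.
Qed.

(** By sine_transform_decay the truncated transforms are dominated by a multiple
   of lorentz uniformly in n, so that their pointwise limit, computed by
   heat_odd_transform, is also the limit in L^2. *)
Lemma is_F0_test : is_F0 test_fun test_hat.
Proof.
split; [exact: radial_L2_test|exact: spectral_L2_test|].
apply/cLnorm2_cvg0P => d d0.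
have dh := strongly_decayingW (strongly_decaying_heat_odd y e0).
have ih := decaying_integrable dh.
pose a n l := sine_transform (truncate n (heat_odd e y)) l.
have ca n : continuous (a n).
  by apply: continuous_sine_transform; exact: integrable_truncate.
have specE l : test_spectrum l = sine_transform (heat_odd e y) l.
  by rewrite /test_spectrum /sine_transform (heat_odd_transform _ e0).
have sqE n : sqnorm nu (F0_integral (fun s => if s <= n%:R then test_fun s else 0)
    \- test_hat) = (\int[lambda]_(l in D0) ((a n l - test_spectrum l) ^+ 2)%:E)%E.
  rewrite /sqnorm -ge0_spectral_integral.
  - apply: eq_integral => l _; congr (_%:E); rewrite normc_sqr.
    have [|hRe hIm] := @F0_integral_Re_Im R test_fun n l measurable_test_profile.
      exact: measurable_cst.
    set F := F0_integral _.
    have -> : (F \- test_hat) l = F l - test_hat l by [].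
    rewrite Re_sub Im_sub hRe hIm [complex.Re _]/= [complex.Im _]/=.
    have -> : sine_transform (truncate n (profile (fun r => complex.Im (test_fun r)))) l = 0.
      rewrite /sine_transform [X in _ * X](_ : _ = 0) ?mulr0//.
      transitivity (\int[lambda]_(x in D0) (0 : R)).
        apply: eq_Rintegral => x _; rewrite /truncate /profile mul0r.
        by case: ifP; rewrite mulr0.
      by rewrite Rintegral_cst// mul0r.
    rewrite subr0 expr0n addr0; congr ((_ - _) ^+ 2).
    rewrite /a /sine_transform; congr (_ * _); apply: eq_Rintegral => x.
    rewrite inE/= in_itv/= andbT => x0; congr (_ * _); rewrite /truncate.
    by case: ifP => // _; exact: profile_test.
  - apply/measurable_EFinP; apply: measurable_funX; apply: measurable_funTS.
    apply: measurable_funB; apply: continuous_measurable_fun; first exact: ca.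
    exact: decaying_test_spectrum.1.
  - by move=> x; rewrite lee_fin sqr_ge0.
have [K K0 hK] : exists2 K, 0 <= K & forall n l, a n.+2 l ^+ 2 <= K * lorentz l.
  have dho := is_derive_heat_odd y e0.
  apply: (sine_transform_decay dh _ dho).
  apply: decayingZ.
  have -> : (fun x => x * heat_odd e y x - y * heat_even e y x) =
      (fun x => x * heat_odd e y x + - y * heat_even e y x).
    by apply/funext => x; rewrite mulNr.
  apply: decayingD; last exact/decayingZ/strongly_decayingW/strongly_decaying_heat_even.
  apply: (@strongly_decaying_mul _ _ _ 1 (strongly_decaying_heat_odd y e0)).
    by move=> x; exact: cvg_id.
  by move=> x; rewrite mul1r; exact: lin_le_sqr.
have [K' K'0 hK'] := decaying_sqr decaying_test_spectrum.
have bnd n l : 0 <= l -> `|(a n.+2 l - test_spectrum l) ^+ 2| <=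
    (2 * K + 2 * K') * lorentz l.
  move=> l0; rewrite ger0_norm ?sqr_ge0// mulrDl.
  have := hK n l; have := hK' l l0; have := sqr_ge0 (a n.+2 l + test_spectrum l).
  nra.
have [|n|l _||n l /=|_ cv] := @Rintegral_DCT _ _ _ lambda D0
  (fun n l => (a n.+2 l - test_spectrum l) ^+ 2) (fun=> 0)
  (fun l => (2 * K + 2 * K') * lorentz l).
- by [].
- apply: measurable_funX; apply: measurable_funTS.
  apply: measurable_funB; apply: continuous_measurable_fun; first exact: ca.
  exact: decaying_test_spectrum.1.
- have : (fun n => a n l - test_spectrum l) @ \oo --> 0.
    rewrite -(subrr (test_spectrum l)); apply: cvgB; last exact: cvg_cst.
    by rewrite specE; exact: sine_transform_truncate_cvg.
  rewrite -(cvg_shiftn 2) => h.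
  have -> : (fun n => (a n.+2 l - test_spectrum l) ^+ 2) =
      (fun n => (a (n + 2)%N l - test_spectrum l) * (a (n + 2)%N l - test_spectrum l)).
    by apply/funext => n; rewrite addn2 expr2.
  by rewrite -[X in _ --> X](mulr0 0); apply: cvgM.
- apply: (@decay_integrable _ _ _ (2 * K + 2 * K')) => //.
    by apply: measurable_funM => //; exact: measurable_lorentz.
  by move=> l _; rewrite ger0_norm// mulr_ge0 ?lorentz_ge0 ?addr_ge0 ?mulr_ge0.
- by rewrite in_itv/= andbT => l0; exact: bnd.
move: cv; rewrite Rintegral_cst// mul0r => /cvgrPdist_le/(_ _ d0) cv.
have [N _ hN] := cv.
exists N.+2 => // n /= Nn; have [m nm] : exists m, n = m.+2.
  by move: n Nn => [|[|m]]// _; exists m.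
have Nm : (N <= m)%N by move: Nn; rewrite nm !ltnS.
have := hN m Nm; rewrite /= sub0r normrN => hm.
have im : lambda.-integrable D0 (EFin \o (fun l => (a n l - test_spectrum l) ^+ 2)).
  rewrite nm; apply: (@decay_integrable _ _ _ (2 * K + 2 * K')) => //.
    apply: measurable_funX; apply: measurable_funTS.
    apply: measurable_funB; apply: continuous_measurable_fun; first exact: ca.
    exact: decaying_test_spectrum.1.
  move=> l /=; rewrite in_itv/= andbT => l0; exact: bnd.
rewrite sqE -(fineK (integrable_fin_num _ im))// lee_fin nm.
exact: le_trans (ler_norm _) hm.
Qed.

End test_functions.

(** * Self-adjointness of the sine transform *)

Section bounded_kernel_fubini.
Context {R : realType}.
Local Notation lambda := (@lebesgue_measure R).
Local Notation RR := (measurableTypeR R).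
Variables (K : R -> R -> R) (F G : R -> R) (M : R).
Hypotheses (mK : measurable_fun [set: RR * RR] (fun z => K z.1 z.2))
  (leK : forall x y, `|K x y| <= M)
  (iF : lambda.-integrable setT (EFin \o F))
  (iG : lambda.-integrable setT (EFin \o G)).

Let f (z : RR * RR) : \bar R := (K z.1 z.2 * (F z.1 * G z.2))%:E.

Let mf : measurable_fun setT f.
Proof.
apply/measurable_EFinP; apply: measurable_funM => //.
have mF : measurable_fun setT F by apply/measurable_EFinP; case/integrableP: iF.
have mG : measurable_fun setT G by apply/measurable_EFinP; case/integrableP: iG.
by apply: measurable_funM; [exact: (measurableT_comp mF)|exact: (measurableT_comp mG)].
Qed.

Let M0 : 0 <= M.
Proof. exact: le_trans (normr_ge0 _) (leK 0 0). Qed.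

Let integrable_f : (lambda \x lambda)%E.-integrable setT f.
Proof.
apply/integrable12ltyP => //.
have mF : measurable_fun setT F by apply/measurable_EFinP; case/integrableP: iF.
have mG : measurable_fun setT G by apply/measurable_EFinP; case/integrableP: iG.
have nF : lambda.-integrable setT (EFin \o (fun x => `|F x|)).
  by move/integrable_norm : iF.
have nG : lambda.-integrable setT (EFin \o (fun x => `|G x|)).
  by move/integrable_norm : iG.
pose g := \int[lambda]_y `|G y|.
have mgF : measurable_fun [set: RR] (fun x => M * g * `|F x|).
  by apply: measurable_funM => //; exact: measurableT_comp.
have mFG x : measurable_fun [set: RR] (fun y => M * `|F x| * `|G y|).
  by apply: measurable_funM => //; exact: measurableT_comp.
apply: (@le_lt_trans _ _ (\int[lambda]_x (M * g * `|F x|)%:E)%E).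
  apply: ge0_le_integral => //.
  - by move=> x _; apply: integral_ge0.
  - apply: (@measurable_fun_fubini_tonelli_F _ _ _ _ R lambda (abse \o f)) => //.
      exact: measurableT_comp.
    by move=> x /=.
  - exact/measurable_EFinP.
  move=> x _; apply: (@le_trans _ _ (\int[lambda]_y (M * `|F x| * `|G y|)%:E)%E).
    apply: ge0_le_integral => //.
    - by apply: measurableT_comp => //; exact: (measurableT_comp mf).
    - exact/measurable_EFinP.
    - by move=> y _; rewrite /= lee_fin !normrM mulrA ler_wpM2r// ler_wpM2r.
  under eq_integral do rewrite EFinM.
  rewrite integralZl// -[X in (_ * X)%E]fineK; last exact: integrable_fin_num.
  by rewrite -EFinM lee_fin -/g [leRHS]mulrAC.
under eq_integral do rewrite EFinM.
rewrite integralZl//.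
have /integrableP[_] := nF; rewrite /=.
under eq_integral do rewrite normr_id.
move=> h; have fn : (\int[lambda]_x (`|F x|)%:E)%E \is a fin_num.
  exact: integrable_fin_num.
by rewrite -(fineK fn) -EFinM ltry.
Qed.

Lemma bounded_kernel_Fubini :
  \int[lambda]_x ((\int[lambda]_y (K x y * G y)) * F x) =
  \int[lambda]_y ((\int[lambda]_x (K x y * F x)) * G y).
Proof.
have iK (H k : R -> R) : lambda.-integrable setT (EFin \o H) ->
    measurable_fun [set: RR] k -> (forall x, `|k x| <= M) ->
    lambda.-integrable setT (EFin \o (fun x => k x * H x)).
  move=> iH mk leM; have mH : measurable_fun setT H.
    by apply/measurable_EFinP; case/integrableP: iH.
  apply: (@le_integrable _ _ _ lambda _ _ _ (fun x => M%:E * (EFin \o H) x)%E) => //.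
  - by apply/measurable_EFinP; exact: measurable_funM.
  - move=> x _ /=; rewrite lee_fin normrM [leRHS]normrM ler_wpM2r//.
    by rewrite (ger0_norm M0).
  - exact: integrableZl.
have mK1 x : measurable_fun [set: RR] (K x).
  exact: (measurableT_comp mK (measurable_pair1 _)).
have mK2 y : measurable_fun [set: RR] (K^~ y).
  exact: (measurableT_comp mK (measurable_pair2 _)).
have h := @Fubini _ _ _ _ R lambda lambda f integrable_f.
have E1 x : ((\int[lambda]_y (K x y * G y)) * F x)%:E = (\int[lambda]_y f (x, y))%E.
  rewrite mulrC EFinM /Rintegral fineK; last exact: integrable_fin_num (iK _ _ iG (mK1 x) (leK x)).
  rewrite -integralZl//; last exact: iK iG (mK1 x) (leK x).
  by apply: eq_integral => y _; rewrite /f -EFinM; congr (_%:E); ring.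
have E2 y : ((\int[lambda]_x (K x y * F x)) * G y)%:E = (\int[lambda]_x f (x, y))%E.
  rewrite mulrC EFinM /Rintegral fineK; last exact: integrable_fin_num (iK _ _ iF (mK2 y) (fun x => leK x y)).
  rewrite -integralZl//; last exact: iK iF (mK2 y) (fun x => leK x y).
  by apply: eq_integral => x _; rewrite /f -EFinM; congr (_%:E); ring.
rewrite /Rintegral; congr fine.
under eq_integral do rewrite E1.
by rewrite h; apply: eq_integral => y _; rewrite E2.
Qed.

End bounded_kernel_fubini.

Section sine_transform_pairing.
Context {R : realType}.
Local Notation lambda := (@lebesgue_measure R).
Local Notation D0 := (`[0%R, +oo[%classic : set R).

Lemma normM_le_sqr (d a b : R) : 0 < d -> `|a * b| <= d^-1 * a ^+ 2 + d * b ^+ 2.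
Proof.
move=> d0; have di : 0 < d^-1 by rewrite invr_gt0.
have dd : d^-1 * d = 1 by rewrite mulVf// gt_eqF.
have := sqr_ge0 (d^-1 * `|a| - `|b|).
rewrite -[a ^+ 2]real_normK ?num_real// -[b ^+ 2]real_normK ?num_real// normrM.
move: (normr_ge0 a) (normr_ge0 b); move: `|a| `|b| => p q p0 q0.
move=> h; have : 0 <= d * (d^-1 * p - q) ^+ 2 by rewrite mulr_ge0// ltW.
have -> : d * (d^-1 * p - q) ^+ 2 =
    (d^-1 * d) * d^-1 * p ^+ 2 - (d^-1 * d) * p * q *+ 2 + d * q ^+ 2.
  by rewrite -mulr_natl; ring.
rewrite dd; move: (mulr_ge0 p0 q0); lra.
Qed.

Section square_integrable.
Variables (D : set (measurableTypeR R)) (mD : measurable D) (f g : R -> R).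
Hypotheses (mf : measurable_fun D f) (mg : measurable_fun D g).
Hypotheses (if2 : lambda.-integrable D (EFin \o (fun x => f x ^+ 2)))
  (ig2 : lambda.-integrable D (EFin \o (fun x => g x ^+ 2))).

Let ibound (d : R) :
  lambda.-integrable D (EFin \o (fun x => d^-1 * f x ^+ 2 + d * g x ^+ 2)).
Proof.
rewrite (_ : _ \o _ = (fun x => d^-1%:E * (f x ^+ 2)%:E + d%:E * (g x ^+ 2)%:E)%E).
  by apply: integrableD => //; exact: integrableZl.
by apply/funext => x /=; rewrite EFinD !EFinM.
Qed.

Lemma integrable_mul_sqr : lambda.-integrable D (EFin \o (fun x => f x * g x)).
Proof.
apply: (le_integrable mD _ _ (ibound 1)).
  by apply/measurable_EFinP; exact: measurable_funM.
move=> x _ /=; rewrite lee_fin.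
by rewrite (le_trans (normM_le_sqr _ _ ltr01))// ler_norm.
Qed.

(** Young's inequality in the place of the Cauchy-Schwarz inequality: the free
   parameter d will be chosen small. *)
Lemma normr_Rintegral_mul_le (d : R) : 0 < d ->
  `|\int[lambda]_(x in D) (f x * g x)| <=
  d^-1 * \int[lambda]_(x in D) (f x ^+ 2) + d * \int[lambda]_(x in D) (g x ^+ 2).
Proof.
move=> d0; have ifg := integrable_mul_sqr.
have iZ (c : R) (h : R -> R) : lambda.-integrable D (EFin \o h) ->
    lambda.-integrable D (EFin \o (fun x => c * h x)).
  move=> ih; rewrite (_ : _ \o _ = (fun x => c%:E * (EFin \o h) x)%E).
    exact: integrableZl.
  by apply/funext => x /=; rewrite EFinM.
rewrite (le_trans (le_normr_Rintegral mD ifg))//.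
apply: (@le_trans _ _ (\int[lambda]_(x in D) (d^-1 * f x ^+ 2 + d * g x ^+ 2))).
  apply: le_Rintegral => //.
  - by move/integrable_norm : ifg.
  - by move=> x _; exact: normM_le_sqr.
by rewrite RintegralD ?RintegralZl//; exact: iZ.
Qed.

End square_integrable.

(** The kernel sin(x l) is symmetric, so that the sine transform is
   self-adjoint on integrable functions. *)
Lemma sine_transform_adjoint (F G : R -> R) :
  lambda.-integrable D0 (EFin \o F) -> lambda.-integrable D0 (EFin \o G) ->
  \int[lambda]_(l in D0) (sine_transform F l * G l) =
  \int[lambda]_(x in D0) (F x * sine_transform G x).
Proof.
move=> iF iG.
have pT (H : R -> R) : lambda.-integrable D0 (EFin \o H) ->
    lambda.-integrable setT (EFin \o (H \_ D0)).
  by move=> iH; rewrite -restrict_EFin; apply: (integrable_mkcond _ _).1 => //.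
have E (H : R -> R) l : sine_transform H l =
    F0_const * \int[lambda]_x (sin (x * l) * (H \_ D0) x).
  rewrite /sine_transform Rintegral_mkcond; congr (_ * _).
  by apply: eq_Rintegral => x _; rewrite !patchE; case: ifP; rewrite ?mulr0.
have mK : measurable_fun [set: measurableTypeR R * measurableTypeR R]
    (fun z : R * R => sin (z.1 * z.2)).
  have ms : measurable_fun [set: measurableTypeR R] (@sin R).
    by apply: continuous_measurable_fun; exact: continuous_sin.
  have mm : measurable_fun [set: measurableTypeR R * measurableTypeR R]
    (fun z : measurableTypeR R * measurableTypeR R => z.1 * z.2 : measurableTypeR R).
    exact: measurable_funM.
  exact: (measurableT_comp ms mm).
have c1 (x y : R) : `|sin (x * y)| <= 1 by exact: sin_norm.
have := bounded_kernel_Fubini mK c1 (pT _ iF) (pT _ iG).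
move=> /(congr1 (fun z => F0_const * z)) h.
have iS (H H' : R -> R) : lambda.-integrable D0 (EFin \o H) ->
    lambda.-integrable D0 (EFin \o H') ->
    lambda.-integrable setT
      (EFin \o (fun l => (\int[lambda]_x (sin (x * l) * (H \_ D0) x)) * (H' \_ D0) l)).
  move=> iH iH'.
  pose M := \int[lambda]_x `|(H \_ D0) x|.
  have M0 : 0 <= M by apply: Rintegral_ge0.
  have hM l : `|\int[lambda]_x (sin (x * l) * (H \_ D0) x)| <= M.
    have ib : lambda.-integrable setT (EFin \o (fun x => sin (x * l) * (H \_ D0) x)).
      apply: integrable_bounded_mul (pT _ iH) => //.
      exact: measurable_sin_lin.
    rewrite (le_trans (le_normr_Rintegral _ ib))//.
    apply: le_Rintegral => //.
    - by move/integrable_norm : ib.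
    - by move/integrable_norm : (pT _ iH).
    - by move=> x _; apply: normM_le1; exact: sin_norm.
  have iM : lambda.-integrable setT (fun l => M%:E * (EFin \o (H' \_ D0)) l)%E.
    by apply: integrableZl => //; exact: pT.
  apply: (le_integrable _ _ _ iM) => //.
    apply/measurable_EFinP; apply: measurable_funM.
      have cS : continuous (fun l => F0_const * \int[lambda]_x (sin (x * l) * (H \_ D0) x)).
        have <- : sine_transform H =
            (fun l => F0_const * \int[lambda]_x (sin (x * l) * (H \_ D0) x)).
          by apply/funext => l; exact: E.
        exact: continuous_sine_transform.
      have c0 : F0_const != 0 :> R.
        by rewrite gt_eqF// /F0_const sqrtr_gt0 divr_gt0// pi_gt0.
      have -> : (fun l => \int[lambda]_x (sin (x * l) * (H \_ D0) x)) =
          (fun l => F0_const^-1 * (F0_const * \int[lambda]_x (sin (x * l) * (H \_ D0) x))).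
        by apply/funext => l; rewrite mulKf.
      by apply: measurable_funM => //; exact: continuous_measurable_fun.
    by apply/measurable_EFinP; case/integrableP: (pT _ iH').
  move=> l _ /=; rewrite lee_fin normrM [leRHS]normrM (ger0_norm M0).
  by rewrite ler_wpM2r.
transitivity (F0_const * \int[lambda]_y
    (\int[lambda]_x (sin (x * y) * (F \_ D0) x) * (G \_ D0) y)).
  rewrite -RintegralZl//; last exact: iS.
  rewrite Rintegral_mkcond; apply: eq_Rintegral => l _.
  by rewrite mulrA -E !patchE; case: ifP; rewrite ?mulr0.
rewrite -h -RintegralZl//; last first.
  have := iS _ _ iG iF; congr (integrable _ _ (EFin \o _)); apply/funext => x.
  by congr (_ * _); apply: eq_Rintegral => y _; rewrite mulrC [y * x]mulrC mulrC.
rewrite [RHS]Rintegral_mkcond; apply: eq_Rintegral => x _.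
rewrite mulrA.
have -> : F0_const * \int[lambda]_y (sin (x * y) * (G \_ D0) y) = sine_transform G x.
  by rewrite E; congr (_ * _); apply: eq_Rintegral => y _; rewrite [y * x]mulrC.
by rewrite !patchE; case: ifP; rewrite ?mulr0// mulrC.
Qed.

(** On the bounded range of the truncation, 1 is at most a multiple of lorentz,
   and |U| <= U^2 + 1. *)
Lemma integrable_truncate_sqr (n : nat) (U : R -> R) : measurable_fun D0 U ->
  lambda.-integrable D0 (EFin \o (fun x => U x ^+ 2)) ->
  lambda.-integrable D0 (EFin \o truncate n U).
Proof.
move=> mU iU.
have il : lambda.-integrable D0 (EFin \o (fun x => (1 + n%:R ^+ 2) * lorentz x)).
  rewrite (_ : _ \o _ = (fun x => (1 + n%:R ^+ 2)%:E * (EFin \o lorentz) x)%E).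
    by apply: integrableZl => //; exact: integrable_lorentz.
  by apply/funext => x /=; rewrite EFinM.
apply: (le_integrable _ _ _ (integrableD _ iU il)) => //.
  by apply/measurable_EFinP; apply: measurable_truncate.
move=> x /=; rewrite in_itv/= andbT => x0; rewrite lee_fin.
rewrite [leRHS]ger0_norm; last first.
  by rewrite addr_ge0 ?sqr_ge0// mulr_ge0 ?lorentz_ge0// addr_ge0 ?sqr_ge0.
rewrite /truncate; case: ifPn => [xn|_]; last first.
  by rewrite normr0 addr_ge0 ?sqr_ge0// mulr_ge0 ?lorentz_ge0// addr_ge0 ?sqr_ge0.
have h : 1 <= (1 + n%:R ^+ 2) * lorentz x.
  rewrite /lorentz ler_pdivlMr; last by have := sqr_ge0 x; lra.
  by rewrite mul1r lerD2l ler_pXn2r ?nnegrE//; lra.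
apply: (@le_trans _ _ (U x ^+ 2 + 1)); last by rewrite lerD2l.
rewrite -real_normK ?num_real//; have := sqr_ge0 (`|U x| - 1); have := normr_ge0 (U x); nra.
Qed.

(** Self-adjointness survives the passage to the L^2 limit that defines the
   transform of U: both sides are continuous in L^2. *)
Lemma sine_transform_L2_adjoint (U V rho : R -> R) :
  measurable_fun D0 U -> measurable_fun D0 V ->
  lambda.-integrable D0 (EFin \o (fun x => U x ^+ 2)) ->
  lambda.-integrable D0 (EFin \o (fun x => V x ^+ 2)) ->
  (forall eps : R, 0 < eps -> \forall n \near \oo,
    (\int[lambda]_(l in D0) ((sine_transform (truncate n U) l - V l) ^+ 2)%:E
       <= eps%:E)%E) ->
  decaying rho -> decaying (sine_transform rho) ->
  \int[lambda]_(l in D0) (V l * rho l) =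
  \int[lambda]_(x in D0) (U x * sine_transform rho x).
Proof.
move=> mU mV iU2 iV2 cUV drho dk; set k := sine_transform rho.
have mrho : measurable_fun D0 rho.
  by apply: measurable_funTS; exact: continuous_measurable_fun drho.1.
have mk : measurable_fun D0 k.
  by apply: measurable_funTS; exact: continuous_measurable_fun dk.1.
have ir2 := decaying_sqr_integrable drho; have ik2 := decaying_sqr_integrable dk.
have irho := decaying_integrable drho.
have mD0 : measurable (D0 : set (measurableTypeR R)) by [].
have iUk := integrable_mul_sqr mD0 mU mk iU2 ik2.
have iVr := integrable_mul_sqr mD0 mV mrho iV2 ir2.
have iUn n := integrable_truncate_sqr n mU iU2.
have mUn n := measurable_truncate n mD0 mU.
have c1 : (fun n => \int[lambda]_(x in D0) (truncate n U x * k x)) @ \oo -->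
    \int[lambda]_(x in D0) (U x * k x).
  have [|||||//] := @Rintegral_DCT _ _ _ lambda D0
    (fun n x => truncate n U x * k x) (fun x => U x * k x) (fun x => `|U x * k x|).
  - exact: mD0.
  - by move=> n; exact: measurable_funM.
  - by move=> x _; apply: cvgM; [exact: truncate_cvg|exact: cvg_cst].
  - by move/integrable_norm : iUk.
  - by move=> n x _; rewrite normrM [leRHS]normrM ler_wpM2r// truncate_le.
have c2 : (fun n => \int[lambda]_(x in D0) (truncate n U x * k x)) @ \oo -->
    \int[lambda]_(l in D0) (V l * rho l).
  apply/cvgrPdist_le => eps eps0.
  pose P := \int[lambda]_(l in D0) (rho l ^+ 2).
  have P0 : 0 <= P by apply: Rintegral_ge0 => x _; exact: sqr_ge0.
  pose d := eps / (2 * (P + 1)).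
  have P1 : 0 < 2 * (P + 1) by lra.
  have d0 : 0 < d by rewrite divr_gt0.
  have e0 : 0 < d * (eps / 2) by rewrite mulr_gt0// divr_gt0.
  apply: filterS (cUV _ e0) => n hn.
  have mS : measurable_fun D0 (sine_transform (truncate n U)).
    apply: measurable_funTS; apply: continuous_measurable_fun.
    exact: continuous_sine_transform.
  pose W l := sine_transform (truncate n U) l - V l.
  have mW : measurable_fun D0 W by exact: measurable_funB.
  have iW2 : lambda.-integrable D0 (EFin \o (fun x => W x ^+ 2)).
    apply/integrableP; split.
      by apply/measurable_EFinP; exact: measurable_funX.
    apply: (@le_lt_trans _ _ (d * (eps / 2))%:E); last exact: ltry.
    apply: le_trans hn; rewrite le_eqVlt; apply/orP; left; apply/eqP.
    by apply: eq_integral => l _ /=; rewrite ger0_norm ?sqr_ge0.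
  have iWr := integrable_mul_sqr mD0 mW mrho iW2 ir2.
  have hW : \int[lambda]_(l in D0) (W l ^+ 2) <= d * (eps / 2).
    by rewrite -lee_fin /Rintegral fineK//; exact: integrable_fin_num.
  have -> : \int[lambda]_(x in D0) (truncate n U x * k x) =
      \int[lambda]_(l in D0) (V l * rho l) + \int[lambda]_(l in D0) (W l * rho l).
    rewrite -(sine_transform_adjoint (iUn n) irho) -RintegralD//.
    by apply: eq_Rintegral => l _; rewrite /W; ring.
  rewrite opprD addrA subrr sub0r normrN.
  rewrite (le_trans (normr_Rintegral_mul_le mD0 mW mrho iW2 ir2 d0))// -/P.
  have h1 : d^-1 * \int[lambda]_(l in D0) (W l ^+ 2) <= eps / 2.
    by rewrite mulrC ler_pdivrMr// mulrC.
  have h2 : d * P <= eps / 2.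
    rewrite /d; have -> : eps / (2 * (P + 1)) * P = (eps / 2) * (P / (P + 1)).
      by field; lra.
    rewrite ler_piMr ?divr_ge0 ?ltW// ltr_pdivrMr//; lra.
  by rewrite (le_trans (lerD h1 h2))// -splitr.
exact: cvg_unique _ c2 c1.
Qed.

End sine_transform_pairing.

(** * The propagator tested against heat kernels *)

Section dispersive_kernel.
Context {R : realType}.
Local Notation lambda := (@lebesgue_measure R).
Local Notation D0 := (`[0%R, +oo[%classic : set R).
Variable e : R.
Hypothesis e0 : 0 < e.

(** For C l = exp(- e l^2) this is the transform of the test function; the
   propagator multiplies it by cos(t l^2) and sin(t l^2). *)
Definition modulated (C : R -> R) (y l : R) : R :=
  F0_const * (sin (l * y) * C l).

Definition kernel (C : R -> R) (y : R) : R -> R := sine_transform (modulated C y).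

Lemma sqr_F0_const : F0_const ^+ 2 = 2 / pi :> R.
Proof. by rewrite sqr_sqrtr// divr_ge0// pi_ge0. Qed.

Lemma decaying_modulated (C : R -> R) y : continuous C ->
  (forall l, `|C l| <= expR (- e * l ^+ 2)) -> decaying (modulated C y).
Proof. by move=> cC leC; apply: decayingZ; exact: (decaying_sin_weight e0). Qed.

(** The method of images: sin(l x) sin(l y) splits into the waves at x - y and
   at x + y. *)
Lemma kernelE (C : R -> R) y x : continuous C ->
  (forall l, `|C l| <= expR (- e * l ^+ 2)) ->
  kernel C y x = pi^-1 *
    (\int[lambda]_(l in D0) (cos (l * (x - y)) * C l) -
     \int[lambda]_(l in D0) (cos (l * (x + y)) * C l)).
Proof.
move=> cC leC; rewrite /kernel /sine_transform /modulated.
transitivity (F0_const * \int[lambda]_(l in D0)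
    (F0_const * (sin (l * x) * (sin (l * y) * C l)))).
  by congr (_ * _); apply: eq_Rintegral => l _; ring.
rewrite RintegralZl//; last first.
  apply: integrable_bounded_mul => // [|l|]; [exact: measurable_sin_lin|exact: sin_norm|].
  exact/decaying_integrable/(decaying_sin_weight e0).
rewrite (sin_sin_transform e0)// mulrA -expr2 sqr_F0_const.
have aux (p X : R) : p != 0 -> 2 / p * (X / 2) = p^-1 * X by move=> p0; field.
by apply: aux; rewrite gt_eqF// pi_gt0.
Qed.

Lemma strongly_decaying_kernel (C : R -> R) p c y : 0 < p -> continuous C ->
  (forall l, `|C l| <= expR (- e * l ^+ 2)) ->
  (forall z, `|\int[lambda]_(l in D0) (cos (l * z) * C l)| <= c * expR (- p * z ^+ 2)) ->
  strongly_decaying (kernel C y).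
Proof.
move=> p0 cC leC hE; split.
  by apply: continuous_sine_transform; exact/decaying_integrable/decaying_modulated.
have [A A0 hA] := kernel_decay y p0 hE.
exists (pi^-1 * A) => x; rewrite kernelE// normrM -mulrA ger0_norm ?invr_ge0 ?pi_ge0//.
by rewrite ler_wpM2l ?invr_ge0 ?pi_ge0.
Qed.

Lemma strongly_decaying_cos_kernel t y :
  strongly_decaying (kernel (cos_chirp e t) y).
Proof.
apply: (strongly_decaying_kernel _ (chirp_re_gt0 e0 t)).
- exact: continuous_cos_chirp.
- exact: cos_chirp_le.
- by move=> z; exact: (Ec_gauss e0).
Qed.

Lemma strongly_decaying_sin_kernel t y :
  strongly_decaying (kernel (sin_chirp e t) y).
Proof.
apply: (strongly_decaying_kernel _ (chirp_re_gt0 e0 t)).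
- exact: continuous_sin_chirp.
- exact: sin_chirp_le.
- by move=> z; exact: (Es_gauss e0).
Qed.

Lemma cos_kernel_dispersive t x y : t != 0 -> 0 <= x -> 0 <= y ->
  `|kernel (cos_chirp e t) y x| <= pi^-1 * (3 / 2 * decay_rate t * (x * y)).
Proof.
move=> t0 x0 y0; rewrite kernelE; last 2 first.
- exact: continuous_cos_chirp.
- exact: cos_chirp_le.
rewrite normrM ger0_norm ?invr_ge0 ?pi_ge0// ler_wpM2l ?invr_ge0 ?pi_ge0//.
exact: (Ec_dispersive e0).
Qed.

Lemma sin_kernel_dispersive t x y : t != 0 -> 0 <= x -> 0 <= y ->
  `|kernel (sin_chirp e t) y x| <= pi^-1 * (3 / 2 * decay_rate t * (x * y)).
Proof.
move=> t0 x0 y0; rewrite kernelE; last 2 first.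
- exact: continuous_sin_chirp.
- exact: sin_chirp_le.
rewrite normrM ger0_norm ?invr_ge0 ?pi_ge0// ler_wpM2l ?invr_ge0 ?pi_ge0//.
exact: (Es_dispersive e0).
Qed.

End dispersive_kernel.

Section propagator_pairing.
Context {R : realType}.
Local Notation lambda := (@lebesgue_measure R).
Local Notation D0 := (`[0%R, +oo[%classic : set R).
Local Notation D1 := (`[1%R, +oo[%classic : set R).
Local Notation mu := (@radial_measure R).
Local Notation nu := (spectral_measure R).
Local Notation Re f := (fun r => complex.Re (f r)).
Local Notation Im f := (fun r => complex.Im (f r)).

(** The weak form of w = Re exp(i t Delta) (u + i v), tested against Dirichlet
   heat kernels. *)
Definition propagated (t : R) (u v w : R -> R) := forall e y, 0 < e ->
  \int[lambda]_(x in D0) (profile w x * heat_odd e y x) =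
  \int[lambda]_(x in D0) (profile u x * kernel (cos_chirp e t) y x) +
  \int[lambda]_(x in D0) (profile v x * kernel (sin_chirp e t) y x).

Lemma is_F0_pairing (f h : R -> R[i]) (rho : R -> R) : is_F0 f h ->
  decaying rho -> decaying (sine_transform rho) ->
  \int[lambda]_(l in D0) (complex.Re (h l) * rho l) =
    \int[lambda]_(x in D0) (profile (Re f) x * sine_transform rho x) /\
  \int[lambda]_(l in D0) (complex.Im (h l) * rho l) =
    \int[lambda]_(x in D0) (profile (Im f) x * sine_transform rho x).
Proof.
move=> [/radial_L2_profile[mRf mIf iRf iIf] /spectral_L2_profile[mRh mIh iRh iIh] cv].
move: cv => /cLnorm2_cvg0P cv dr dk.
have mS (u : R -> R) n : measurable_fun D1 u ->
    lambda.-integrable D0 (EFin \o (fun x => profile u x ^+ 2)) ->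
    measurable_fun D0 (sine_transform (truncate n (profile u))).
  move=> mu1 iu; apply: measurable_funTS; apply: continuous_measurable_fun.
  apply: continuous_sine_transform; apply: integrable_truncate_sqr => //.
  exact: measurable_profile.
split; apply: sine_transform_L2_adjoint => //; try exact: measurable_profile;
  move=> eps eps0; apply: filterS (cv _ eps0) => n hn; apply: le_trans hn.
- apply: le_trans (sqnorm_Re _ _); rewrite ge0_spectral_integral.
  + rewrite le_eqVlt; apply/orP; left; apply/eqP; apply: eq_integral => l _.
    by have [<- _] := F0_integral_Re_Im n l mRf mIf; rewrite -Re_sub.
  + apply/measurable_EFinP; apply: measurable_funX.
    have -> : (fun l => complex.Re ((F0_integral
        (fun s => if s <= n%:R then f s else 0) \- h) l)) =
        (fun l => sine_transform (truncate n (profile (Re f))) l - complex.Re (h l)).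
      by apply/funext => l; rewrite -(F0_integral_Re_Im n l mRf mIf).1 -Re_sub.
    by apply: measurable_funB => //; exact: mS.
  + by move=> l; rewrite lee_fin sqr_ge0.
- apply: le_trans (sqnorm_Im _ _); rewrite ge0_spectral_integral.
  + rewrite le_eqVlt; apply/orP; left; apply/eqP; apply: eq_integral => l _.
    by have [_ <-] := F0_integral_Re_Im n l mRf mIf; rewrite -Im_sub.
  + apply/measurable_EFinP; apply: measurable_funX.
    have -> : (fun l => complex.Im ((F0_integral
        (fun s => if s <= n%:R then f s else 0) \- h) l)) =
        (fun l => sine_transform (truncate n (profile (Im f))) l - complex.Im (h l)).
      by apply/funext => l; rewrite -(F0_integral_Re_Im n l mRf mIf).2 -Im_sub.
    by apply: measurable_funB => //; exact: mS.
  + by move=> l; rewrite lee_fin sqr_ge0.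
Qed.

(** In the duality that defines the adjoint, taken at a test function, the
   multiplier exp(- i l^2 t) moves onto the transform of the test function, and
   self-adjointness brings the pairing back to the half-line.  The second
   identity is the first one for the datum - i f. *)
Lemma propagator_L2_propagated (t : R) (f g : R -> R[i]) :
  is_propagator_L2 t f g ->
  propagated t (Re f) (Im f) (Re g) /\
  propagated t (Im f) (fun r => - complex.Re (f r)) (Im g).
Proof.
move=> [h Fh [sh rg adj]].
have [/radial_L2_profile[mRf mIf iRf iIf] /spectral_L2_profile[mRh mIh iRh iIh] _] := Fh.
have [mRg mIg _ _] := radial_L2_profile rg.
have pair e y : 0 < e ->
  (\int[lambda]_(x in D0) (profile (Re g) x * heat_odd e y x) =
    \int[lambda]_(x in D0) (profile (Re f) x * kernel (cos_chirp e t) y x) +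
    \int[lambda]_(x in D0) (profile (Im f) x * kernel (sin_chirp e t) y x)) /\
  (\int[lambda]_(x in D0) (profile (Im g) x * heat_odd e y x) =
    \int[lambda]_(x in D0) (profile (Im f) x * kernel (cos_chirp e t) y x) -
    \int[lambda]_(x in D0) (profile (Re f) x * kernel (sin_chirp e t) y x)).
  move=> e0.
  have := adj _ _ (is_F0_test y e0).
  have mt : measurable_fun D1 (test_profile e y) by exact: measurable_test_profile.
  have dc : decaying (modulated (cos_chirp e t) y).
    by apply: (decaying_modulated e0); [exact: continuous_cos_chirp|exact: cos_chirp_le].
  have ds : decaying (modulated (sin_chirp e t) y).
    by apply: (decaying_modulated e0); [exact: continuous_sin_chirp|exact: sin_chirp_le].
  have dkc := strongly_decayingW (strongly_decaying_cos_kernel e0 t y).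
  have dks := strongly_decayingW (strongly_decaying_sin_kernel e0 t y).
  have [pRc pIc] := is_F0_pairing Fh dc dkc.
  have [pRs pIs] := is_F0_pairing Fh ds dks.
  have ii (u rho : R -> R) : measurable_fun D0 u ->
      lambda.-integrable D0 (EFin \o (fun x => u x ^+ 2)) -> decaying rho ->
      lambda.-integrable D0 (EFin \o (fun x => u x * rho x)).
    move=> mu1 iu2 dr; apply: integrable_mul_sqr => //.
      by apply: measurable_funTS; exact: continuous_measurable_fun dr.1.
    exact: decaying_sqr_integrable.
  have side (u : R -> R) : measurable_fun D1 u ->
      \int[mu]_x (u x * test_profile e y x) =
      \int[lambda]_(x in D0) (profile u x * heat_odd e y x).
    move=> mu1; rewrite radial_Rintegral; last exact: measurable_funM.
    apply: eq_Rintegral => x; rewrite inE/= in_itv/= andbT => x0.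
    by rewrite -profile_test// /profile; ring.
  have mcs (c : R -> R) : continuous c -> measurable_fun D0 c.
    by move=> cc; apply: measurable_funTS; exact: continuous_measurable_fun.
  have cc : continuous (fun l : R => cos (l ^+ 2 * t)).
    by move=> l; eapply is_derive_cont; derive_tac; reflexivity.
  have cs : continuous (fun l : R => sin (l ^+ 2 * t)).
    by move=> l; eapply is_derive_cont; derive_tac; reflexivity.
  have msp : measurable_fun D0 (test_spectrum e y).
    by apply: mcs; exact: (decaying_test_spectrum y e0).1.
  have conjM (z : R[i]) (a : R) : z * (a%:C%C)^*%C = a%:C%C * z.
    by case: z => p q; rewrite /= oppr0; congr (_ +i* _)%C; ring.
  rewrite /cinner /cintegral => /(congr1 (fun z => (complex.Re z, complex.Im z))) [].
  have sE a b c d : test_spectrum e y a * (cos (a ^+ 2 * t) * b + sin (a ^+ 2 * t) * c) =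
     d -> d = b * modulated (cos_chirp e t) y a + c * modulated (sin_chirp e t) y a.
    by move=> <-; rewrite /test_spectrum /modulated /cos_chirp /sin_chirp
      [t * _]mulrC; ring.
  move=> eR eI; split.
  - rewrite -side//; transitivity (\int[mu]_x complex.Re (g x * ((test_fun e y x)^*)%C)).
      by apply: eq_Rintegral => x _; rewrite conjM Re_realM mulrC.
    rewrite eR -pRc -pIs -RintegralD//; [|exact: ii..].
    rewrite spectral_Rintegral.
      apply: eq_Rintegral => l _; rewrite conjM Re_realM Re_expi_mul.
      exact: sE erefl.
    have -> : (fun l => complex.Re (expi (- (l ^+ 2 * t)) * h l * ((test_hat e y l)^*)%C)) =
        (fun l => test_spectrum e y l * (cos (l ^+ 2 * t) * complex.Re (h l) +
          sin (l ^+ 2 * t) * complex.Im (h l))).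
      by apply/funext => l; rewrite conjM Re_realM Re_expi_mul.
    apply: measurable_funM => //.
    by apply: measurable_funD; apply: measurable_funM => //; exact: mcs.
  - rewrite -side//; transitivity (\int[mu]_x complex.Im (g x * ((test_fun e y x)^*)%C)).
      by apply: eq_Rintegral => x _; rewrite conjM Im_realM mulrC.
    rewrite eI -pRs -pIc -RintegralB//; [|exact: ii..].
    rewrite spectral_Rintegral.
      apply: eq_Rintegral => l _; rewrite conjM Im_realM Im_expi_mul.
      by have := sE l (complex.Im (h l)) (- complex.Re (h l)) _ erefl; rewrite mulrN mulNr.
    have -> : (fun l => complex.Im (expi (- (l ^+ 2 * t)) * h l * ((test_hat e y l)^*)%C)) =
        (fun l => test_spectrum e y l * (cos (l ^+ 2 * t) * complex.Im (h l) -
          sin (l ^+ 2 * t) * complex.Re (h l))).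
      by apply/funext => l; rewrite conjM Im_realM Im_expi_mul.
    apply: measurable_funM => //.
    by apply: measurable_funB; apply: measurable_funM => //; exact: mcs.
split=> e y e0; first exact: (pair e y e0).1.
rewrite (pair e y e0).2; congr (_ + _).
have dks := strongly_decayingW (strongly_decaying_sin_kernel e0 t y).
rewrite -[LHS]mulN1r -RintegralZl//.
  by apply: eq_Rintegral => x _; rewrite /profile; ring.
apply: integrable_mul_sqr => //.
- exact: measurable_profile.
- by apply: measurable_funTS; exact: continuous_measurable_fun dks.1.
- exact: decaying_sqr_integrable.
Qed.

End propagator_pairing.

(** * The energy space *)

Section sobolev_bound.
Context {R : realType}.
Local Notation lambda := (@lebesgue_measure R).
Local Notation D0 := (`[0%R, +oo[%classic : set R).
Local Notation D1 := (`[1%R, +oo[%classic : set R).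
Local Notation mu := (@radial_measure R).

Lemma radial_ae_of_lebesgue (P : R -> Prop) :
  {ae lambda, forall x, P x} -> {ae mu, forall x, P x}.
Proof.
move=> [N [mN N0 PN]]; exists N; split => //.
rewrite /= /radial_measure.
have mND : measurable (N `&` D1 : set (measurableTypeR R)) by exact: measurableI.
rewrite null_set_integral//.
  by apply/measurable_EFinP; apply: measurable_funTS; exact: exprn_measurable.
apply/eqP; rewrite eq_le measure_ge0 andbT -N0 le_measure// ?inE//.
Qed.

(** The Dirichlet energy controls the size: |u(b)| <= int_1^b |u'| r * r^-1 dr,
   and r^-1 is square integrable at infinity. *)
Lemma dirichlet_energy_sup : exists2 K : R, 0 <= K & forall (u : R -> R) (eta b : R),
  0 < eta -> (forall b, ac_on 1 b u) -> u 1 = 0 ->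
  (\int[mu]_r (u^`()%classic r ^+ 2)%:E <= (eta ^+ 2)%:E)%E ->
  1 <= b -> `|u b| <= K * eta.
Proof.
pose L := \int[lambda]_(x in D0) lorentz x.
have L0 : 0 <= L by apply: Rintegral_ge0 => x _; exact: lorentz_ge0.
exists (1 + 2 * L) => [|u eta b eta0 acu u1 hu]; first by rewrite addr_ge0// mulr_ge0.
rewrite le_eqVlt => /predU1P[<-|b1].
  by rewrite u1 normr0 mulr_ge0 ?addr_ge0 ?mulr_ge0// ltW.
have [g [ig ug dg]] := ac_ftc b1 (acu b).
have mg : measurable_fun setT g by apply/measurable_EFinP; case/integrableP: ig.
have igb : lambda.-integrable `[1%R, b] (EFin \o g) by exact: integrableS ig.
have mgx (D : set (measurableTypeR R)) : measurable_fun D (fun x => (g x * x) ^+ 2).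
  by apply: measurable_funX; apply: measurable_funM => //; exact: measurable_funTS.
have ub : u b = \int[lambda]_(t in `[1%R, b]) g t.
  by rewrite -ug ?u1 ?subr0// ltW.
(* u' need not be measurable: it is compared to g inside the integral *)
have energy : (\int[lambda]_(x in `[1%R, b]) ((g x * x) ^+ 2)%:E <= (eta ^+ 2)%:E)%E.
  pose h x : R := g x ^+ 2 * \1_(`]1%R, b[) x.
  have h0 x : 0 <= h x by rewrite mulr_ge0 ?sqr_ge0.
  have hmu : (\int[mu]_x (h x)%:E <= (eta ^+ 2)%:E)%E.
    apply: le_trans hu; apply: ge0_le_integral_ae => [x|x|].
    - by rewrite lee_fin.
    - by rewrite lee_fin sqr_ge0.
    - apply: radial_ae_of_lebesgue; apply: ae_mono dg => x dgx.
      rewrite lee_fin /h indicE; case: (boolP (x \in _)) => [|_].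
        by rewrite inE/= => xb; rewrite mulr1 dgx.
      by rewrite mulr0 sqr_ge0.
  apply: le_trans hmu; rewrite ge0_radial_integral.
  - rewrite integral_itv_bndoo; last by apply/measurable_EFinP; exact: mgx.
    rewrite integral_mkcond [leRHS]integral_mkcond le_eqVlt; apply/orP; left.
    apply/eqP; apply: eq_integral => x _; rewrite !patchE /h indicE.
    case: (boolP (x \in (`]1%R, b[%classic : set R))) => [|_]; last first.
      by case: ifP; rewrite // mulr0 mul0e.
    rewrite inE/= in_itv/= => /andP[x1 _].
    rewrite mem_set/=; last by rewrite in_itv/= andbT ltW.
    by rewrite mulr1 exprMn.
  - apply/measurable_EFinP; apply: measurable_funM.
      by apply: measurable_funX; exact: measurable_funTS.
    by apply: measurable_funTS; exact: measurable_indic.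
  - by move=> x; rewrite lee_fin.
have il : lambda.-integrable `[1%R, b] (EFin \o lorentz).
  apply: integrableS (integrable_lorentz) => //.
  by move=> x /=; rewrite !in_itv/= andbT => /andP[x1 _]; rewrite (le_trans _ x1).
have ml : measurable_fun `[1%R, b] (@lorentz R) by exact: measurable_lorentz.
have hl : (\int[lambda]_(x in `[1%R, b]) (lorentz x)%:E <= L%:E)%E.
  rewrite /L /Rintegral fineK; last exact: integrable_fin_num integrable_lorentz.
  apply: ge0_subset_integral => //.
  - by apply/measurable_EFinP; exact: measurable_lorentz.
  - by move=> x _; rewrite lee_fin lorentz_ge0.
  - by move=> x /=; rewrite !in_itv/= andbT => /andP[x1 _]; rewrite (le_trans _ x1).
rewrite -lee_fin ub /Rintegral.
have -> : (`|fine (\int[lambda]_(t in `[1%R, b]) (g t)%:E)|%:E =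
    `|\int[lambda]_(t in `[1%R, b]) (g t)%:E|)%E.
  by rewrite -[in RHS](@fineK _ (\int[lambda]_(t in _) _)%E)//; exact: integrable_fin_num.
apply: (le_trans (le_abse_integral _ _ _)) => //.
  by apply/measurable_EFinP; exact: measurable_funTS.
apply: (@le_trans _ _ (\int[lambda]_(x in `[1%R, b])
    ((eta^-1)%:E * ((g x * x) ^+ 2)%:E + (2 * eta)%:E * (lorentz x)%:E))%E).
  apply: ge0_le_integral => //.
  - apply: measurableT_comp => //; apply/measurable_EFinP; exact: measurable_funTS.
  - apply: emeasurable_funD; apply: emeasurable_funM => //; exact/measurable_EFinP.
  move=> x /=; rewrite in_itv/= => /andP[x1 _]; rewrite lee_fin.
  have x0 : 0 < x by lra.
  have -> : g x = (g x * x) * x^-1 by rewrite mulfK// gt_eqF.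
  rewrite (le_trans (normM_le_sqr _ _ eta0))// mulfK ?gt_eqF//.
  rewrite lerD2l [2 * eta]mulrC -mulrA ler_wpM2l ?(ltW eta0)//.
  have x2 : 1 <= x ^+ 2 by rewrite expr_ge1// ltW.
  rewrite exprVn /lorentz ler_pdivlMr; last by lra.
  by rewrite mulrDr mulr1 mulVf ?gt_eqF ?exprn_gt0// (@le_trans _ _ (1 + 1))// lerD2r invf_le1// exprn_gt0.
rewrite ge0_integralD//.
- rewrite !ge0_integralZl//.
  + have -> : ((1 + 2 * L) * eta)%:E =
        ((eta^-1)%:E * (eta ^+ 2)%:E + (2 * eta)%:E * L%:E)%E.
      by rewrite -!EFinM -EFinD; congr (_%:E); field; rewrite gt_eqF.
    by rewrite leeD// lee_wpmul2l// lee_fin ?invr_ge0 ?mulr_ge0// ltW.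
  + exact/measurable_EFinP.
  + by move=> x _; rewrite lee_fin lorentz_ge0.
  + by rewrite lee_fin mulr_ge0// ltW.
  + exact/measurable_EFinP.
  + by move=> x _; rewrite lee_fin sqr_ge0.
  + by rewrite lee_fin invr_ge0 ltW.
- by move=> x _; rewrite -EFinM lee_fin mulr_ge0 ?sqr_ge0// invr_ge0 ltW.
- by apply: emeasurable_funM => //; exact/measurable_EFinP.
- by move=> x _; rewrite -EFinM lee_fin mulr_ge0 ?lorentz_ge0// mulr_ge0// ltW.
- by apply: emeasurable_funM => //; exact/measurable_EFinP.
Qed.

End sobolev_bound.

Section tempered_functions.
Context {R : realType}.
Local Notation lambda := (@lebesgue_measure R).
Local Notation D0 := (`[0%R, +oo[%classic : set R).
Local Notation D1 := (`[1%R, +oo[%classic : set R).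
Local Notation mu := (@radial_measure R).
Local Notation Re f := (fun r => complex.Re (f r)).
Local Notation Im f := (fun r => complex.Im (f r)).

(** The common ground of L^2 and the energy space: functions that may be
   paired with the kernels and with the test functions. *)
Definition tempered (u : R -> R) := measurable_fun D1 u /\
  forall k, strongly_decaying k ->
    lambda.-integrable D0 (EFin \o (fun x => profile u x * k x)).

Lemma tempered_sqr (u : R -> R) : measurable_fun D1 u ->
  lambda.-integrable D0 (EFin \o (fun x => profile u x ^+ 2)) -> tempered u.
Proof.
move=> mu1 iu; split=> // k sk; have dk := strongly_decayingW sk.
apply: integrable_mul_sqr => //.
- exact: measurable_profile.
- by apply: measurable_funTS; exact: continuous_measurable_fun dk.1.
- exact: decaying_sqr_integrable.
Qed.

Lemma decaying_radius_mul (k : R -> R) : strongly_decaying k ->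
  decaying (fun x => (1 + x) * k x).
Proof.
move=> sk; apply: (@strongly_decaying_mul _ _ _ 2 sk) => [x|x].
  by apply: cvgD; [exact: cvg_cst|exact: cvg_id].
rewrite (le_trans (ler_normD _ _))// normr1.
have := lin_le_sqr x; have := sqr_ge0 x; lra.
Qed.

Lemma tempered_bounded (u : R -> R) (B : R) : measurable_fun D1 u ->
  (forall r, 1 <= r -> `|u r| <= B) -> tempered u.
Proof.
move=> mu1 uB; split=> // k sk.
have dk := decaying_radius_mul sk.
have idk : lambda.-integrable D0 (fun x => B%:E * (EFin \o (fun x => ((1 + x) * k x)%R)) x)%E.
  by apply: integrableZl => //; exact: decaying_integrable.
apply: (le_integrable _ _ _ idk) => //.
  apply/measurable_EFinP; apply: measurable_funM; first exact: measurable_profile.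
  by apply: measurable_funTS; exact: continuous_measurable_fun sk.1.
move=> x /=; rewrite in_itv/= andbT => x0; rewrite lee_fin /profile -mulrA.
rewrite normrM [leRHS]normrM ler_wpM2r// (le_trans _ (ler_norm B))//.
by rewrite uB// lerDl.
Qed.

Lemma profileD (u v : R -> R) x : profile (u \+ v) x = profile u x + profile v x.
Proof. by rewrite /profile mulrDl. Qed.

Lemma temperedD (u v : R -> R) : tempered u -> tempered v -> tempered (u \+ v).
Proof.
move=> [mu1 iu] [mv iv]; split; first exact: measurable_funD.
move=> k sk.
have -> : EFin \o (fun x => profile (u \+ v) x * k x) =
    ((EFin \o (fun x => profile u x * k x)%R) \+
     (EFin \o (fun x => profile v x * k x)%R))%E.
  by apply/funext => x /=; rewrite profileD mulrDl EFinD.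
by apply: integrableD => //; [exact: iu|exact: iv].
Qed.

Lemma temperedN (u : R -> R) : tempered u -> tempered (fun r => - u r).
Proof.
move=> [mu1 iu]; split; first exact: measurableT_comp.
move=> k sk.
have -> : EFin \o (fun x => profile (fun r => - u r) x * k x) =
    (\- (EFin \o (fun x => profile u x * k x)%R))%E.
  by apply/funext => x /=; rewrite /profile !mulNr EFinN.
by apply: integrableN => //; exact: iu.
Qed.

Lemma propagatedD t (u v w u' v' w' : R -> R) :
  tempered u -> tempered v -> tempered w ->
  tempered u' -> tempered v' -> tempered w' ->
  propagated t u v w -> propagated t u' v' w' ->
  propagated t (u \+ u') (v \+ v') (w \+ w').
Proof.
move=> [_ iu] [_ iv] [_ iw] [_ iu'] [_ iv'] [_ iw'] h h' e y e0.
have sc := strongly_decaying_cos_kernel e0 t y.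
have ss := strongly_decaying_sin_kernel e0 t y.
have sh := strongly_decaying_heat_odd y e0.
have split_int (a b k : R -> R) :
    lambda.-integrable D0 (EFin \o (fun x => profile a x * k x)) ->
    lambda.-integrable D0 (EFin \o (fun x => profile b x * k x)) ->
    \int[lambda]_(x in D0) (profile (a \+ b) x * k x) =
    \int[lambda]_(x in D0) (profile a x * k x) +
    \int[lambda]_(x in D0) (profile b x * k x).
  move=> ia ib; rewrite -RintegralD//; apply: eq_Rintegral => x _.
  by rewrite profileD mulrDl.
rewrite split_int; [|exact: iw|exact: iw'].
rewrite split_int; [|exact: iu|exact: iu'].
rewrite split_int; [|exact: iv|exact: iv'].
by rewrite (h e y e0) (h' e y e0) addrACA.
Qed.

(** Composed with r |-> max 1 r, the function is continuous on the line. *)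
Lemma ac_measurable (u : R -> R) : (forall b, ac_on 1 b u) -> measurable_fun D1 u.
Proof.
move=> acu; pose v x := u (Num.max 1 x).
have cv : continuous v.
  move=> x; apply/cvgrPdist_le => eps eps0.
  have [d d0 hd] := ac_on_continuous (acu (`|x| + 2)) eps0.
  apply/nbhs_ballP; exists (Num.min d 1) => /=; first by rewrite lt_min d0/=.
  move=> y; rewrite /ball/= lt_min => /andP[xyd xy1].
  have mx (a c : R) : a <= c -> Num.max 1 a <= Num.max 1 c.
    by move=> ac; rewrite ge_max le_max lexx /= le_max ac orbT.
  have mL (a c : R) : a <= c -> Num.max 1 c - Num.max 1 a <= c - a.
    by move=> ac; case: (leP 1 c); case: (leP 1 a); lra.
  have m1 (a : R) : 1 <= Num.max 1 a by rewrite le_max lexx.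
  have mb (a : R) : a <= `|x| + 2 -> Num.max 1 a <= `|x| + 2.
    by move=> h; rewrite ge_max h andbT; have := normr_ge0 x; lra.
  have xb := ler_norm x.
  move: xyd xy1; rewrite /v; case: (leP x y) => [xy|/ltW yx].
    rewrite distrC [`|y - x|]ger0_norm ?subr_ge0// => xyd xy1.
    by rewrite distrC; apply: hd; [exact: m1|exact: mx|apply: mb; lra|exact: le_lt_trans (mL _ _ xy) xyd].
  rewrite ger0_norm ?subr_ge0// => xyd xy1.
  by apply: hd; [exact: m1|exact: mx|apply: mb; lra|exact: le_lt_trans (mL _ _ yx) xyd].
apply: (@eq_measurable_fun _ _ _ _ _ v).
  by move=> x; rewrite inE/= in_itv/= andbT => x1; rewrite /v max_r.
by apply: measurable_funTS; exact: continuous_measurable_fun.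
Qed.

(** Since profile u x = u (1 + x) (1 + x), and (1 + x) k x is integrable, uniform
   convergence passes to the pairing. *)
Lemma uniform_cvg_pairing (u_ : nat -> R -> R) (u k : R -> R) :
  strongly_decaying k -> (forall n, tempered (u_ n)) -> tempered u ->
  (forall eps : R, 0 < eps -> \forall n \near \oo,
    forall r, 1 <= r -> `|u_ n r - u r| <= eps) ->
  (fun n => \int[lambda]_(x in D0) (profile (u_ n) x * k x)) @ \oo -->
  \int[lambda]_(x in D0) (profile u x * k x).
Proof.
move=> sk tu_ tu cu; have dk := decaying_radius_mul sk.
have idk : lambda.-integrable D0 (EFin \o (fun x => `|(1 + x) * k x|)).
  by move/integrable_norm : (decaying_integrable dk).
set L := \int[lambda]_(x in D0) `|(1 + x) * k x|.
have L0 : 0 <= L by apply: Rintegral_ge0.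
apply/cvgrPdist_le => eps eps0.
have e0 : 0 < eps / (L + 1) by rewrite divr_gt0//; lra.
apply: filterS (cu _ e0) => n hn.
have iu := tu.2 _ sk; have iun := (tu_ n).2 _ sk.
rewrite -RintegralB//.
have ib := integrableB _ iu iun.
have {}ib : lambda.-integrable D0 (EFin \o
    (fun x => profile u x * k x - profile (u_ n) x * k x)) by exact: ib.
rewrite (le_trans (le_normr_Rintegral _ ib))//.
apply: (@le_trans _ _ (\int[lambda]_(x in D0) (eps / (L + 1) * `|(1 + x) * k x|))).
  apply: le_Rintegral => //.
  - by move/integrable_norm : ib.
  - rewrite (_ : _ \o _ =
      (fun x => (eps / (L + 1))%:E * (EFin \o (fun x => `|(1 + x) * k x|%R)) x)%E).
      exact: integrableZl.
    by apply/funext => x /=; rewrite EFinM.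
  move=> x; rewrite /= in_itv/= andbT => x0.
  have -> : profile u x * k x - profile (u_ n) x * k x =
      (u (1 + x) - u_ n (1 + x)) * ((1 + x) * k x) by rewrite /profile; ring.
  rewrite normrM ler_wpM2r// distrC.
  by apply: hn; rewrite lerDl.
rewrite RintegralZl// -/L.
have -> : eps / (L + 1) * L = eps * (L / (L + 1)) by field; lra.
by rewrite ler_piMr ?ltW// ltr_pdivrMr//; lra.
Qed.

Lemma dotH01_Re_Im (f : R -> R[i]) : dotH01 f ->
  [/\ forall b, ac_on 1 b (Re f), forall b, ac_on 1 b (Im f),
      complex.Re (f 1) = 0 & complex.Im (f 1) = 0].
Proof.
move=> [acf f1 _ _]; split=> [b|b||]; rewrite ?f1//.
- exact: (ac_on_Re_Im (acf b)).1.
- exact: (ac_on_Re_Im (acf b)).2.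
Qed.

(** Finite energy makes the function bounded. *)
Lemma tempered_dotH01 (f : R -> R[i]) : dotH01 f ->
  tempered (Re f) /\ tempered (Im f).
Proof.
move=> Hf; have [acR acI R1 I1] := dotH01_Re_Im Hf.
have [K K0 hK] := @dirichlet_energy_sup R.
have [_ _ /cLnorm2_lty fin _] := Hf.
have [S S1 hS] : exists2 S : R, 0 < S & (sqnorm mu (cderive f) <= (S ^+ 2)%:E)%E.
  have s0 := sqnorm_ge0 mu (cderive f).
  have fn : sqnorm mu (cderive f) \is a fin_num by rewrite ge0_fin_numE.
  have s0' : 0 <= fine (sqnorm mu (cderive f)) by exact: fine_ge0.
  exists (1 + fine (sqnorm mu (cderive f))); first lra.
  rewrite -(fineK fn) lee_fin; nra.
split.
- apply: (@tempered_bounded _ (K * S)); first exact: ac_measurable.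
  move=> r r1; apply: (hK (Re f)) => //.
  by apply: le_trans hS; exact: (sqnorm_Re mu (cderive f)).
- apply: (@tempered_bounded _ (K * S)); first exact: ac_measurable.
  move=> r r1; apply: (hK (Im f)) => //.
  by apply: le_trans hS; exact: (sqnorm_Im mu (cderive f)).
Qed.

(** The energy bound is applied to the differences f_n - f. *)
Lemma H01_uniform_cvg (f_ : nat -> R -> R[i]) (f : R -> R[i]) :
  (forall n, dotH01 (f_ n)) -> dotH01 f ->
  (fun n => H01_norm (f_ n \- f)) @ \oo --> 0%E ->
  forall eps : R, 0 < eps -> \forall n \near \oo, forall r, 1 <= r ->
    `|complex.Re (f_ n r) - complex.Re (f r)| <= eps /\
    `|complex.Im (f_ n r) - complex.Im (f r)| <= eps.
Proof.
move=> Hf_ Hf /cLnorm2_cvg0P cv eps eps0.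
have [K K0 hK] := @dirichlet_energy_sup R.
have [acR acI R1 I1] := dotH01_Re_Im Hf.
pose eta := eps / (K + 1).
have eta0 : 0 < eta by rewrite divr_gt0//; lra.
have eta20 : 0 < eta ^+ 2 by rewrite exprn_gt0.
apply: filterS (cv _ eta20) => n hn r r1.
have [acRn acIn Rn1 In1] := dotH01_Re_Im (Hf_ n).
have Keta : K * eta <= eps.
  rewrite /eta; have -> : K * (eps / (K + 1)) = eps * (K / (K + 1)) by field; lra.
  by rewrite ler_piMr ?ltW// ltr_pdivrMr//; lra.
have ReE : (fun y => complex.Re ((f_ n \- f) y)) =
    (fun y => complex.Re (f_ n y) - complex.Re (f y)).
  by apply/funext => y; exact: Re_sub.
have ImE : (fun y => complex.Im ((f_ n \- f) y)) =
    (fun y => complex.Im (f_ n y) - complex.Im (f y)).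
  by apply/funext => y; exact: Im_sub.
split; apply: le_trans Keta.
- apply: (hK (fun y => complex.Re (f_ n y) - complex.Re (f y))) => //.
  + by move=> b; exact: ac_onB.
  + by rewrite Rn1 R1 subrr.
  + by apply: le_trans hn; rewrite -ReE; exact: (sqnorm_Re mu (cderive (f_ n \- f))).
- apply: (hK (fun y => complex.Im (f_ n y) - complex.Im (f y))) => //.
  + by move=> b; exact: ac_onB.
  + by rewrite In1 I1 subrr.
  + by apply: le_trans hn; rewrite -ImE; exact: (sqnorm_Im mu (cderive (f_ n \- f))).
Qed.

Lemma tempered_L2 (f : R -> R[i]) : radial_L2 f -> tempered (Re f) /\ tempered (Im f).
Proof. by move=> /radial_L2_profile[*]; split; exact: tempered_sqr. Qed.

Lemma propagated_uniform_limit t (u_ v_ w_ : nat -> R -> R) (u v w : R -> R) :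
  (forall n, [/\ tempered (u_ n), tempered (v_ n) & tempered (w_ n)]) ->
  tempered u -> tempered v -> tempered w ->
  (forall n, propagated t (u_ n) (v_ n) (w_ n)) ->
  (forall eps : R, 0 < eps -> \forall n \near \oo,
    forall r, 1 <= r -> `|u_ n r - u r| <= eps) ->
  (forall eps : R, 0 < eps -> \forall n \near \oo,
    forall r, 1 <= r -> `|v_ n r - v r| <= eps) ->
  (forall eps : R, 0 < eps -> \forall n \near \oo,
    forall r, 1 <= r -> `|w_ n r - w r| <= eps) ->
  propagated t u v w.
Proof.
move=> T_ tu tv tw P_ cu cv cw e y e0.
have sc := strongly_decaying_cos_kernel e0 t y.
have ss := strongly_decaying_sin_kernel e0 t y.
have sh := strongly_decaying_heat_odd y e0.
have ucv := uniform_cvg_pairing sc (fun n => let: And3 a _ _ := T_ n in a) tu cu.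
have vcv := uniform_cvg_pairing ss (fun n => let: And3 _ a _ := T_ n in a) tv cv.
have wcv := uniform_cvg_pairing sh (fun n => let: And3 _ _ a := T_ n in a) tw cw.
have uvcv := cvgD ucv vcv.
apply: (cvg_unique _ wcv) => //.
have E : (fun n => \int[lambda]_(x in D0) (profile (w_ n) x * heat_odd e y x)) =
    (fun n => \int[lambda]_(x in D0) (profile (u_ n) x * kernel (cos_chirp e t) y x) +
      \int[lambda]_(x in D0) (profile (v_ n) x * kernel (sin_chirp e t) y x)).
  by apply/funext => n; exact: P_.
by rewrite E; exact: uvcv.
Qed.

Lemma propagator_H01_propagated t (f g : R -> R[i]) : is_propagator_H01 t f g ->
  propagated t (Re f) (Im f) (Re g) /\
  propagated t (Im f) (fun r => - complex.Re (f r)) (Im g).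
Proof.
move=> [Hf Hg [f_ [g_ [P_ cf cg]]]].
have [tRf tIf] := tempered_dotH01 Hf; have [tRg tIg] := tempered_dotH01 Hg.
have Hf_ n : dotH01 (f_ n) by case: (P_ n).
have Hg_ n : dotH01 (g_ n) by case: (P_ n).
have L_ n : is_propagator_L2 t (f_ n) (g_ n) by case: (P_ n).
have ucf := H01_uniform_cvg Hf_ Hf cf; have ucg := H01_uniform_cvg Hg_ Hg cg.
have tf_ n := tempered_dotH01 (Hf_ n); have tg_ n := tempered_dotH01 (Hg_ n).
have pr n := propagator_L2_propagated (L_ n).
split.
- apply: (@propagated_uniform_limit t (fun n => Re (f_ n)) (fun n => Im (f_ n))
    (fun n => Re (g_ n))) => //.
  + by move=> n; split; [exact: (tf_ n).1|exact: (tf_ n).2|exact: (tg_ n).1].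
  + by move=> n; exact: (pr n).1.
  + by move=> eps e0; apply: filterS (ucf _ e0) => n h r /h[].
  + by move=> eps e0; apply: filterS (ucf _ e0) => n h r /h[].
  + by move=> eps e0; apply: filterS (ucg _ e0) => n h r /h[].
- apply: (@propagated_uniform_limit t (fun n => Im (f_ n))
    (fun n r => - complex.Re (f_ n r)) (fun n => Im (g_ n))) => //.
  + move=> n; split; [exact: (tf_ n).2| |exact: (tg_ n).2].
    exact: temperedN (tf_ n).1.
  + exact: temperedN.
  + by move=> n; exact: (pr n).2.
  + by move=> eps e0; apply: filterS (ucf _ e0) => n h r /h[].
  + move=> eps e0; apply: filterS (ucf _ e0) => n h r /h[hr _].
    by rewrite opprK addrC distrC.
  + by move=> eps e0; apply: filterS (ucg _ e0) => n h r /h[].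
Qed.

(** Since f and g are only known up to null sets, they are replaced by the sums
   f1 + f2 and g1 + g2. *)
Lemma propagator_propagated t (f g : R -> R[i]) : is_propagator t f g ->
  exists f' g' : R -> R[i],
    [/\ {ae mu, forall r, f r = f' r}, {ae mu, forall r, g r = g' r},
        [/\ tempered (Re f'), tempered (Im f'), tempered (Re g') & tempered (Im g')],
        propagated t (Re f') (Im f') (Re g') &
        propagated t (Im f') (fun r => - complex.Re (f' r)) (Im g')].
Proof.
move=> [f1 [f2 [g1 [g2 [P1 P2 ff gg]]]]].
exists (f1 \+ f2), (g1 \+ g2).
have [h [rf1 _ _] [_ rg1 _]] := P1; have [Hf2 Hg2 _] := P2.
have [tRf1 tIf1] := tempered_L2 rf1; have [tRg1 tIg1] := tempered_L2 rg1.
have [tRf2 tIf2] := tempered_dotH01 Hf2; have [tRg2 tIg2] := tempered_dotH01 Hg2.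
have [p1 q1] := propagator_L2_propagated P1.
have [p2 q2] := propagator_H01_propagated P2.
have ReD (a b : R -> R[i]) :
    (fun r => complex.Re ((a \+ b) r)) = (Re a) \+ (Re b).
  by apply/funext => r /=; case: (a r) (b r) => [? ?] [? ?].
have ImD (a b : R -> R[i]) :
    (fun r => complex.Im ((a \+ b) r)) = (Im a) \+ (Im b).
  by apply/funext => r /=; case: (a r) (b r) => [? ?] [? ?].
have NReD (a b : R -> R[i]) : (fun r => - complex.Re ((a \+ b) r)) =
    (fun r => - complex.Re (a r)) \+ (fun r => - complex.Re (b r)).
  by apply/funext => r /=; case: (a r) (b r) => [? ?] [? ?] /=; rewrite opprD.
split => //; rewrite ?NReD ?ReD ?ImD.
- by split; exact: temperedD.
- exact: propagatedD.
- by apply: propagatedD => //; exact: temperedN.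
Qed.

End tempered_functions.

(** * Approximation of the identity *)

Section approximate_identity.
Context {R : realType}.
Local Notation lambda := (@lebesgue_measure R).
Local Notation D0 := (`[0%R, +oo[%classic : set R).

(** The integral of a dominated function, measurable or not: its positive and
   negative parts are both dominated. *)
Lemma normr_Rintegral_le (f g : R -> R) : lambda.-integrable setT (EFin \o g) ->
  (forall x, `|f x| <= g x) -> `|\int[lambda]_x f x| <= \int[lambda]_x g x.
Proof.
have aux (a b c : R) : 0 <= a -> a <= c -> 0 <= b -> b <= c -> `|a - b| <= c.
  by move=> *; rewrite ler_norml; apply/andP; split; lra.
move=> ig fg; have fing := integrable_fin_num measurableT ig.
have part (h : R -> \bar R) : (forall x, 0 <= h x)%E -> (forall x, h x <= (g x)%:E)%E ->
    exists2 c : R, (\int[lambda]_x h x)%E = c%:E & 0 <= c <= \int[lambda]_x g x.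
  move=> h0 hg.
  have le : (\int[lambda]_x h x <= \int[lambda]_x (g x)%:E)%E.
    apply: ge0_le_integral_ae => // [x|]; last exact: aeW.
    exact: le_trans (h0 x) (hg x).
  have fin : (\int[lambda]_x h x)%E \is a fin_num.
    rewrite ge0_fin_numE; last exact: integral_ge0.
    by apply: le_lt_trans le _; rewrite ltey_eq fing.
  exists (fine (\int[lambda]_x h x)%E); first by rewrite fineK.
  by rewrite fine_ge0 ?integral_ge0//= /Rintegral fine_le.
rewrite [X in `|X|]/Rintegral Rintegral_posneg.
have [|x|P -> /andP[P0 P1]] := part (fun x => (Num.max (f x) 0)%:E).
- by move=> x; rewrite lee_fin le_max lexx orbT.
- by rewrite lee_fin ge_max (le_trans (ler_norm _) (fg x)) (le_trans (normr_ge0 _) (fg x)).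
have [|x|N -> /andP[N0 N1]] := part (fun x => (Num.max (- f x) 0)%:E).
- by move=> x; rewrite lee_fin le_max lexx orbT.
- rewrite lee_fin ge_max (le_trans (normr_ge0 _) (fg x)) andbT.
  by rewrite (le_trans (ler_norm _))// normrN.
exact: aux.
Qed.

Lemma integrable_heat (e x : R) : 0 < e ->
  lambda.-integrable setT (EFin \o (fun y => heat e (y - x))).
Proof.
move=> e0; have := @integrable_normal_pdf R x (Num.sqrt (2 * e)).
by congr (integrable _ _ _); apply/funext => y /=; rewrite (normal_heat e0).
Qed.

Lemma heat_mass (e x : R) : 0 < e -> \int[lambda]_y heat e (y - x) = 1.
Proof.
move=> e0; rewrite /Rintegral.
have -> : (\int[lambda]_y (heat e (y - x))%:E =
    \int[lambda]_y (normal_pdf x (Num.sqrt (2 * e)) y)%:E)%E.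
  by apply: eq_integral => y _; rewrite (normal_heat e0).
by rewrite integral_normal_pdf.
Qed.

Lemma heat_double (e z : R) : 0 < e ->
  heat e z = Num.sqrt 2 * expR (- (8 * e)^-1 * z ^+ 2) * heat (2 * e) z.
Proof.
move=> e0; rewrite /heat.
have -> : pi * (2 * e) = 2 * (pi * e) by ring.
rewrite [Num.sqrt (2 * _)]sqrtrM//; have s2 : Num.sqrt 2 != 0 :> R by rewrite gt_eqF// sqrtr_gt0.
have s : Num.sqrt (pi * e) != 0 by rewrite gt_eqF// sqrtr_gt0 mulr_gt0// pi_gt0.
have -> : - (4 * e)^-1 * z ^+ 2 = - (8 * e)^-1 * z ^+ 2 + - (4 * (2 * e))^-1 * z ^+ 2.
  by field; rewrite gt_eqF.
rewrite expRD; move: (Num.sqrt 2) (Num.sqrt (pi * e)) s2 s (expR _) (expR _).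
by move=> u v u0 v0 a b; field; rewrite u0 v0.
Qed.

Lemma le_heat_mass (e x : R) (D : set (measurableTypeR R)) : 0 < e -> measurable D ->
  0 <= \int[lambda]_(y in D) heat e (y - x) <= 1.
Proof.
move=> e0 mD; have ih := integrable_heat x e0.
rewrite Rintegral_ge0/=; last by move=> y _; exact: heat_ge0.
rewrite -(heat_mass x e0) /Rintegral fine_le//.
- by apply: integrable_fin_num => //; exact: integrableS ih.
- exact: integrable_fin_num.
- apply: ge0_subset_integral => //; first by case/integrableP: ih.
  by move=> y _; rewrite lee_fin heat_ge0.
Qed.

(** Half of the Gaussian exponent bounds the kernel at distance d, and the other
   half leaves a heat kernel of mass 1. *)
Lemma far_heat (e x d : R) (D : set (measurableTypeR R)) : 0 < e -> measurable D ->
  0 <= d -> (forall y, D y -> d <= `|y - x|) ->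
  \int[lambda]_(y in D) heat e (y - x) <= Num.sqrt 2 * expR (- (8 * e)^-1 * d ^+ 2).
Proof.
move=> e0 mD d0 hD; set c := Num.sqrt 2 * _.
have c0 : 0 <= c by rewrite mulr_ge0 ?expR_ge0.
have e20 : 0 < 2 * e by rewrite mulr_gt0.
have iD e' : 0 < e' -> lambda.-integrable D (EFin \o (fun y => heat e' (y - x))).
  by move=> h; exact: integrableS (integrable_heat x h).
apply: (@le_trans _ _ (\int[lambda]_(y in D) (c * heat (2 * e) (y - x)))).
  apply: le_Rintegral => //; first exact: iD.
  - rewrite (_ : _ \o _ = (fun y => c%:E * (EFin \o (fun y => heat (2 * e) (y - x)%R)) y)%E).
      by apply: integrableZl => //; exact: iD.
    by apply/funext => y /=; rewrite EFinM.
  move=> y Dy; rewrite (heat_double _ e0) ler_wpM2r ?heat_ge0// ler_wpM2l//.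
  rewrite ler_expR !mulNr lerN2 ler_wpM2l ?invr_ge0 ?mulr_ge0 ?(ltW e0)//.
  by rewrite -[leRHS]real_normK ?num_real// ler_pXn2r ?nnegrE// hD.
rewrite RintegralZl//; last exact: iD.
have /andP[_ h] := le_heat_mass x e20 mD.
by rewrite -[leRHS]mulr1 ler_wpM2l.
Qed.

(** As e tends to 0 this tends to the indicator of [p, q] on the half-line: the
   mirror image lives on [- q, - p]. *)
Definition window (p q e x : R) : R := \int[lambda]_(y in `[p, q]) heat_odd e y x.

Lemma windowE (p q e x : R) : 0 < e -> window p q e x =
  \int[lambda]_(y in `[p, q]) heat e (y - x) -
  \int[lambda]_(y in `[p, q]) heat e (y - - x).
Proof.
move=> e0; rewrite -RintegralB//; last 2 first.
- exact: integrableS (integrable_heat x e0).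
- exact: integrableS (integrable_heat (- x) e0).
apply: eq_Rintegral => y _; rewrite /heat_odd -[y - x]opprB heatN.
by rewrite opprK [y + x]addrC.
Qed.

Lemma window_near (p q e x d : R) : 0 < e -> 0 <= x -> 0 < d -> d <= p ->
  d <= `|x - p| -> d <= `|x - q| ->
  `|window p q e x - (p < x < q)%R%:R| <= 2 * (Num.sqrt 2 * expR (- (8 * e)^-1 * d ^+ 2)).
Proof.
move=> e0 x0 d0 dp dxp dxq; rewrite windowE//.
set dlt := Num.sqrt 2 * _.
have mI : measurable (`[p, q]%classic : set (measurableTypeR R)) by exact: measurable_itv.
have mC : measurable (~` `[p, q]%classic : set (measurableTypeR R)) by exact: measurableC.
have /andP[J0 _] := le_heat_mass (- x) e0 mI.
have J1 : \int[lambda]_(y in `[p, q]) heat e (y - - x) <= dlt.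
  apply: far_heat => //; first exact: ltW.
  move=> y /=; rewrite in_itv/= opprK => /andP[py _].
  by rewrite (le_trans _ (ler_norm _))//; lra.
have /andP[I0 _] := le_heat_mass x e0 mI.
have dlt0 : 0 <= dlt by exact: le_trans J1.
set I := \int[lambda]_(y in `[p, q]) heat e (y - x) in I0 *.
set J := \int[lambda]_(y in `[p, q]) heat e (y - - x) in J0 J1 *.
case: (boolP (p < x < q)) => [/andP[px xq]|out] /=.
  have /andP[K0 _] := le_heat_mass x e0 mC.
  have K1 : \int[lambda]_(y in ~` `[p, q]) heat e (y - x) <= dlt.
    apply: far_heat => //; first exact: ltW.
    move=> y /= /negP; rewrite in_itv/= negb_and -!ltNge.
    move: dxp dxq; rewrite ger0_norm ?subr_ge0 ?(ltW px)//.
    rewrite ler0_norm ?subr_le0 ?(ltW xq)// => dxp dxq.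
    by case/orP => h; rewrite real_ler_normr ?num_real//; apply/orP; [right|left]; lra.
  have E : I + \int[lambda]_(y in ~` `[p, q]) heat e (y - x) = 1.
    rewrite -(heat_mass x e0) -(setUv `[p, q]%classic) Rintegral_setU//.
    - by rewrite setUv; exact: integrable_heat.
    - by apply/disj_setPS => y [].
  by rewrite ler_norml /=; apply/andP; split; lra.
have I1 : I <= dlt.
  apply: far_heat => //; first exact: ltW.
  move=> y /=; rewrite in_itv/= => /andP[py yq].
  move: out dxp dxq; rewrite negb_and -!leNgt => /orP[h|h].
    rewrite ler0_norm ?subr_le0// => dxp _.
    by rewrite real_ler_normr ?num_real//; apply/orP; left; lra.
  move=> _; rewrite ger0_norm ?subr_ge0// => dxq.
  by rewrite real_ler_normr ?num_real//; apply/orP; right; lra.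
by rewrite subr0 ler_norml; apply/andP; split; lra.
Qed.

Lemma window_cvg (p q x : R) : 0 < p -> 0 <= x -> x != p -> x != q ->
  (fun n => window p q n.+1%:R^-1 x) @ \oo --> ((p < x < q)%R%:R : R).
Proof.
move=> p0 x0 xp xq.
pose d := Num.min p (Num.min `|x - p| `|x - q|).
have d0 : 0 < d by rewrite !lt_min p0 !normr_gt0 !subr_eq0 xp xq.
have dp : d <= p by rewrite ge_min lexx.
have dxp : d <= `|x - p| by rewrite !ge_min lexx orbT.
have dxq : d <= `|x - q| by rewrite !ge_min lexx !orbT.
pose c := 2 * (Num.sqrt 2 * (8 / d ^+ 2)).
have c0 : 0 <= c by rewrite !mulr_ge0// invr_ge0 sqr_ge0.
have cv : (fun n : nat => c * n.+1%:R^-1) @ \oo --> c * 0.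
  by apply: cvgM; [exact: cvg_cst|exact: cvg_harmonic].
rewrite mulr0 in cv.
apply/cvgrPdist_le => eps eps0.
move/cvgrPdist_le : cv => /(_ _ eps0); apply: filterS => n.
rewrite sub0r normrN => h.
have e0 : 0 < n.+1%:R^-1 :> R by rewrite invr_gt0.
rewrite distrC (le_trans (window_near e0 x0 d0 dp dxp dxq))// (le_trans _ (le_trans (ler_norm _) h))//.
rewrite /c -!mulrA ler_wpM2l// ler_wpM2l//.
set s := (8 * n.+1%:R^-1)^-1 * d ^+ 2.
have s0 : 0 < s by rewrite mulr_gt0 ?exprn_gt0// invr_gt0 mulr_gt0.
have -> : 8 * ((d ^+ 2)^-1 * n.+1%:R^-1) = s^-1.
  by rewrite /s; move: (n.+1%:R^-1) e0 => k k0; field; rewrite !gt_eqF.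
rewrite mulNr -/s expRN lef_pV2 ?posrE ?expR_gt0//.
by have := expR_ge1Dx s; lra.
Qed.

(** Domination uniform in e <= 1: at distance d from [p, q] the window is at most
   a multiple of exp(- d^2 / 8). *)
Lemma window_bound (p q : R) : 0 < p -> exists2 A, 0 <= A & forall e x,
  0 < e -> e <= 1 -> 0 <= x -> `|window p q e x| <= A * lorentz x ^+ 2.
Proof.
move=> p0; have k0 : 0 < 8^-1 :> R by rewrite invr_gt0.
have [A A0 hA] := shifted_gauss_decay q k0.
have [B B0 hB] := shifted_gauss_decay 0 k0.
have s20 : 0 <= Num.sqrt 2 :> R by exact: sqrtr_ge0.
exists (Num.sqrt 2 * A + (1 + q ^+ 2) ^+ 2 + Num.sqrt 2 * B) => [|e x e0 e1 x0].
  apply: addr_ge0; last exact: mulr_ge0.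
  by apply: addr_ge0; [exact: mulr_ge0|exact: sqr_ge0].
have l0 : 0 <= lorentz x ^+ 2 by exact: sqr_ge0.
have rate (z : R) : expR (- (8 * e)^-1 * z ^+ 2) <= expR (- 8^-1 * z ^+ 2).
  rewrite ler_expR !mulNr lerN2 ler_wpM2r ?sqr_ge0// lef_pV2 ?posrE ?mulr_gt0//.
  by rewrite ler_piMr.
have mI : measurable (`[p, q]%classic : set (measurableTypeR R)) by exact: measurable_itv.
rewrite windowE//; have /andP[J0 _] := le_heat_mass (- x) e0 mI.
have /andP[I0 I1] := le_heat_mass x e0 mI.
rewrite (le_trans (ler_normB _ _))// !ger0_norm// mulrDl lerD//.
  have [xq|qx] := leP x q.
    rewrite (le_trans I1)// mulrDl.
    have h1 : 1 <= (1 + q ^+ 2) ^+ 2 * lorentz x ^+ 2.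
      rewrite -exprMn expr_ge1// /lorentz; last first.
        by rewrite mulr_ge0 ?invr_ge0 ?addr_ge0 ?sqr_ge0.
      rewrite ler_pdivlMr; last by have := sqr_ge0 x; lra.
      by rewrite mul1r lerD2l ler_pXn2r ?nnegrE// (le_trans x0).
    rewrite (le_trans h1)// lerDr; apply: mulr_ge0 => //; exact: mulr_ge0.
  apply: (@le_trans _ _ (Num.sqrt 2 * A * lorentz x ^+ 2)); last first.
    by rewrite mulrDl lerDl mulr_ge0 ?sqr_ge0.
  have far y : (`[p, q]%classic : set R) y -> x - q <= `|y - x|.
    rewrite /= in_itv/= => /andP[_ yq].
    by rewrite real_ler_normr ?num_real//; apply/orP; right; lra.
  have xq0 : 0 <= x - q by rewrite subr_ge0 ltW.
  rewrite (le_trans (far_heat e0 mI xq0 far))// -mulrA ler_wpM2l//.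
  exact: le_trans (rate _) (hA _).
have far y : (`[p, q]%classic : set R) y -> x <= `|y - - x|.
  rewrite /= in_itv/= => /andP[py _].
  by rewrite opprK (le_trans _ (ler_norm _))//; lra.
rewrite (le_trans (far_heat e0 mI x0 far))// -mulrA ler_wpM2l//.
by apply: le_trans (rate _) _; have := hB x; rewrite subr0.
Qed.

End approximate_identity.

Section local_averages.
Context {R : realType}.
Local Notation lambda := (@lebesgue_measure R).
Local Notation D0 := (`[0%R, +oo[%classic : set R).
Local Notation RR := (measurableTypeR R).

Lemma continuous_heat (e : R) : 0 < e -> continuous (heat e).
Proof.
move=> e0; have <- : (fun x => heat e (x + 0)) = heat e.
  by apply/funext => x; rewrite addr0.
exact: (strongly_decaying_heat e0 0).1.
Qed.

Lemma strongly_decaying_lorentz2 : strongly_decaying (fun x : R => lorentz x ^+ 2).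
Proof.
split; last by exists 1 => x; rewrite mul1r ger0_norm ?sqr_ge0.
have cl : continuous (@lorentz R).
  move=> x; apply: cvgV; first by rewrite gt_eqF//; have := sqr_ge0 x; lra.
  have cp : continuous (fun x : R => 1 + x ^+ 2).
    by move=> z; eapply is_derive_cont; derive_tac; reflexivity.
  exact: cp.
have -> : (fun x : R => lorentz x ^+ 2) = (fun x => lorentz x * lorentz x).
  by apply/funext => x; rewrite expr2.
by move=> x; apply: cvgM; exact: cl.
Qed.

Lemma measurable_heat_diff (e : R) : 0 < e ->
  measurable_fun [set: RR * RR] (fun z : RR * RR => heat e (z.1 - z.2)) /\
  measurable_fun [set: RR * RR] (fun z : RR * RR => heat e (z.1 + z.2)).
Proof.
move=> e0; have mh : measurable_fun [set: RR] (heat e).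
  by apply: continuous_measurable_fun; exact: continuous_heat.
have md : measurable_fun [set: RR * RR] (fun z : RR * RR => z.1 - z.2 : RR).
  exact: measurable_funB.
have ms : measurable_fun [set: RR * RR] (fun z : RR * RR => z.1 + z.2 : RR).
  exact: measurable_funD.
by split; [exact: (measurableT_comp mh md)|exact: (measurableT_comp mh ms)].
Qed.

(** From (x - y)^2 >= x^2 / 2 - y^2. *)
Lemma heat_uniform_decay (e q : R) : 0 < e -> exists2 M, 0 <= M & forall x y,
  `|y| <= q -> heat e (x - y) <= M * lorentz x ^+ 2.
Proof.
move=> e0; have k0 : 0 < (8 * e)^-1 by rewrite invr_gt0 mulr_gt0.
have [A A0 hA] := shifted_gauss_decay 0 k0.
pose c := (2 * Num.sqrt (pi * e))^-1.
have c0 : 0 <= c by rewrite invr_ge0 mulr_ge0.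
exists (c * expR ((4 * e)^-1 * q ^+ 2) * A) => [|x y yq].
  by rewrite !mulr_ge0 ?expR_ge0.
rewrite /heat -/c mulrC -!mulrA ler_wpM2l//.
apply: (@le_trans _ _ (expR ((4 * e)^-1 * q ^+ 2) * expR (- (8 * e)^-1 * (x - 0) ^+ 2))).
  rewrite -expRD ler_expR subr0.
  have -> : (4 * e)^-1 = (8 * e)^-1 * 2 by field; rewrite gt_eqF.
  move: (8 * e)^-1 k0 => k k0.
  have yq2 : y ^+ 2 <= q ^+ 2.
    rewrite -[y ^+ 2]real_normK ?num_real// ler_pXn2r ?nnegrE//.
    exact: le_trans (normr_ge0 y) yq.
  have -> : - (k * 2) * (x - y) ^+ 2 =
      - k * x ^+ 2 + k * 2 * y ^+ 2 - k * (x - 2 * y) ^+ 2 by ring.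
  have := mulr_ge0 (ltW k0) (sqr_ge0 (x - 2 * y)).
  have : k * 2 * y ^+ 2 <= k * 2 * q ^+ 2 by rewrite ler_wpM2l// mulr_ge0// ltW.
  by rewrite mulNr; lra.
by rewrite ler_wpM2l ?expR_ge0.
Qed.

Variable (w : R -> R).
Hypothesis tw : tempered w.
Local Notation W := (profile w).

Let mD0 : measurable (D0 : set RR). Proof. exact: measurable_itv. Qed.

Let mW : measurable_fun D0 W. Proof. by apply: measurable_profile; exact: tw.1. Qed.

(** Fubini, after the weight (1 + x^2)^2 has been shifted from the profile to the
   kernel: the former becomes integrable, the latter remains bounded. *)
Lemma window_pairing (p q e : R) : 0 <= p -> 0 < e ->
  \int[lambda]_y ((\int[lambda]_(x in D0) (W x * heat_odd e y x)) * \1_(`[p, q]) y) =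
  \int[lambda]_(x in D0) (W x * window p q e x).
Proof.
move=> p0 e0.
pose I := (`[p, q]%classic : set RR).
have mI : measurable I by exact: measurable_itv.
pose F := (fun x => W x * lorentz x ^+ 2) \_ D0.
pose K x y : R := (1 + x ^+ 2) ^+ 2 * (heat_odd e y x * \1_I y).
have iF : lambda.-integrable setT (EFin \o F).
  rewrite /F -restrict_EFin; apply: (integrable_mkcond _ _).1 => //.
  exact: tw.2 strongly_decaying_lorentz2.
have iG : lambda.-integrable setT (EFin \o (\1_I : R -> R)).
  exact: integrable_indic_itv.
have [M M0 hM] := heat_uniform_decay q e0.
have hone (x : R) : (1 + x ^+ 2) ^+ 2 * lorentz x ^+ 2 = 1.
  rewrite -exprMn /lorentz mulfV ?expr1n// gt_eqF//.
  by have := sqr_ge0 x; lra.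
have weight (a b c d : R) : a * b = 1 -> a * c * (d * b) = d * c.
  by move=> ab; transitivity ((a * b) * (d * c)); [ring|rewrite ab mul1r].
have leK x y : `|K x y| <= M + M.
  rewrite /K indicE; case: (boolP (y \in I)) => [|_]; last first.
    by rewrite !mulr0 normr0 addr_ge0.
  rewrite inE /I /= in_itv/= => /andP[py yq]; rewrite mulr1 normrM.
  have yq' : `|y| <= q by rewrite ger0_norm// (le_trans p0).
  have Nyq' : `|- y| <= q by rewrite normrN.
  have -> : M + M = (1 + x ^+ 2) ^+ 2 * ((M + M) * lorentz x ^+ 2).
    by rewrite mulrCA hone mulr1.
  rewrite ger0_norm ?sqr_ge0// ler_wpM2l ?sqr_ge0//.
  rewrite /heat_odd mulrDl; apply: (le_trans (ler_normB _ _)); apply: lerD.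
    by rewrite ger0_norm; [exact: hM|exact: heat_ge0].
  rewrite ger0_norm; last exact: heat_ge0.
  by have := hM x (- y) Nyq'; rewrite opprK.
have [md ms] := measurable_heat_diff e0.
have mK : measurable_fun [set: RR * RR] (fun z => K z.1 z.2).
  apply: measurable_funM.
    have h : measurable_fun [set: RR] (fun x : RR => (1 + x ^+ 2) ^+ 2 : R).
      by apply: measurable_funX; apply: measurable_funD.
    exact: (measurableT_comp h).
  apply: measurable_funM; first exact: measurable_funB.
  have h : measurable_fun [set: RR] (\1_I : RR -> R) by exact: measurable_indic.
  exact: (measurableT_comp h).
have h := bounded_kernel_Fubini mK leK iF iG.
transitivity (\int[lambda]_y (\int[lambda]_x (K x y * F x) * \1_I y)).
  apply: eq_Rintegral => y _; rewrite indicE.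
  case: (boolP (y \in I)) => [yI|_]; last by rewrite !mulr0.
  congr (_ * _); rewrite Rintegral_mkcond; apply: eq_Rintegral => x _.
  rewrite /K /F indicE yI mulr1 !patchE; case: ifP => _; last by rewrite mulr0.
  by rewrite weight.
rewrite -h [RHS]Rintegral_mkcond; apply: eq_Rintegral => x _.
have -> : \int[lambda]_y (K x y * \1_I y) = (1 + x ^+ 2) ^+ 2 * window p q e x.
  rewrite /window -RintegralZl//; last first.
    have i1 := integrableS measurableT mI (@subsetT _ _) (integrable_heat x e0).
    have i2 := integrableS measurableT mI (@subsetT _ _) (integrable_heat (- x) e0).
    have := integrableB mI i1 i2.
    congr (integrable _ _ _); apply/funext => y /=.
    by rewrite -EFinB /heat_odd -[y - x]opprB heatN opprK [y + x]addrC.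
  rewrite [RHS]Rintegral_mkcond; apply: eq_Rintegral => y _.
  by rewrite /K indicE patchE; case: ifP => _; rewrite ?mulr1 ?mulr0.
rewrite /F !patchE; case: ifP => _; last by rewrite mulr0.
by rewrite weight.
Qed.

Lemma integrable_window_bound (A : R) :
  lambda.-integrable D0 (EFin \o (fun x => `|W x * (A * lorentz x ^+ 2)|)).
Proof.
have i := tw.2 _ strongly_decaying_lorentz2.
have iA : lambda.-integrable D0 (EFin \o (fun x => W x * (A * lorentz x ^+ 2))).
  rewrite (_ : _ \o _ = (fun x => A%:E * (EFin \o (fun x => (W x * lorentz x ^+ 2)%R)) x)%E).
    exact: integrableZl.
  by apply/funext => x /=; rewrite -EFinM mulrCA.
by move/integrable_norm : iA.
Qed.

Lemma integrable_profile_itv (p q : R) : 0 <= p ->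
  lambda.-integrable `[p, q] (EFin \o W).
Proof.
move=> p0; pose c := (1 + q ^+ 2) ^+ 2.
have sub : `[p, q]%classic `<=` D0.
  by move=> x /=; rewrite !in_itv/= andbT => /andP[px _]; rewrite (le_trans p0).
have mpq : measurable (`[p, q]%classic : set RR) by exact: measurable_itv.
apply: (le_integrable mpq _ _ (integrableS mD0 mpq sub (integrable_window_bound c))).
  by apply/measurable_EFinP; exact: measurable_funS mW.
move=> x /=; rewrite in_itv/= => /andP[px xq]; rewrite lee_fin normr_id [leRHS]normrM.
have x0 := le_trans p0 px; have q0 := le_trans x0 xq.
rewrite -[leLHS]mulr1 ler_wpM2l// (le_trans _ (ler_norm _))//.
rewrite /c -exprMn -[leLHS](expr1n _ 2) ler_pXn2r ?nnegrE//; last first.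
  by rewrite mulr_ge0 ?lorentz_ge0// addr_ge0 ?sqr_ge0.
rewrite /lorentz ler_pdivlMr; last by have := sqr_ge0 x; lra.
by rewrite mul1r lerD2l ler_pXn2r ?nnegrE//.
Qed.

Variable B : R.
Hypothesis B0 : 0 <= B.
Hypothesis hB : forall e y, 0 < e -> 0 <= y ->
  `|\int[lambda]_(x in D0) (W x * heat_odd e y x)| <= B * y.

Lemma window_average (p q e : R) : 0 <= p -> p < q -> 0 < e ->
  `|\int[lambda]_(x in D0) (W x * window p q e x)| <= B * q * (q - p).
Proof.
move=> p0 pq e0; rewrite -window_pairing//.
have iI : lambda.-integrable setT (EFin \o (\1_(`[p, q]) : R -> R)).
  exact: integrable_indic_itv.
have iBI : lambda.-integrable setT (EFin \o (fun y : R => B * q * \1_(`[p, q]) y)).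
  rewrite (_ : _ \o _ = (fun y => (B * q)%:E * (EFin \o (\1_(`[p, q]) : R -> R)) y)%E).
    exact: integrableZl.
  by apply/funext => y /=; rewrite EFinM.
apply: (le_trans (@normr_Rintegral_le _ _ _ iBI _)).
  move=> y; rewrite normrM indicE; case: (boolP (_ \in _)) => [|_]; last first.
    by rewrite normr0 !mulr0.
  rewrite inE/= in_itv/= => /andP[py yq]; rewrite normr1 !mulr1.
  by rewrite (le_trans (hB e0 (le_trans p0 py)))// ler_wpM2l.
have Bq : 0 <= B * q by rewrite mulr_ge0// (le_trans p0)// ltW.
rewrite RintegralZl//; apply: ler_wpM2l => //.
rewrite /Rintegral integral_indic//= setIT lebesgue_measure_itv/= lte_fin pq.
by rewrite -EFinB.
Qed.

(** Dominated convergence along e = 1 / (n + 1); at the endpoints p and q, which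
   form a null set, the window does not tend to the indicator. *)
Lemma interval_average (p q : R) : 0 < p -> p < q ->
  `|\int[lambda]_(x in `[p, q]) W x| <= B * q * (q - p).
Proof.
move=> p0 pq; have [A A0 hA] := window_bound q p0.
pose e n : R := n.+1%:R^-1.
have e0 n : 0 < e n by rewrite invr_gt0.
have e1 n : e n <= 1 by rewrite invf_le1// ler1n.
have mwin n : measurable_fun D0 (window p q (e n)).
  apply: measurable_funTS.
  have mI : measurable_fun [set: RR] (\1_(`[p, q]) : RR -> R).
    by apply: measurable_indic; exact: measurable_itv.
  have mT (k : RR * RR -> R) : measurable_fun [set: RR * RR] k -> (forall z, 0 <= k z) ->
      measurable_fun [set: RR] (fun x => \int[lambda]_y (k (x, y) * \1_(`[p, q]) y)).
    move=> mk k0; rewrite /Rintegral; apply: measurableT_comp => //.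
    apply: (@measurable_fun_fubini_tonelli_F _ _ _ _ R lambda
      (fun z : RR * RR => (k z * \1_(`[p, q]) z.2)%:E)).
      apply/measurable_EFinP; apply: measurable_funM => //.
      exact: (measurableT_comp mI).
    by move=> z; rewrite lee_fin mulr_ge0.
  have [md ms] := measurable_heat_diff (e0 n).
  have -> : window p q (e n) = (fun x =>
      \int[lambda]_y (heat (e n) (x - y) * \1_(`[p, q]) y) -
      \int[lambda]_y (heat (e n) (x + y) * \1_(`[p, q]) y)).
    apply/funext => x; rewrite windowE//; congr (_ - _);
      rewrite Rintegral_mkcond; apply: eq_Rintegral => y _; rewrite patchE indicE;
      case: ifP => _; rewrite ?mulr1 ?mulr0//.
      by rewrite -[y - x]opprB heatN.
    by rewrite opprK addrC.
  by apply: measurable_funB; [apply: (mT (fun z => heat (e n) (z.1 - z.2)))|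
    apply: (mT (fun z => heat (e n) (z.1 + z.2)))] => // z; exact: heat_ge0.
have mlim : measurable_fun D0 (fun x => W x * (p < x < q)%R%:R).
  apply: measurable_funM => //; apply: (@eq_measurable_fun _ _ _ _ _ (\1_(`]p, q[) : RR -> R)).
    by move=> x _; rewrite indicE; congr (_%:R); rewrite mem_setE in_itv.
  by apply: measurable_funTS; apply: measurable_indic; exact: measurable_itv.
have [||||| fi _ cv] := @dominated_convergence _ _ _ lambda D0 mD0
  (fun n => EFin \o (fun x => W x * window p q (e n) x))
  (EFin \o (fun x => W x * (p < x < q)%R%:R))
  (EFin \o (fun x => `|W x * (A * lorentz x ^+ 2)|)).
- by move=> n; apply/measurable_EFinP; apply: measurable_funM; [exact: mW|exact: mwin].
- by apply/measurable_EFinP; exact: mlim.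
- exists ([set p] `|` [set q]); split.
  + exact: measurableU.
  + apply: countable_lebesgue_measure0; apply: finite_set_countable.
    by rewrite finite_setU; split; exact: finite_set1.
  move=> x /= /not_implyP[x0]; apply: contra_notP => /not_orP[/eqP xp /eqP xq].
  apply: cvg_EFin; first exact: nearW.
  apply: cvgM; first exact: cvg_cst.
  by apply: window_cvg => //; move: x0; rewrite in_itv/= andbT.
- exact: integrable_window_bound.
- apply: aeW => x n /=; rewrite in_itv/= andbT => x0; rewrite lee_fin.
  rewrite normrM [leRHS]normrM ler_wpM2l// (le_trans _ (ler_norm _))//.
  exact: hA.
have E : \int[lambda]_(x in `[p, q]) W x =
    fine (\int[lambda]_(x in D0) (W x * (p < x < q)%R%:R)%:E)%E.
  transitivity (\int[lambda]_(x in `]p, q[) W x).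
    rewrite /Rintegral integral_itv_bndoo//; apply/measurable_EFinP.
    apply: measurable_funS mW => // x /=; rewrite !in_itv/= andbT => /andP[px _].
    by rewrite (le_trans (ltW p0))// ltW.
  rewrite Rintegral_mkcond.
  transitivity (\int[lambda]_(x in D0) (W x * (p < x < q)%R%:R)); last by [].
  rewrite [RHS]Rintegral_mkcond.
  apply: eq_Rintegral => x _; rewrite !patchE !mem_setE !in_itv/= andbT.
  case: (ltP p x) => px /=; last by rewrite mulr0 if_same.
  rewrite (le_trans (ltW p0) (ltW px)).
  by case: ifP => _; rewrite ?mulr1 ?mulr0.
have cv' : (fun n => \int[lambda]_(x in D0) (W x * window p q (e n) x)) @ \oo -->
    \int[lambda]_(x in `[p, q]) W x.
  by rewrite E; apply: fine_cvg; rewrite fineK//; exact: integrable_fin_num fi.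
apply: (cvgr_to_le (cvg_norm cv')); apply: nearW => n.
by apply: window_average => //; exact: ltW.
Qed.

End local_averages.

Section pointwise_bound.
Context {R : realType}.
Local Notation lambda := (@lebesgue_measure R).
Local Notation D0 := (`[0%R, +oo[%classic : set R).
Local Notation D1 := (`[1%R, +oo[%classic : set R).
Local Notation RR := (measurableTypeR R).
Local Notation mu := (@radial_measure R).

Lemma lebesgue_ae_shift (P : R -> Prop) :
  {ae lambda, forall x, P x} -> {ae lambda, forall r, P (r - 1)}.
Proof.
move=> [N [mN N0 PN]].
have ms : measurable_fun [set: RR] (fun r : RR => r - 1 : RR).
  exact: measurable_funB.
have mN' : measurable ((fun r : RR => r - 1 : RR) @^-1` N).
  by rewrite -[X in measurable X]setTI; exact: ms.
exists ((fun r : RR => r - 1 : RR) @^-1` N); split => //; last first.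
  by move=> r /= /PN.
set N' := _ @^-1` N in mN' *.
have E (A : set RR) : measurable A -> (lambda A = \int[lambda]_x (\1_A x)%:E)%E.
  by move=> mA; rewrite integral_indic// setIT.
rewrite E// (ge0_integral_shift 1).
- rewrite -N0 E//; apply: eq_integral => x _; rewrite !indicE; congr ((nat_of_bool _)%:R%:E).
  by apply/idP/idP; rewrite !inE /N'/= (_ : 1 + x - 1 = x)//; ring.
- by apply/measurable_EFinP; exact: measurable_indic.
- by move=> x; rewrite lee_fin.
Qed.

Section averages.
Variables (w : R -> R) (B : R).
Hypotheses (tw : tempered w) (B0 : 0 <= B)
  (hB : forall e y, 0 < e -> 0 <= y ->
    `|\int[lambda]_(x in D0) (profile w x * heat_odd e y x)| <= B * y).
Local Notation W := (profile w).

(** Lebesgue differentiation: at a Lebesgue point, W x is the limit of the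
   averages over [x, x + h], which are at most B (x + h). *)
Lemma profile_bound_ae : {ae lambda, forall x, 0 < x -> `|W x| <= B * x}.
Proof.
suff : {ae lambda, forall x, forall N : nat, 0 < x -> x < N%:R -> `|W x| <= B * x}.
  apply: ae_mono => x h x0.
  exact: (h (Num.truncn x).+1 x0 (truncnS_gt x)).
apply: ae_foralln => N.
pose f := W \_ `[0%R, N%:R].
have iF : lambda.-integrable setT (EFin \o f).
  rewrite /f -restrict_EFin; apply: (integrable_mkcond _ _).1.
    exact: measurable_itv.
  exact: integrable_profile_itv.
have sub (A : set RR) : measurable A -> lambda.-integrable A (EFin \o f).
  by move=> mA; exact: integrableS iF.
have locf : locally_integrable setT f.
  by apply: open_integrable_locally => //; exact: openT.
have := @FTC1 R f (BLeft 0) (fun y => sub _ (measurable_itv _)) locf.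
apply: ae_mono => x h x0 xN.
have [dF dFE] := h x0.
have fW y : 0 <= y -> y <= N%:R -> f y = W y.
  by move=> y0 yN; rewrite /f patchE mem_set//= in_itv/= y0.
rewrite fW ?ltW// derive1E in dFE.
set F := (fun x : R => \int[lambda]_(t in `[0, x]) f t) in dF dFE.
have cv : (fun h : R => h^-1 * (F (x + h) - F x)) @ (0 : R)^' --> W x.
  have -> : (fun h : R => h^-1 * (F (x + h) - F x)) =
      (fun h : R => h^-1 *: ((F (h *: (1 : R^o) + x) : R^o) - F x)).
    apply/funext => k; rewrite -[RHS]/(k^-1 * (F (k * 1 + x) - F x)).
    by rewrite mulr1 [k + x]addrC.
  by rewrite -dFE; exact: dF.
apply/ler_addgt0Pr => eps eps0.
have cvn : (fun h : R => `|h^-1 * (F (x + h) - F x)|) @ (0 : R)^'+ --> `|W x|.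
  exact: (cvg_norm (cvg_dnbhs_at_right cv)).
apply: (cvgr_to_le cvn).
have B1 : 0 < B + 1 by rewrite ltr_wpDl.
have d0 : 0 < eps / (B + 1) by rewrite divr_gt0.
have xN0 : 0 < N%:R - x by rewrite subr_gt0.
near=> k.
have k0 : 0 < k by near: k; exact: nbhs_right_gt.
have kN : k <= N%:R - x by near: k; exact: nbhs_right_le.
have ke : k <= eps / (B + 1) by near: k; exact: nbhs_right_le.
have FB : F (x + k) - F x = \int[lambda]_(t in `[x, x + k]) W t.
  rewrite /F Rintegral_itvB//.
  - rewrite Rintegral_itv_obnd_cbnd; last by apply: sub; exact: measurable_itv.
    apply: eq_Rintegral => t; rewrite inE/= in_itv/= => /andP[xt txk].
    by apply: fW; [exact: le_trans (ltW x0) xt|lra].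
  - by apply: sub; exact: measurable_itv.
  - by rewrite bnd_simp ltW.
  - by rewrite bnd_simp; lra.
rewrite FB normrM gtr0_norm ?invr_gt0//.
have xk : x < x + k by rewrite ltrDl.
have := interval_average tw B0 hB x0 xk.
have -> : x + k - x = k by ring.
rewrite [B * (x + k) * k]mulrC => hk.
rewrite ler_pdivrMl//; apply: (le_trans hk).
apply: ler_wpM2l; first exact: ltW.
rewrite mulrDr lerD2l.
apply: (@le_trans _ _ (B * (eps / (B + 1)))); first by rewrite ler_wpM2l.
rewrite mulrCA ler_piMr//; first exact: ltW.
by rewrite ler_pdivrMr// mul1r lerDl.
Unshelve. all: by end_near. Qed.

(** At r = 1 + x the bound on the profile reads |w r| r <= B (r - 1). *)
Lemma radial_bound_ae : {ae mu, forall r, `|w r| <= B}.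
Proof.
have r1 : {ae lambda, forall r : R, r != 1}.
  exists [set 1]; split; [exact: measurable_set1|exact: lebesgue_measure_set1|].
  by move=> r /= /negP; rewrite negbK => /eqP.
have h : {ae lambda, forall r, r != 1 -> 1 <= r -> `|w r| <= B}.
  apply: ae_mono (lebesgue_ae_shift profile_bound_ae) => r hr r1' r1''.
  have rgt : 1 < r by rewrite lt_neqAle eq_sym r1'.
  have r0 : 0 < r by rewrite (lt_trans ltr01).
  have := hr; rewrite subr_gt0 => /(_ rgt).
  rewrite /profile (_ : 1 + (r - 1) = r); last by ring.
  rewrite normrM (gtr0_norm r0) => hw.
  rewrite -(ler_pM2r r0) (le_trans hw)// ler_wpM2l// lerBlDr lerDl//.
have := radial_ae_D1 (R := R).
have h' := radial_ae_of_lebesgue (ae_mono2 _ h r1).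
apply: ae_mono2 (h' _ (fun r a b => a b)) => r hr.
by rewrite /= in_itv/= andbT; exact: hr.
Qed.

End averages.
End pointwise_bound.

(** * The dispersive estimate *)

Section dispersive_estimate.
Context {R : realType}.
Local Notation lambda := (@lebesgue_measure R).
Local Notation D0 := (`[0%R, +oo[%classic : set R).
Local Notation D1 := (`[1%R, +oo[%classic : set R).
Local Notation mu := (@radial_measure R).
Local Notation Re f := (fun r => complex.Re (f r)).
Local Notation Im f := (fun r => complex.Im (f r)).

(** The kernel vanishes linearly at the boundary, and the factor x <= r turns
   |u| r dr into |u| r^2 dr. *)
Lemma pairing_le_L1 (u k : R -> R) (c L : R) : tempered u -> strongly_decaying k ->
  0 <= c -> (forall x, 0 <= x -> `|k x| <= c * x) ->
  (\int[mu]_r (`|u r|)%:E <= L%:E)%E ->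
  `|\int[lambda]_(x in D0) (profile u x * k x)| <= c * L.
Proof.
move=> [mu1 iu] sk c0 hk hL.
have iuk := iu _ sk.
have mu0 : measurable_fun D0 (fun x => u (1 + x)) by exact: measurable_shift1.
rewrite (le_trans (le_normr_Rintegral _ iuk))// -lee_fin /Rintegral fineK; last first.
  by apply: integrable_fin_num => //; move/integrable_norm : iuk.
apply: (@le_trans _ _ (\int[lambda]_(x in D0) (c%:E * (`|u (1 + x)| * (1 + x) ^+ 2)%:E))%E).
  apply: ge0_le_integral => //.
  - by move/integrable_norm : iuk => /integrableP[].
  - apply: emeasurable_funM => //; apply/measurable_EFinP; apply: measurable_funM.
      exact: measurableT_comp.
    by apply: measurable_funTS; apply: measurable_funX; apply: measurable_funD.
  move=> x /=; rewrite in_itv/= andbT => x0; rewrite -EFinM lee_fin /profile !normrM.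
  have x1 : 0 <= 1 + x by lra.
  rewrite (ger0_norm x1) mulrCA -mulrA; apply: ler_wpM2l => //.
  rewrite expr2 mulrCA; apply: ler_wpM2l => //.
  by rewrite (le_trans (hk x x0))// ler_wpM2l// lerDr.
rewrite ge0_integralZl//.
- rewrite EFinM; apply: lee_wpmul2l; first by rewrite lee_fin.
  apply: le_trans hL; rewrite ge0_radial_integral0.
  + by rewrite le_eqVlt; apply/orP; left; apply/eqP; apply: eq_integral.
  + by apply/measurable_EFinP; exact: measurableT_comp.
  + by move=> x; rewrite lee_fin.
- apply/measurable_EFinP; apply: measurable_funM.
    exact: measurableT_comp.
  by apply: measurable_funTS; apply: measurable_funX; apply: measurable_funD.
- by move=> x _; rewrite lee_fin mulr_ge0 ?sqr_ge0.
Qed.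

(** The two kernels are at most a multiple of decay_rate t * y * x; since they
   are paired with real and imaginary part, the constants add up. *)
Lemma propagated_bound t (u v w : R -> R) (L : R) : t != 0 -> 0 <= L ->
  tempered u -> tempered v -> tempered w -> propagated t u v w ->
  (\int[mu]_r (`|u r|)%:E <= L%:E)%E -> (\int[mu]_r (`|v r|)%:E <= L%:E)%E ->
  {ae mu, forall r, `|w r| <= 3 / pi * decay_rate t * L}.
Proof.
move=> t0 L0 tu tv tw P uL vL.
have d0 := decay_rate_ge0 t.
have p0 : 0 <= pi^-1 :> R by rewrite invr_ge0 pi_ge0.
apply: radial_bound_ae => //.
  by rewrite mulr_ge0// mulr_ge0// mulr_ge0.
move=> e y e0 y0; rewrite (P e y e0).
pose c := pi^-1 * (3 / 2 * decay_rate t) * y.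
have c0 : 0 <= c by rewrite mulr_ge0// mulr_ge0// mulr_ge0// divr_ge0.
have hc x : 0 <= x -> `|kernel (cos_chirp e t) y x| <= c * x.
  move=> x0; apply: le_trans (cos_kernel_dispersive e0 t0 x0 y0) _.
  by rewrite /c le_eqVlt; apply/orP; left; apply/eqP; ring.
have hs x : 0 <= x -> `|kernel (sin_chirp e t) y x| <= c * x.
  move=> x0; apply: le_trans (sin_kernel_dispersive e0 t0 x0 y0) _.
  by rewrite /c le_eqVlt; apply/orP; left; apply/eqP; ring.
have h1 := pairing_le_L1 tu (strongly_decaying_cos_kernel e0 t y) c0 hc uL.
have h2 := pairing_le_L1 tv (strongly_decaying_sin_kernel e0 t y) c0 hs vL.
rewrite (le_trans (ler_normD _ _))// (le_trans (lerD h1 h2))//.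
rewrite /c; move: (pi^-1) (decay_rate t) => p d.
by rewrite le_eqVlt; apply/orP; left; apply/eqP; field.
Qed.

Lemma decay_rateE (t : R) : decay_rate t = Num.sqrt pi / `|t| `^ (3 / 2).
Proof.
rewrite /decay_rate; congr (_ / _).
have [->|t0] := eqVneq t 0; first by rewrite normr0 mul0r powR0// mulf_neq0// invr_neq0.
rewrite (_ : 3 / 2 = 1 + 2^-1 :> R); last by field.
rewrite powRD; last by apply/implyP => _; rewrite normr_eq0.
by rewrite powRr1// powR12_sqrt.
Qed.

Lemma Loo_norm_le (f : R -> R[i]) (B : R) : 0 <= B ->
  {ae mu, forall r, Normc.normc (f r) <= B} -> (Loo_norm f <= B%:E)%E.
Proof.
move=> B0 h; rewrite /Loo_norm /cLnorm unlock.
case: ifP => _; last by rewrite lee_fin.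
apply/ess_supP; apply: ae_mono h => r hr /=.
by rewrite lee_fin ger0_norm ?normc_ge0.
Qed.

Lemma cLnorm1E (f : R -> R[i]) : cLnorm mu 1%:E f = (\int[mu]_r (Normc.normc (f r))%:E)%E.
Proof.
rewrite /cLnorm Lnorm1; apply: eq_integral => r _ /=.
by rewrite ger0_norm ?normc_ge0.
Qed.

End dispersive_estimate.

Local Close Scope classical_set_scope.

Theorem lemma2p1 (R : realType) :
  exists C : R, forall (t : R) (f : R -> R[i]),
    t != 0 -> L2_plus_H01 f ->
    forall g : R -> R[i], is_propagator t f g ->
      (Loo_norm g <= (C / `|t| `^ (3 / 2))%:E * L1_norm f)%E.
Proof.
pose c : R := 6 / pi * Num.sqrt pi.
have pi0 : 0 < pi :> R by exact: pi_gt0.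
have c0 : 0 < c by rewrite mulr_gt0 ?divr_gt0 ?sqrtr_gt0.
exists (c / (4 * pi)) => t f t0 _ g Hp.
have t1 : 0 < `|t| `^ (3 / 2) by rewrite powR_gt0// normr_gt0.
have C0 : 0 < c / (4 * pi) / `|t| `^ (3 / 2) by rewrite !divr_gt0// mulr_gt0.
rewrite /L1_norm cLnorm1E; set I := (\int[_]_r _)%E.
have I0 : (0 <= I)%E by apply: integral_ge0 => r _; rewrite lee_fin normc_ge0.
have [I_fin|] := boolP (I \is a fin_num); last first.
  rewrite ge0_fin_numE// -leNgt leye_eq => /eqP ->.
  by rewrite gt0_muley ?lte_fin ?mulr_gt0// gt0_muley ?lte_fin// leey.
have [L L0 IL] : exists2 L : R, 0 <= L & I = L%:E.
  by exists (fine I); rewrite ?fine_ge0// fineK.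
have [f' [g' [ff gg [tRf tIf tRg tIg] pR pI]]] := propagator_propagated Hp.
have f'L : (\int[@radial_measure R]_r (Normc.normc (f' r))%:E = L%:E)%E.
  rewrite -IL /I; apply: ge0_eq_integral_ae => [r|r|]; rewrite ?lee_fin ?normc_ge0//.
  by apply: ae_mono ff => r ->.
have RfL : (\int[@radial_measure R]_r (`|complex.Re (f' r)|)%:E <= L%:E)%E.
  rewrite -f'L; apply: ge0_le_integral_ae => [r|r|]; rewrite ?lee_fin ?normc_ge0//.
  by apply: aeW => r; rewrite lee_fin Re_le_normc.
have IfL : (\int[@radial_measure R]_r (`|complex.Im (f' r)|)%:E <= L%:E)%E.
  rewrite -f'L; apply: ge0_le_integral_ae => [r|r|]; rewrite ?lee_fin ?normc_ge0//.
  by apply: aeW => r; rewrite lee_fin Im_le_normc.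
have NRfL : (\int[@radial_measure R]_r (`|- complex.Re (f' r)|)%:E <= L%:E)%E.
  by under eq_integral do rewrite normrN.
have bR := propagated_bound t0 L0 tRf tIf tRg pR RfL IfL.
have bI := propagated_bound t0 L0 tIf (temperedN tRf) tIg pI IfL NRfL.
rewrite IL -!EFinM; apply: Loo_norm_le.
  by apply: mulr_ge0; [exact: ltW|apply: mulr_ge0 => //; rewrite mulr_ge0// ltW].
apply: ae_mono2 (ae_mono2 (fun r a b => conj a b) bR bI) gg => r [hR hI] ->.
rewrite (le_trans (normc_le_Re_Im _))// (le_trans (lerD hR hI))// decay_rateE /c.
have pn : pi != 0 :> R by rewrite gt_eqF.
have tn : `|t| `^ (3 / 2) != 0 by rewrite gt_eqF.
rewrite le_eqVlt; apply/orP; left; apply/eqP.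
move: pn tn (Num.sqrt pi); move: (pi : R) (`|t| `^ (3 / 2)) => p T pn tn s.
by field; rewrite pn tn.
Qed.
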